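(* Let $n\ge2$. For each conjugacy class $C$ of $\mathfrak A_n$ fix $w_C\in C_{\min}$. For every $w\in\mathfrak A_n$ there exist Laurent polynomials $g_{C,w}\in\mathbb Z[\frac12,x,x^{-1}]$ ($C$ running over the conjugacy classes of $\mathfrak A_n$), independent of $\lambda$, satisfying $\chi^\mu_{\mathscr A}(A_w)=\sum_C g_{C,w}(q)\chi^\mu_{\mathscr A}(A_{w_C})$ for all partitions $\mu$ of $n$, and for every self-conjugate partition $\lambda=\lambda'$ of $n$, with $h(\lambda)=(h_1,\dots,h_{d(\lambda)})$, there exists a polynomial $a^\lambda_w(q)\in\mathbb Z[q-q^{-1}]$ with $\deg_q a^\lambda_w(q)\le\ell(w)-\ell(w_{h(\lambda)})$ and $\chi^\lambda(T_w\tau)=(-\sqrt{-1})^{\frac12(n-d(\lambda))}a^\lambda_w(q)q^{-\frac n2}\prod_{i=1}^{d(\lambda)}\sqrt{[h_i]}$, which is nonzero as a polynomial only if $w\rightsquigarrow w_\kappa$ for some composition $\kappa$ of $n$ with $\vec\kappa=h(\lambda)$, such that $$\chi^{\lambda\pm}_{\mathscr A}(A_w)=\frac12\sum_{C}g_{C,w}(q)\,\chi^\lambda_{\mathscr A}(A_{w_C})\ \pm\ \frac12(-\sqrt{-1})^{\frac12(n-d(\lambda))}\,a^\lambda_w(q)\,q^{-\frac n2}\prod_{i=1}^{d(\lambda)}\sqrt{[h_i]},$$ where the sum is over the conjugacy classes $C$ of $\mathfrak A_n$.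
   Context: **Field.** $\mathbb F$ is a field of characteristic different from $2$ and $q\in\mathbb F$ is nonzero. For $k\ge0$ put $[k]=q+q^3+\dots+q^{2k-1}$ and $[-k]=-q^{-2k}[k]$. Assume that $-1$ and $[k]$, $1\le k\le n$, are nonzero and have square roots in $\mathbb F$, and fix square roots $\sqrt{-1}$, $\sqrt{[k]}$; put $\sqrt{[0]}=0$. Write $q^{1/2}=\sqrt{[1]}$, so $q^{-n/2}=(\sqrt{[1]})^{-n}$. An element of $\mathbb Z[q-q^{-1}]$ is $P(q-q^{-1})$ with $P\in\mathbb Z[x]$, regarded as a polynomial whose $\deg_q$ is $\deg P$ (zero polynomial: $-\infty$), and evaluated at $q\in\mathbb F$ in the displayed equations. **Hecke algebra.** $\mathfrak S_n$ is the symmetric group, $\mathfrak A_n$ the alternating group, $s_i=(i,i+1)$, $S=\{s_1,\dots,s_{n-1}\}$, $\ell$ the Coxeter length on $\mathfrak S_n$, $\varepsilon_w=(-1)^{\ell(w)}$. $\mathcal H_q(\mathfrak S_n)$ is the unital associative $\mathbb F$-algebra with generators $T_1,\dots,T_{n-1}$ and relations $(T_i-q)(T_i+q^{-1})=0$, $T_iT_j=T_jT_i$ for $|i-j|>1$, $T_iT_{i+1}T_i=T_{i+1}T_iT_{i+1}$. For a reduced expression $w=s_{i_1}\cdots s_{i_k}$ put $T_w=T_{i_1}\cdots T_{i_k}$. Let $\#$ be the algebra automorphism with $T_w^\#=\varepsilon_wT_{w^{-1}}^{-1}$. The alternating Hecke algebra is $\mathcal H_q(\mathfrak A_n)=\{a\in\mathcal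 H_q(\mathfrak S_n):a^\#=a\}$. Put $A_w=\frac12(T_w+\varepsilon_wT_w^\#)$. **Conjugacy classes and compositions.** For a conjugacy class $C$ of $\mathfrak A_n$, $C_{\min}$ is the set of elements of $C$ of minimal length. For a composition $\kappa=(\kappa_1,\dots,\kappa_d)$ of $n$, $\vec\kappa$ is the partition obtained by sorting its parts, and $w_\kappa$ is the product, in increasing order of $i$, of all $s_i$ with $1\le i<n$ and $i\notin\{\kappa_1,\kappa_1+\kappa_2,\dots,\kappa_1+\dots+\kappa_{d-1}\}$. Write $x\xrightarrow{s}y$ ($s\in S$) if $y=sxs$ and $\ell(y)\le\ell(x)$; $\longrightarrow$ is the reflexive and transitive closure. $\rightsquigarrow$ is the transitive relation on $\mathfrak S_n$ generated by: $w\rightsquigarrow v$ if either $w\longrightarrow v$, or there is $s\in S$ with $\ell(w)=\ell(sws)$, $v\in\{sw,ws\}$, $\ell(v)=\ell(w)-1$. **Partitions and Specht modules.** $\lambda'$ is the conjugate of $\lambda$. If $\lambda=\lambda'$, $d(\lambda)=\max\{i:\lambda_i\ge i\}$ and $h_i=\lambda_i+\lambda_i'-2i+1$. $\mathrm{Std}(\lambda)$ is the set of standard $\lambda$-tableaux; $\mathfrak t'$ is the conjugate (transposed) tableau; $\mathfrak t s_i$ swaps $i$ and $i+1$ in $\mathfrak t$. If $i$ is in row $r$, column $c$ of $\mathfrak t$, then $c_{\mathfrak t}(i)=c-r$; $\rho_{\mathfrak t}(i)=c_{\mathfrak t}(i)-c_{\mathfrak t}(i+1)$. For $k>0$ put $\alpha_k=\sqrt{-1}\sqrt{[k+1]}\sqrt{[k-1]}/[k]$,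 $\alpha_{-k}=-\alpha_k$; $\alpha_{\mathfrak t}(i)=\alpha_{\rho_{\mathfrak t}(i)}$ if $\mathfrak t s_i$ is standard and $0$ otherwise. $S(\lambda)$ is the right $\mathcal H_q(\mathfrak S_n)$-module with basis $\{v_{\mathfrak t}:\mathfrak t\in\mathrm{Std}(\lambda)\}$ and $v_{\mathfrak t}T_i=\frac{-1}{[\rho_{\mathfrak t}(i)]}v_{\mathfrak t}+\alpha_{\mathfrak t}(i)v_{\mathfrak ts_i}$ for $1\le i<n$. **Characters.** $\chi^\lambda_{\mathscr A}$ is the character of the restriction of $S(\lambda)$ to $\mathcal H_q(\mathfrak A_n)$. For $\lambda=\lambda'$, $\tau$ is the linear endomorphism of $S(\lambda)$ with $v_{\mathfrak t}\mapsto v_{\mathfrak t'}$; $\chi^\lambda(h\tau)$ is the trace on $S(\lambda)$ of the composite of right multiplication by $h$ and $\tau$; $S(\lambda)^\pm$ is the span of the $v_{\mathfrak t}\pm v_{\mathfrak t'}$ with $\mathfrak t\in\mathrm{Std}(\lambda)$ having $2$ in its first row, an $\mathcal H_q(\mathfrak A_n)$-submodule of $S(\lambda)$, and $\chi^{\lambda\pm}_{\mathscr A}$ is its character. *)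

(* Defs.v *)
From HB Require Import structures.
From Stdlib Require Import Relation_Operators.
From mathcomp Require Import all_boot all_order all_algebra.
From mathcomp Require Import all_fingroup all_solvable.

Set Implicit Arguments.
Unset Strict Implicit.
Unset Printing Implicit Defensive.

Import GRing.Theory.
Local Open Scope ring_scope.

(* Indices are shifted by one: k : 'I_n stands for k + 1 in {1, .., n}, and
   i : 'I_n.-1 stands for i + 1 in {1, .., n - 1}. *)

Section SymmetricGroup.
Variable n : nat.

Lemma hi_ord_subproof (i : 'I_n.-1) : (i.+1 < n)%N.
Proof. by case: n i => [[]|m] //= i; rewrite ltnS. Qed.

Definition lo_ord (i : 'I_n.-1) : 'I_n := widen_ord (leq_pred n) i.
Definition hi_ord (i : 'I_n.-1) : 'I_n := Ordinal (hi_ord_subproof i).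

Definition simple_refl (i : 'I_n.-1) : 'S_n := tperm (lo_ord i) (hi_ord i).

Definition word_perm (s : seq 'I_n.-1) : 'S_n :=
  (\prod_(i <- s) simple_refl i)%g.

Lemma word_perm_tperm (x y : 'I_n) : exists s, tperm x y = word_perm s.
Proof.
wlog lexy : x y / (x <= y)%N.
  by move=> W; case/orP: (leq_total x y) => /W // [s]; exists s; rewrite tpermC.
have [d] := ubnP (y - x)%N; elim: d => // d IHd in x y lexy *.
rewrite ltnS => ledxy; have [->|neqxy] := eqVneq x y.
  by exists [::]; rewrite tperm1 /word_perm big_nil.
have ltxy : (x < y)%N by rewrite ltn_neqAle lexy andbT.
have y0 : (0 < y)%N by apply: leq_ltn_trans ltxy.
have ilt : (y.-1 < n.-1)%N by rewrite -ltnS !prednK // (leq_trans _ (ltn_ord y)).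
pose i := Ordinal ilt.
have hiE : hi_ord i = y by apply/val_inj; rewrite /= prednK.
have lolt : (lo_ord i < y)%N by rewrite /= prednK.
have [|//|s sE] := IHd x (lo_ord i).
- by rewrite -ltnS /= prednK.
- by apply: leq_trans ledxy; rewrite /= ltn_sub2r.
have [<-|neqxi] := eqVneq (lo_ord i) x.
  by exists [:: i]; rewrite /word_perm big_seq1 /simple_refl hiE.
exists (i :: rcons s i).
rewrite /word_perm big_cons -cats1 big_cat big_seq1 /= -/(word_perm s) -sE.
have -> : tperm x y = (tperm x (lo_ord i) ^ simple_refl i)%g.
  by rewrite tpermJ /simple_refl tpermL hiE tpermD // eq_sym.
by rewrite /conjg /simple_refl tpermV.
Qed.

Lemma word_perm_surj (w : 'S_n) :
  exists k, [exists s : k.-tuple 'I_n.-1, word_perm s == w].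
Proof.
suff [s <-] : exists s, word_perm s = w.
  by exists (size s); apply/existsP; exists (in_tuple s).
have [ts -> _] := prod_tpermP w; elim: ts => [|xy ts [s sE]].
  by exists [::]; rewrite /word_perm !big_nil.
have [s0 s0E] := word_perm_tperm xy.1 xy.2.
by exists (s0 ++ s); rewrite big_cons s0E -sE /word_perm big_cat.
Qed.

Definition coxlen (w : 'S_n) : nat := ex_minn (word_perm_surj w).

Lemma reduced_word_subproof (w : 'S_n) :
  exists s : (coxlen w).-tuple 'I_n.-1, word_perm s == w.
Proof. by rewrite /coxlen; case: ex_minnP => k /existsP. Qed.

Definition reduced_word (w : 'S_n) : seq 'I_n.-1 :=
  xchoose (reduced_word_subproof w).

Definition min_length (C : {set 'S_n}) : {set 'S_n} :=
  [set w in C | [forall v in C, (coxlen w <= coxlen v)%N]].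

Definition cyclic_step (x y : 'S_n) : bool :=
  [exists i, (y == simple_refl i * x * simple_refl i)%g]
    && (coxlen y <= coxlen x)%N.

Definition drop_step (w v : 'S_n) : bool :=
  [exists i, let s := simple_refl i in
    [&& coxlen w == coxlen (s * w * s)%g,
        (v == s * w)%g || (v == w * s)%g & (coxlen v).+1 == coxlen w]].

(* [connect] is the reflexive transitive closure. *)
Definition reduces_to : 'S_n -> 'S_n -> Prop :=
  clos_trans 'S_n (fun w v => connect cyclic_step w v || drop_step w v).

Definition is_composition (kappa : seq nat) : bool :=
  (0%N \notin kappa) && (sumn kappa == n).

Definition inner_sums (kappa : seq nat) : seq nat :=
  [seq sumn (take k kappa) | k <- iota 1 (size kappa).-1].

Definition w_comp (kappa : seq nat) : 'S_n :=
  (\prod_(i < n.-1 | i.+1 \notin inner_sums kappa) simple_refl i)%g.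

Definition is_partition (lam : seq nat) : bool :=
  sorted geq lam && is_composition lam.

End SymmetricGroup.

Definition conj_part (lam : seq nat) : seq nat :=
  [seq count (leq j) lam | j <- iota 1 (head 0%N lam)].

Definition diag_len (lam : seq nat) : nat :=
  \max_(1 <= i < (size lam).+1 | (i <= nth 0 lam i.-1)%N) i.

(* The subtraction is not truncated: both parts are at least i. *)
Definition diag_hooks (lam : seq nat) : seq nat :=
  [seq (nth 0 lam i.-1 + nth 0 (conj_part lam) i.-1 + 1 - 2 * i)%N
  | i <- iota 1 (diag_len lam)].

Section Tableaux.
Variable n : nat.

(* A tableau is given by the position (row, column) of each entry, rows and
   columns being numbered from 0. *)
Definition tableau := {ffun 'I_n -> 'I_n * 'I_n}.

Definition is_std (lam : seq nat) (t : tableau) : bool :=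
  [&& injectiveb t,
      [forall k, ((t k).2 < nth 0 lam (t k).1)%N],
      [forall k, forall l,
         ((t k).1 == (t l).1) && ((t k).2 < (t l).2)%N ==> (k < l)%N] &
      [forall k, forall l,
         ((t k).2 == (t l).2) && ((t k).1 < (t l).1)%N ==> (k < l)%N]].

Definition std (lam : seq nat) : Type := {t : tableau | is_std lam t}.
HB.instance Definition _ lam := Finite.on (std lam).

Definition conj_tab (t : tableau) : tableau := [ffun k => ((t k).2, (t k).1)].

Definition swap_tab (t : tableau) (i : 'I_n.-1) : tableau :=
  [ffun k => t (simple_refl i k)].

Definition content (t : tableau) (k : 'I_n) : int :=
  (t k).2%:Z - (t k).1%:Z.

Definition axial (t : tableau) (i : 'I_n.-1) : int :=
  content t (lo_ord i) - content t (hi_ord i).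

Definition two_in_first_row (t : tableau) : bool :=
  [forall k : 'I_n, (val k == 1%N) ==> (val (t k).1 == 0%N)].

End Tableaux.

Section Scalars.
Variables (F : fieldType) (q : F).

Definition qnat (k : nat) : F := \sum_(i < k) q ^+ (2 * i).+1%N.

Definition qint (k : int) : F :=
  match k with
  | Posz m => qnat m
  | Negz m => - (q ^- (2 * m.+1)%N) * qnat m.+1
  end.

(* [im] is the fixed root of -1 and [rt k] that of [k]. *)
Variables (im : F) (rt : nat -> F).

Definition alpha_nat (k : nat) : F := im * rt k.+1 * rt k.-1 / qnat k.

Definition alpha (k : int) : F :=
  match k with Posz m => alpha_nat m | Negz m => - alpha_nat m.+1 end.

End Scalars.

(* (c, a, b) encodes c(x) / (2 ^ a x ^ b); every element of
   Z[1/2, x, x^-1] is of this form. *)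
Record half_laurent := HalfLaurent {
  hl_num : {poly int};
  hl_two : nat;
  hl_var : nat
}.

Definition int_eval (F : fieldType) (p : {poly int}) (x : F) : F :=
  (map_poly intr p).[x].

Definition hl_eval (F : fieldType) (g : half_laurent) (x : F) : F :=
  int_eval (hl_num g) x / (2%:R ^+ hl_two g * x ^+ hl_var g).

Section Hecke.
Variables (F : fieldType) (n : nat) (q : F).

Definition hecke_relations (B : algType F) (U : 'I_n.-1 -> B) : Prop :=
  [/\ forall i, (U i - q%:A) * (U i + (q^-1)%:A) = 0,
      forall i j : 'I_n.-1, (i.+1 < j)%N || (j.+1 < i)%N ->
        U i * U j = U j * U i
    & forall i j : 'I_n.-1, j = i.+1 :> nat ->
        U i * U j * U i = U j * U i * U j].

(* The universal property of the algebra with generators T_i and the relations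
   above. *)
Definition hecke_presentation (H : algType F) (T : 'I_n.-1 -> H) : Prop :=
  hecke_relations T /\
  forall (B : algType F) (U : 'I_n.-1 -> B), hecke_relations U ->
    exists f : {lrmorphism H -> B}, (forall i, f (T i) = U i) /\
      forall g : {lrmorphism H -> B}, (forall i, g (T i) = U i) -> g =1 f.

(* By Matsumoto's theorem the choice of the reduced word is irrelevant. *)
Definition T_perm (H : algType F) (T : 'I_n.-1 -> H) (w : 'S_n) : H :=
  \prod_(i <- reduced_word w) T i.

(* Every algebra extends to a unitAlgType; it only makes the inverse of T_w
   available. *)
Definition is_sharp (H : unitAlgType F) (T : 'I_n.-1 -> H)
    (sharp : {lrmorphism H -> H}) : Prop :=
  bijective sharp /\
  forall w, sharp (T_perm T w) = (-1) ^+ coxlen w *: (T_perm T w^-1%g)^-1.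

Definition A_perm (H : algType F) (T : 'I_n.-1 -> H)
    (sharp : {lrmorphism H -> H}) (w : 'S_n) : H :=
  2%:R^-1 *: (T_perm T w + (-1) ^+ coxlen w *: sharp (T_perm T w)).

End Hecke.

Section Specht.
Variables (F : fieldType) (n : nat) (lam : seq nat).

Definition specht := {ffun std n lam -> F^o}.

(* The basis vector v_t when t is a standard lam-tableau, 0 otherwise. *)
Definition bvec (t : tableau n) : specht :=
  [ffun s : std n lam => (val s == t)%:R].

Record right_module (H : algType F) (act : specht -> H -> specht) : Prop := {
  act_linearl : forall h, linear (act^~ h);
  act_linearr : forall v, linear (act v);
  act1 : forall v, act v 1 = v;
  actM : forall v h k, act v (h * k) = act (act v h) k
}.

Definition alpha_tab (q im : F) (rt : nat -> F) (t : tableau n)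
    (i : 'I_n.-1) : F :=
  if is_std lam (swap_tab t i) then alpha q im rt (axial t i) else 0.

Definition specht_action (q im : F) (rt : nat -> F) (H : algType F)
    (T : 'I_n.-1 -> H) (act : specht -> H -> specht) : Prop :=
  right_module act /\
  forall (t : std n lam) (i : 'I_n.-1),
    act (bvec (val t)) (T i) =
      (- 1 / qint q (axial (val t) i)) *: bvec (val t)
      + alpha_tab q im rt (val t) i *: bvec (swap_tab (val t) i).

(* The trace on U of a linear map f that stabilises U. *)
Definition trace_on (U : {vspace specht}) (f : specht -> specht) : F :=
  \sum_(i < \dim U) coord (vbasis U) i (f (vbasis U)`_i).

(* Meant for a self-conjugate lam. *)
Definition tau (v : specht) : specht :=
  \sum_(t : std n lam) (v t : F) *: bvec (conj_tab (val t)).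

(* The sign is + for e = false and - for e = true. *)
Definition specht_half (e : bool) : {vspace specht} :=
  (\sum_(t : std n lam | two_in_first_row (val t))
      <[bvec (val t) + (-1) ^+ e *: bvec (conj_tab (val t))]>)%VS.

Variables (H : algType F) (act : specht -> H -> specht).

(* The alternating Hecke algebra is the subalgebra of fixed points of sharp, so
   its character on the restriction of specht is chi restricted to that
   subalgebra. It stabilises [specht_half e], whose character is [chi_half e];
   elsewhere [chi_half e] is meaningless. *)
Definition chi (h : H) : F := trace_on fullv (act^~ h).
Definition chi_tau (h : H) : F := trace_on fullv (fun v => tau (act v h)).
Definition chi_half (e : bool) (h : H) : F :=
  trace_on (specht_half e) (act^~ h).

End Specht.

Definition diag_factor (F : fieldType) (n : nat) (q im : F) (rt : nat -> F)
    (lam : seq nat) (a : {poly int}) : F :=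
  (- im) ^+ ((n - diag_len lam) %/ 2) * int_eval a (q - q^-1)
  * rt 1%N ^- n * \prod_(h <- diag_hooks lam) rt h.

(* Main.v *)
(* Cyclic shifts and the quadratic relations reduce the value of a trace at T_w to
   its values at shorter elements and, in the end, at the T_(w_kappa). On A_w with w
   even, the character of S(mu) agrees with its average under #; on T_w with w odd
   this average is a combination of its values at shorter elements. This gives the
   g_(C,w).
   Since tau turns the action of h into that of h^#, the form f(h) = chi(h tau)
   satisfies f(x T_i) = (q - q^-1) f(x) - f(T_i x), and the same descent expresses
   f(T_w) over Z[q - q^-1] through the f(T_(w_kappa)).
   The latter is the sum over t of the coefficient of v_(t') in v_t T_(w_kappa),
   which vanishes unless t' arises from t by disjoint swaps of consecutive entries
   inside the blocks of kappa. Removing the last entries one after the other, a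
   self-conjugate shape, seen as the strict partition of its half hooks, loses a
   diagonal box or a symmetric pair of boxes. By partial fractions the sums over the
   entries of a block are determinants of transfer weights of independent particles;
   at its end a block of even length gives 0 and one of odd length m creates the part
   (m + 1) / 2. So f(T_(w_kappa)) is an explicit product times the determinant of the
   matrix with entries [kappa_i = h_j], which vanishes unless kappa is a rearrangement
   of the diagonal hook lengths. *)

Require Import Defs.
From mathcomp Require Import all_boot all_order all_algebra.
From mathcomp Require Import all_fingroup all_solvable.
From Stdlib Require Import Relation_Operators.
From mathcomp Require Import zify ring.

Set Implicit Arguments.
Unset Strict Implicit.
Unset Printing Implicit Defensive.

Import GRing.Theory.
Local Open Scope ring_scope.

(** * Lengths and reduced words *)

(** The coefficients g have to serve all mu at once. They are computed for an arbitrary functional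
    with the formal properties of the averaged characters; the modules enter only afterwards. For
    the twisted trace the bottom of the descent is harder: moving the blocks of kappa past each
    other is a conjugation by some T_x, which a trace ignores but f does not, so f(T_(w_kappa)) is
    evaluated for every kappa. In that evaluation the particles interact only through the link
    factors between consecutive moves, that is, through the order of the moves. Partial fractions
    undo this: the product of the weights of the separate particles, as a function of the variable Y
    of the next link, is a sum over the particle that moves last. Exclusion comes back by
    antisymmetry, since a move that makes two parts equal gives a determinant with two equal rows.
    All identities between quantum integers are proved without dividing by q - q^(-1), because q = 1
    and q = -1 are allowed. *)

Section CoxeterLength.
Variable n : nat.
Implicit Types (w : 'S_n) (i j : 'I_n.-1) (s : seq 'I_n.-1).
Local Notation sr := (@simple_refl n).

Lemma lo_neq_hi i : lo_ord i != hi_ord i.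
Proof. by rewrite -val_eqE /= neq_ltn ltnSn. Qed.

Lemma simple_reflL i : sr i (lo_ord i) = hi_ord i.
Proof. exact: tpermL. Qed.

Lemma simple_reflR i : sr i (hi_ord i) = lo_ord i.
Proof. exact: tpermR. Qed.

Lemma simple_reflK i : (sr i * sr i = 1)%g.
Proof. exact: tperm2. Qed.

Lemma simple_reflV i : ((sr i)^-1 = sr i)%g.
Proof. exact: tpermV. Qed.

Lemma simple_reflKm i w : (sr i * (sr i * w) = w)%g.
Proof. by rewrite mulgA simple_reflK mul1g. Qed.

Lemma simple_reflmK i w : (w * sr i * sr i = w)%g.
Proof. by rewrite -mulgA simple_reflK mulg1. Qed.

Lemma simple_refl_val i (x : 'I_n) :
  sr i x = (if x == i :> nat then i.+1 else if x == i.+1 :> nat then i : nat else x) :> nat.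
Proof.
rewrite /simple_refl; case: tpermP => [->|->|] /=; first by rewrite eqxx.
- by rewrite eqxx; case: eqP => //; lia.
move=> /eqP h1 /eqP h2; rewrite -val_eqE /= in h1; rewrite -val_eqE /= in h2.
by rewrite (negbTE h1) (negbTE h2).
Qed.

(** Products of permutations act from left to right, so this is the condition for s_i w to be
    shorter than w; right descents appear as descents of the inverse. *)
Definition descent w i : bool := (w (hi_ord i) < w (lo_ord i))%N.

Lemma descentN w i : ~~ descent w i = (w (lo_ord i) < w (hi_ord i))%N.
Proof.
rewrite /descent -leqNgt leq_eqVlt; case: eqP => //= /val_inj /perm_inj /eqP.
by rewrite (negbTE (lo_neq_hi i)).
Qed.

Lemma descent_mul w i : descent (sr i * w) i = ~~ descent w i.
Proof. by rewrite descentN /descent !permM simple_reflL simple_reflR. Qed.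

Definition inv_set w : {set 'I_n * 'I_n} :=
  [set p : 'I_n * 'I_n | (p.1 < p.2)%N && (w p.2 < w p.1)%N].

(** Applying s_i to both members of a pair carries the inversions of w onto those of s_i w other
    than the pair (i, i + 1) itself. *)
Lemma inv_set_simple w i : ~~ descent w i ->
  #|inv_set (sr i * w)| = #|inv_set w|.+1.
Proof.
move=> Nd; pose p0 := (lo_ord i, hi_ord i).
have p0in : p0 \in inv_set (sr i * w).
  by rewrite inE /= ltnSn; have := descent_mul w i; rewrite Nd.
have p0nin : p0 \notin inv_set w.
  by rewrite inE /= ltnSn /=; exact: Nd.
rewrite (cardsD1 p0) p0in add1n; congr S.
pose h (p : 'I_n * 'I_n) := (sr i p.1, sr i p.2).
have hI : injective h by move=> [a b] [c d] [/perm_inj-> /perm_inj->].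
rewrite -[RHS](card_imset _ hI); congr #|pred_of_set _|; apply/setP=> -[a b].
rewrite !inE /=; apply/idP/imsetP.
  case/and3P=> neq ltab ltw; exists (sr i a, sr i b); last first.
    by rewrite /h /= !tpermK.
  rewrite inE /=; apply/andP; split; last by move: ltw; rewrite !permM.
  rewrite !simple_refl_val.
  move: neq; rewrite /p0 xpair_eqE -!val_eqE /=; move: ltab.
  by do ![case: ifP => /eqP]; lia.
case=> -[c d]; rewrite inE /= => /andP[ltcd ltw] [-> ->].
rewrite !permM !tpermK ltw andbT.
have neq : (c, d) != p0 by apply/eqP=> e; case/negP: p0nin; rewrite -e inE ltcd.
move: neq; rewrite /p0 !xpair_eqE -!val_eqE /= !simple_refl_val.
by do ![case: ifP => /eqP]; lia.
Qed.

Lemma inv_setD w i : descent w i -> #|inv_set w| = #|inv_set (sr i * w)|.+1.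
Proof.
move=> d; rewrite -{1}(simple_reflKm i w) inv_set_simple //.
by rewrite descent_mul d.
Qed.

Lemma inv_set1 : #|inv_set 1| = 0%N.
Proof.
apply/eqP; rewrite cards_eq0; apply/eqP/setP=> -[a b]; rewrite !inE /= !perm1.
by apply/negP; lia.
Qed.

Lemma perm_no_descent w : (forall i, ~~ descent w i) -> w = 1%g.
Proof.
move=> Nd.
have mono d : forall a b : 'I_n, b = (a + d)%N :> nat -> (w a + d <= w b)%N.
  elim: d => [|d IH] a b e.
    by rewrite addn0; have -> : a = b by apply/val_inj; rewrite /= e addn0.
  have hd : (a + d < n)%N by have := ltn_ord b; lia.
  have hd' : (a + d < n.-1)%N by have := ltn_ord b; lia.
  have h1 := IH a (Ordinal hd) erefl.
  have := Nd (Ordinal hd'); rewrite descentN.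
  have -> : lo_ord (Ordinal hd') = Ordinal hd by apply/val_inj.
  have -> : hi_ord (Ordinal hd') = b by apply/val_inj => /=; rewrite e addnS.
  lia.
(* Monotonicity from the first point bounds w x from below by x, monotonicity up to the last point
   bounds it from above. *)
apply/permP=> x; rewrite perm1; apply/val_inj => /=.
case: n w mono x {Nd} => [|m] w' mono x; first by case: x.
have h1 := mono x ord0 x erefl.
have h2 : (w' x + (m - x) <= w' ord_max)%N.
  by apply: mono => /=; have := ltn_ord x; lia.
have := ltn_ord (w' ord_max); have := ltn_ord x; lia.
Qed.

Lemma word_perm_cons i s : word_perm (i :: s) = (sr i * word_perm s)%g.
Proof. by rewrite /word_perm big_cons. Qed.

Lemma word_perm_cat s t : word_perm (s ++ t) = (word_perm s * word_perm t)%g.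
Proof. by rewrite /word_perm big_cat. Qed.

Lemma word_perm_nil : word_perm [::] = 1%g :> 'S_n.
Proof. by rewrite /word_perm big_nil. Qed.

Lemma leq_inv_size s : (#|inv_set (word_perm s)| <= size s)%N.
Proof.
elim: s => [|i s IH]; first by rewrite word_perm_nil inv_set1.
rewrite word_perm_cons /=.
have [d|Nd] := boolP (descent (word_perm s) i).
  by apply: leq_trans (leq_trans IH (leqnSn _)); rewrite (inv_setD d).
by rewrite inv_set_simple.
Qed.

Lemma inv_word w : exists2 s, word_perm s = w & size s = #|inv_set w|.
Proof.
have [k] := ubnP #|inv_set w|; elim: k => // k IH in w *; rewrite ltnS => lek.
case: (pickP (descent w)) => [i d|Nd]; last first.
  have -> : w = 1%g by apply: perm_no_descent => i; rewrite Nd.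
  by exists [::]; rewrite ?word_perm_nil ?inv_set1.
have [s sE sz] := IH (sr i * w)%g (leq_trans (eq_leq (esym (inv_setD d))) lek).
by exists (i :: s); rewrite ?word_perm_cons ?sE ?simple_reflKm //= sz (inv_setD d).
Qed.

Lemma coxlen_leq s : (coxlen (word_perm s) <= size s)%N.
Proof.
rewrite /coxlen; case: ex_minnP => k _; apply.
by apply/existsP; exists (in_tuple s).
Qed.

Lemma reduced_wordP w : word_perm (reduced_word w) = w.
Proof. exact/eqP/(xchooseP (reduced_word_subproof w)). Qed.

Lemma size_reduced_word w : size (reduced_word w) = coxlen w.
Proof. by rewrite /reduced_word size_tuple. Qed.

(** A letter adds at most one inversion, and removing descents one at a time yields a word with one
    letter per inversion. *)
Lemma coxlenE w : coxlen w = #|inv_set w|.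
Proof.
apply/eqP; rewrite eqn_leq; apply/andP; split.
  by have [s <- <-] := inv_word w; exact: coxlen_leq.
by rewrite -size_reduced_word -{1}(reduced_wordP w) leq_inv_size.
Qed.

Lemma coxlen1 : coxlen (1%g : 'S_n) = 0%N.
Proof. by rewrite coxlenE inv_set1. Qed.

Lemma coxlen_ascent w i : ~~ descent w i -> coxlen (sr i * w) = (coxlen w).+1.
Proof. by rewrite !coxlenE; exact: inv_set_simple. Qed.

Lemma coxlen_descent w i : descent w i -> coxlen w = (coxlen (sr i * w)).+1.
Proof. by rewrite !coxlenE; exact: inv_setD. Qed.

Lemma word_perm_rev s : word_perm (rev s) = (word_perm s)^-1%g.
Proof.
elim: s => [|i s IH]; first by rewrite word_perm_nil invg1.
by rewrite rev_cons -cats1 word_perm_cat IH !word_perm_cons word_perm_nil mulg1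
           invMg simple_reflV.
Qed.

Lemma coxlenV w : coxlen w^-1 = coxlen w.
Proof.
have leV (v : 'S_n) : (coxlen v^-1 <= coxlen v)%N.
  rewrite -{1}(reduced_wordP v) -word_perm_rev -[leqRHS]size_reduced_word.
  by rewrite -size_rev coxlen_leq.
by apply/eqP; rewrite eqn_leq leV -{1}(invgK w) leV.
Qed.

Lemma coxlen_ascentr w i : ~~ descent w^-1 i -> coxlen (w * sr i) = (coxlen w).+1.
Proof.
by move=> /coxlen_ascent; rewrite coxlenV => <-; rewrite -coxlenV invMg simple_reflV.
Qed.

Lemma coxlen_descentr w i : descent w^-1 i -> coxlen w = (coxlen (w * sr i)).+1.
Proof.
move=> /coxlen_descent; rewrite coxlenV => ->.
by rewrite -[in RHS]coxlenV invMg simple_reflV.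
Qed.

Lemma coxlen_simple i : coxlen (sr i) = 1%N.
Proof.
by rewrite -[sr i]mulg1 coxlen_ascent ?coxlen1 // descentN !perm1 /=.
Qed.

Lemma odd_word s : odd_perm (word_perm s) = odd (size s).
Proof.
elim: s => [|i s IH]; first by rewrite word_perm_nil odd_perm1.
by rewrite word_perm_cons odd_permM /simple_refl odd_tperm lo_neq_hi IH.
Qed.

Lemma odd_coxlen w : odd (coxlen w) = odd_perm w.
Proof. by rewrite -{2}(reduced_wordP w) odd_word size_reduced_word. Qed.

Lemma descent_far w i j : (i.+1 < j)%N || (j.+1 < i)%N ->
  descent (sr i * w) j = descent w j.
Proof.
move=> far; rewrite /descent !permM.
have e x : (x = lo_ord j) \/ (x = hi_ord j) -> sr i x = x.
  move=> hx; apply/val_inj; rewrite /= simple_refl_val.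
  by case: hx => -> /=; do ![case: ifP => /eqP]; lia.
by rewrite !e; auto.
Qed.

Lemma simple_refl_far i j : (i.+1 < j)%N || (j.+1 < i)%N ->
  (sr i * sr j = sr j * sr i)%g.
Proof.
move=> far; apply/permP=> x; apply/val_inj => /=; rewrite !permM.
rewrite !simple_refl_val.
by do ![case: ifP => /eqP]; lia.
Qed.

Lemma simple_refl_braid i j : j = i.+1 :> nat ->
  (sr i * sr j * sr i = sr j * sr i * sr j)%g.
Proof.
move=> e; apply/permP=> x; apply/val_inj => /=; rewrite !permM !simple_refl_val.
by do ![case: ifP => /eqP]; lia.
Qed.

Lemma descent_braid w i j : j = i.+1 :> nat -> descent w i -> descent w j ->
  [/\ descent (sr i * w) j, descent (sr j * (sr i * w)) i,
      descent (sr j * w) i & descent (sr i * (sr j * w)) j].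
Proof.
move=> e; have loj : lo_ord j = hi_ord i by apply/val_inj.
have h1 : sr i (hi_ord j) = hi_ord j.
  by apply/val_inj; rewrite /= simple_refl_val /= e; do ![case: ifP => /eqP]; lia.
have h2 : sr j (lo_ord i) = lo_ord i.
  by apply/val_inj; rewrite /= simple_refl_val /= e; do ![case: ifP => /eqP]; lia.
have jh : sr j (hi_ord i) = hi_ord j by rewrite -loj simple_reflL.
have jh' : sr j (hi_ord j) = hi_ord i by rewrite -loj simple_reflR.
have jl : sr i (lo_ord j) = lo_ord i by rewrite loj simple_reflR.
rewrite /descent !permM !(h1, h2, jh, jh', simple_reflL, simple_reflR, jl, loj).
by move=> d1 d2; split=> //; apply: ltn_trans d2 d1.
Qed.

Lemma coxlen_word_cons i s : coxlen (word_perm (i :: s)) = (size s).+1 ->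
  coxlen (word_perm s) = size s /\ descent (word_perm (i :: s)) i.
Proof.
move=> h; have hs := coxlen_leq s.
move: h; rewrite word_perm_cons descent_mul.
have [d|Nd] := boolP (descent (word_perm s) i).
  by move: hs; rewrite (coxlen_descent d); lia.
by rewrite coxlen_ascent // => -[->].
Qed.

Lemma sorted_word s : sorted ltn (map val s) ->
  (forall k : 'I_n, all (fun i : 'I_n.-1 => k < i)%N s -> word_perm s k = k) /\
  coxlen (word_perm s) = size s.
Proof.
elim: s => [|i s IH] /= srt.
  by rewrite word_perm_nil coxlen1; split=> // k _; rewrite perm1.
have [fix_s len_s] := IH (path_sorted srt).
have all_s : all (fun j : 'I_n.-1 => i < j)%N s.
  by move: srt; rewrite (path_sortedE ltn_trans) => /andP[+ _]; rewrite all_map.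
split=> [k /andP[ki ks]|].
  rewrite word_perm_cons permM; have -> : sr i k = k.
    by apply/val_inj; rewrite /= simple_refl_val; do ![case: ifP => /eqP]; lia.
  exact: fix_s.
rewrite word_perm_cons coxlen_ascent ?len_s // descentN fix_s //.
(* The later letters move nothing at or below i. If i + 1 had an image of at most i, that image
   would be fixed, hence equal to i + 1. *)
rewrite ltnNge; apply/negP => le; set y := word_perm s (hi_ord i) in le.
have /perm_inj e : word_perm s y = word_perm s (hi_ord i).
  by apply: fix_s; apply: sub_all all_s => j; apply: leq_ltn_trans.
by move: le; rewrite e /= ltnn.
Qed.

End CoxeterLength.

(** * The standard basis of the Hecke algebra *)

Section HeckeBasis.
Variables (F : fieldType) (n : nat) (q : F) (H : algType F) (T : 'I_n.-1 -> H).
Hypothesis q_neq0 : q != 0.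
Hypothesis HT : hecke_relations q T.
Local Notation sr := (@simple_refl n).
Implicit Types (w : 'S_n) (i j : 'I_n.-1) (s : seq 'I_n.-1).

Definition T_word s : H := \prod_(i <- s) T i.

Lemma T_word_cons i s : T_word (i :: s) = T i * T_word s.
Proof. by rewrite /T_word big_cons. Qed.

Lemma T_word_cat s t : T_word (s ++ t) = T_word s * T_word t.
Proof. by rewrite /T_word big_cat. Qed.

Lemma T_sq i : T i * T i = 1 + (q - q^-1) *: T i.
Proof.
case: HT => quad _ _; have := quad i.
rewrite mulrDr !mulrBl mulr_algl !mulr_algr scalerA mulVf // scale1r => e.
apply/eqP; rewrite -subr_eq0 -[X in _ == X]e scalerBl; apply/eqP.
by rewrite !opprD !opprK !addrA -!addrA; congr (_ + _); rewrite addrC !addrA.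
Qed.

Lemma T_commute i j : (i.+1 < j)%N || (j.+1 < i)%N -> T i * T j = T j * T i.
Proof. by case: HT => _ + _; apply. Qed.

Lemma T_braid i j : j = i.+1 :> nat -> T i * T j * T i = T j * T i * T j.
Proof. by case: HT => _ _; apply. Qed.

Lemma reduced_cons w i : descent w i ->
  exists2 s, word_perm (i :: s) = w & size s = coxlen (sr i * w)%g.
Proof.
move=> d; exists (reduced_word (sr i * w)%g); last exact: size_reduced_word.
by rewrite word_perm_cons reduced_wordP simple_reflKm.
Qed.

(** The case of neighbouring letters, needed for both orders of i and j. As both are descents, w
    begins with s_i s_j s_i; a reduced word u of the rest links s to j i u and t to i j u. *)
Lemma matsumoto_braid k w i j s t :
    (forall s t, (size s < k)%N -> word_perm s = word_perm t ->
       size s = coxlen (word_perm s) -> size t = coxlen (word_perm t) ->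
       T_word s = T_word t) ->
    j = i.+1 :> nat -> descent w i -> descent w j ->
    word_perm s = (sr i * w)%g -> word_perm t = (sr j * w)%g ->
    coxlen (word_perm s) = size s -> coxlen (word_perm t) = size t ->
    size s = size t -> (size s < k)%N -> T i * T_word s = T j * T_word t.
Proof.
move=> IH ji d1 d2 es et r1 r2 st lek.
have lekt : (size t < k)%N by rewrite -st.
have [a1 a2 a3 a4] := descent_braid ji d1 d2.
have l1 := coxlen_descent a1; have l2 := coxlen_descent a2.
have [u uE usz] := reduced_cons a2.
have uE' : word_perm u = (sr i * (sr j * (sr i * w)))%g.
  by rewrite -uE word_perm_cons simple_reflKm.
have e1 : word_perm (j :: i :: u) = word_perm s.
  by rewrite word_perm_cons uE simple_reflKm es.
have e2 : word_perm (i :: j :: u) = word_perm t.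
  rewrite !word_perm_cons uE' et; have br := simple_refl_braid ji.
  by rewrite [(sr i * (sr j * (sr i * w)))%g]mulgA [(sr i * sr j * _)%g]mulgA br -!mulgA !simple_reflKm.
have q1 : T_word s = T_word (j :: i :: u).
  by apply: IH; [|rewrite e1|rewrite r1|rewrite e1 r1 /= usz -l2 -l1 -es r1].
have q2 : T_word (i :: j :: u) = T_word t.
  have su : (size u).+2 = size t by rewrite usz -l2 -l1 -es r1 st.
  by apply: IH; [rewrite /= su| |rewrite e2 r2 -su|rewrite r2].
rewrite q1 -q2 !T_word_cons.
by rewrite !mulrA T_braid.
Qed.

(** Induction on the length. If the first letters differ, w begins with the longest element of the
    group they generate, and the two words are compared with words that start with its two
    expressions. *)
Theorem matsumoto s t : word_perm s = word_perm t ->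
  size s = coxlen (word_perm s) -> size t = coxlen (word_perm t) ->
  T_word s = T_word t.
Proof.
have [k] := ubnP (size s); elim: k => // k IH in s t *; rewrite ltnS => lek e sz1 sz2.
have st : size s = size t by rewrite sz1 e -sz2.
case: s t lek e sz1 sz2 st => [|i s] [|j t] //= lek e sz1 sz2 [st].
have [r1 d1] := coxlen_word_cons (esym sz1).
have [r2 d2] := coxlen_word_cons (esym sz2).
have es : word_perm s = (sr i * word_perm (i :: s))%g.
  by rewrite word_perm_cons simple_reflKm.
have et : word_perm t = (sr j * word_perm (i :: s))%g.
  by rewrite e word_perm_cons simple_reflKm.
rewrite -e in d2; set w := word_perm (i :: s) in d1 d2 es et.
rewrite !T_word_cons.
have lekt : (size t < k)%N by rewrite -st.
have [eij|neq] := eqVneq i j.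
  by rewrite eij (IH s t) // et es eij.
have [far|near] := boolP ((i.+1 < j)%N || (j.+1 < i)%N).
  have d3 : descent (sr i * w) j by rewrite descent_far.
  have d4 : descent (sr j * w) i by rewrite descent_far // orbC.
  have [u uE usz] := reduced_cons d3.
  have u2E : word_perm (i :: u) = word_perm t.
    rewrite et word_perm_cons; apply: (canRL (simple_reflKm _)).
    rewrite mulgA simple_refl_far 1?orbC // -mulgA.
    by rewrite -word_perm_cons uE simple_reflKm.
  have ll := coxlen_descent d3.
  have q1 : T_word s = T_word (j :: u).
    by apply: IH; [|rewrite uE es|rewrite r1|rewrite /= uE usz -ll].
  have q2 : T_word (i :: u) = T_word t.
    have su : (size u).+1 = size t by rewrite usz -ll -es r1 st.
    by apply: IH; [rewrite /= su| |rewrite u2E r2 -su|rewrite r2].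
  rewrite q1 -q2 !T_word_cons.
  by rewrite !mulrA T_commute.
have nv : i != j :> nat by rewrite val_eqE.
have [e1|e1] : j = i.+1 :> nat \/ i = j.+1 :> nat.
  by move: near nv; rewrite negb_or -!leqNgt neq_ltn; lia.
- exact: (@matsumoto_braid k w).
by apply/esym/(@matsumoto_braid k w) => //; rewrite -st.
Qed.

Lemma T_perm_word s : size s = coxlen (word_perm s) -> T_perm T (word_perm s) = T_word s.
Proof.
by move=> sz; apply: matsumoto; rewrite ?reduced_wordP ?size_reduced_word.
Qed.

Lemma T_perm1 : T_perm T 1%g = 1.
Proof. by rewrite -[1%g]word_perm_nil T_perm_word /T_word ?big_nil // word_perm_nil coxlen1. Qed.

Lemma T_perm_ascent w i : ~~ descent w i -> T_perm T (sr i * w)%g = T i * T_perm T w.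
Proof.
move=> Nd; have sz : size (reduced_word w) = coxlen w by rewrite size_reduced_word.
rewrite -{1}(reduced_wordP w) -word_perm_cons T_perm_word ?T_word_cons //=.
by rewrite word_perm_cons reduced_wordP coxlen_ascent ?sz.
Qed.

Lemma T_perm_descent w i : descent w i ->
  T i * T_perm T w = T_perm T (sr i * w)%g + (q - q^-1) *: T_perm T w.
Proof.
move=> d; have Nd : ~~ descent (sr i * w)%g i by rewrite descent_mul d.
rewrite -{1 3}(simple_reflKm i w) T_perm_ascent // mulrA T_sq mulrDl mul1r.
by rewrite -scalerAl.
Qed.

Lemma T_perm_ascentr w i : ~~ descent w^-1 i ->
  T_perm T (w * sr i)%g = T_perm T w * T i.
Proof.
move=> Nd; have sz : size (reduced_word w) = coxlen w by rewrite size_reduced_word.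
have e : word_perm (rcons (reduced_word w) i) = (w * sr i)%g.
  by rewrite -cats1 word_perm_cat reduced_wordP word_perm_cons word_perm_nil mulg1.
rewrite -e T_perm_word ?size_rcons ?e ?coxlen_ascentr ?sz //.
by rewrite -cats1 T_word_cat T_word_cons /T_word big_nil mulr1.
Qed.

Lemma T_perm_simple i : T_perm T (sr i) = T i.
Proof.
by rewrite -[sr i]mulg1 T_perm_ascent ?T_perm1 ?mulr1 // descentN !perm1 /=.
Qed.

End HeckeBasis.

(** * Cyclic shifts and compositions *)

Section CyclicShifts.
Variable n : nat.
Local Notation sr := (@simple_refl n).
Implicit Types (w : 'S_n) (i j : 'I_n.-1) (s : seq 'I_n.-1).

Lemma sorted_word_fix s (k : 'I_n) : sorted ltn (map val s) ->
  all (fun i : 'I_n.-1 => k < i)%N s -> word_perm s k = k.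
Proof. by move=> srt; have [+ _] := sorted_word srt; apply. Qed.

Lemma fix_perm_lt m (x : 'S_n) : (forall k : 'I_n, (m <= k)%N -> x k = k) ->
  forall k : 'I_n, (k < m)%N -> (x k < m)%N.
Proof.
move=> fx k lt; rewrite ltnNge; apply/negP => le.
by have := fx _ le => /perm_inj e; move: le; rewrite e leqNgt lt.
Qed.

(* The inner induction writes w = x * word_perm s with x in S_m and s an
   increasing word in the s_i with i >= m - 1; if x maps m - 1 to j < m - 2, then
   conjugation by s_j moves this image to j + 1 without increasing the length. *)
Theorem cyclic_shift_ind (P : 'S_n -> Prop) :
  (forall s, sorted ltn (map val s) ->
     (forall v, (coxlen v < coxlen (word_perm s))%N -> P v) -> P (word_perm s)) ->
  (forall w i, descent w^-1 i ->
     (forall v, (coxlen v < coxlen w)%N -> P v) ->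
     (coxlen (sr i * w * sr i)%g = coxlen w -> P (sr i * w * sr i)%g) -> P w) ->
  forall w, P w.
Proof.
move=> Pword Pshift w; have [k] := ubnP (coxlen w).
elim: k => // k IHk in w *; rewrite ltnS => lek.
have IH v : (coxlen v < coxlen w)%N -> P v.
  by move=> lt; apply: IHk; apply: leq_trans lek.
(* The bound is carried by a fixed [w0], so that w may be replaced by conjugates of at most that
   length while the hypothesis for shorter elements stays available. *)
have {lek} {IH} [w0 lew IH] : exists2 w0 : 'S_n, (coxlen w <= coxlen w0)%N &
    forall v : 'S_n, (coxlen v < coxlen w0)%N -> P v by exists w.
suff main : forall m, (m <= n)%N -> forall (x : 'S_n) s,
    (forall k : 'I_n, (m <= k)%N -> x k = k) -> sorted ltn (map val s) ->
    all (fun i : 'I_n.-1 => (m <= i.+1)%N) s ->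
    (coxlen (x * word_perm s)%g <= coxlen w0)%N -> P (x * word_perm s)%g.
  have := main n (leqnn n) w [::]; rewrite word_perm_nil mulg1; apply=> //.
  by move=> i; rewrite leqNgt ltn_ord.
elim=> [|m IHm] lemn x s fx srt als.
  have -> : x = 1%g by apply/permP => i; rewrite perm1 fx.
  rewrite mul1g => le; apply: Pword => // v lt; apply: IH; exact: leq_trans le.
pose M := Ordinal lemn.
have [d] := ubnP (m - x M)%N; elim: d => // d IHd in x fx *; rewrite ltnS => led.
have xM : (x M <= m)%N by rewrite -ltnS; apply: fix_perm_lt.
have fx' : x M = M -> forall k : 'I_n, (m <= k)%N -> x k = k.
  move=> e i; rewrite leq_eqVlt => /predU1P[ei|]; last exact: fx.
  by have -> : i = M by apply/val_inj.
have [/eqP e|xMneq] := boolP (x M == M).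
  apply: (IHm (ltnW lemn)) => //; first exact: fx'.
  by apply: sub_all als => i; apply: ltnW.
have xMlt : (x M < m)%N.
  by rewrite ltn_neqAle xM andbT -[m]/(val M) val_eqE.
have ltj : (x M < n.-1)%N by have := lemn; lia.
pose j := Ordinal ltj.
have loj : lo_ord j = x M by apply/val_inj.
(* If the image of m is m - 1, a factor s_j splits off from x and extends the increasing word on its
   left. *)
have [e|neq] := eqVneq (x M).+1 m => [le|].
  have hij : hi_ord j = M by apply/val_inj.
  have -> : (x * word_perm s = x * sr j * word_perm (j :: s))%g.
    by rewrite word_perm_cons mulgA simple_reflmK.
  apply: (IHm (ltnW lemn)).
  - move=> i; rewrite leq_eqVlt => /predU1P[ei|lti].
      have -> : i = M by apply/val_inj.
      by rewrite permM -loj simple_reflL hij.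
    rewrite permM fx //; apply/val_inj; rewrite /= simple_refl_val /=.
    by do ![case: ifP => /eqP]; lia.
  - rewrite /= path_sortedE ?srt ?andbT; last exact: ltn_trans.
    by rewrite all_map; apply: sub_all als => i /=; lia.
  - by rewrite /= e leqnn /=; apply: sub_all als => i /=; lia.
  by rewrite word_perm_cons mulgA simple_reflmK.
move=> le; set y := word_perm s; set w1 := (x * y)%g.
have far : all (fun i : 'I_n.-1 => (j.+1 < i)%N) s.
  by apply: sub_all als => i /=; lia.
have fixy (k' : 'I_n) : (k' < m)%N -> y k' = k'.
  by move=> lt; apply: sorted_word_fix => //; apply: sub_all als => i /=; lia.
have comm : commute y (sr j).
  rewrite /commute /y; elim: (s) far => [|i s' IHs] /=.
    by rewrite word_perm_nil mul1g mulg1.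
  case/andP=> fi /IHs e; rewrite word_perm_cons -mulgA e !mulgA simple_refl_far //.
  by rewrite fi orbT.
have des : descent w1^-1 j.
  rewrite /descent invMg !permM.
  have yl : y^-1%g (lo_ord j) = lo_ord j by rewrite -{1}(fixy (lo_ord j)) ?permK.
  have yh : y^-1%g (hi_ord j) = hi_ord j.
    by rewrite -{1}(fixy (hi_ord j)) ?permK //=; lia.
  rewrite yl yh loj permK /= ltn_neqAle.
  have h1 : x^-1%g (hi_ord j) != M.
    by apply/eqP => h; have := lo_neq_hi j; rewrite loj -h permKV eqxx.
  rewrite -[m]/(val M) val_eqE h1 /=.
  rewrite leqNgt; apply/negP => h2.
  have := fx _ h2; rewrite permKV => h3; move: h2; rewrite -h3 /=; lia.
apply: (Pshift _ j des) => [v lt|leq]; first by apply: IH; apply: leq_trans le.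
have e1 : (sr j * w1 * sr j = sr j * x * sr j * y)%g.
  by rewrite /w1 -!mulgA comm.
rewrite e1; apply: IHd.
- move=> i lei; rewrite !permM.
  have ji : sr j i = i.
    by apply/val_inj; rewrite /= simple_refl_val /=; do ![case: ifP => /eqP]; lia.
  by rewrite ji fx // ji.
- rewrite !permM.
  have -> : sr j M = M.
    by apply/val_inj; rewrite /= simple_refl_val /=; do ![case: ifP => /eqP]; lia.
  by rewrite -loj simple_reflL /=; lia.
by rewrite -/y -e1 leq.
Qed.

End CyclicShifts.

(** * Words attached to compositions *)

Section CompositionWords.

(** The letters are natural numbers, so that the words of single blocks can be shifted and
    concatenated; a block of size m has m - 1 letters and skips the index at its right end. *)
Fixpoint comp_word (o : nat) (kappa : seq nat) : seq nat :=
  if kappa is m :: kappa' then iota o m.-1 ++ comp_word (o + m)%N kappa' else [::].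

Lemma comp_word_cat o k1 k2 :
  comp_word o (k1 ++ k2) = comp_word o k1 ++ comp_word (o + sumn k1)%N k2.
Proof.
by elim: k1 o => [|m k1 IH] o /=; rewrite ?addn0 // IH catA addnA.
Qed.

Lemma comp_word_shift o k : comp_word o k = map (addn o) (comp_word 0 k).
Proof.
elim: k o => [|m k IH] o //=; rewrite map_cat -iotaDl addn0 add0n.
by rewrite (IH (o + m)%N) (IH m) -map_comp; congr (_ ++ _); apply: eq_map => x /=; rewrite addnA.
Qed.

Lemma comp_word_bound o (k : seq nat) : 0%N \notin k ->
  all (fun i => (o <= i)%N && (i.+1 < o + sumn k)%N) (comp_word o k).
Proof.
elim: k o => [|m k IH] o //=; rewrite inE negb_or => /andP[m0 k0].
rewrite all_cat; apply/andP; split.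
  by apply/allP => i; rewrite mem_iota; lia.
by apply: sub_all (IH (o + m)%N k0) => i; lia.
Qed.

Lemma size_comp_word o (k : seq nat) : 0%N \notin k -> (size (comp_word o k) + size k)%N = sumn k.
Proof.
elim: k o => [|m k IH] o //=; rewrite inE negb_or => /andP[m0 k0].
have := IH (o + m)%N k0; rewrite size_cat size_iota.
lia.
Qed.

Lemma sorted_comp_word o (k : seq nat) : 0%N \notin k -> sorted ltn (comp_word o k).
Proof.
elim: k o => [|m k IH] o //=; rewrite inE negb_or => /andP[m0 k0].
rewrite (sorted_pairwise ltn_trans) pairwise_cat -!(sorted_pairwise ltn_trans) IH //.
rewrite iota_ltn_sorted !andbT; apply/allrelP => x y; rewrite mem_iota => hx.
by move=> /(allP (comp_word_bound (o + m)%N k0)) /=; lia.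
Qed.

Lemma inner_sums_cons m k : k != [::] ->
  inner_sums (m :: k) = m :: map (addn m) (inner_sums k).
Proof.
case: k => // a k _; rewrite /inner_sums /= -[2%N]/(1 + 1)%N iotaDl -!map_comp.
rewrite /= addn0 ?take0; congr (_ :: _); apply: eq_map => j /=.
Qed.

Lemma inner_sums_rcons k m :
  inner_sums (rcons k m) = [seq sumn (take j k) | j <- iota 1 (size k)].
Proof.
rewrite /inner_sums size_rcons /=; apply/eq_in_map => j; rewrite mem_iota => hj.
by rewrite -cats1 takel_cat //; lia.
Qed.

Lemma comp_word_inner (k : seq nat) : 0%N \notin k ->
  comp_word 0 k = [seq i <- iota 0 (sumn k).-1 | i.+1 \notin inner_sums k].
Proof.
elim: k => [|m k IH] //; rewrite inE negb_or => /andP[m0 k0].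
case: k IH k0 => [|a k] IH k0.
  by rewrite /= cats0 addn0 /inner_sums /= filter_predT.
move: IH k0; set k' := a :: k => IH k0; have k'nil : k' != [::] by [].
rewrite -[LHS]/(iota 0 m.-1 ++ comp_word m k') comp_word_shift IH //; have k'0 : (0 < sumn k')%N by move: k0; rewrite inE negb_or /=; lia.
rewrite (inner_sums_cons m k'nil) -[sumn (m :: k')]/(m + sumn k')%N.
have -> : (m + sumn k').-1 = (m.-1 + (1 + (sumn k').-1))%N by lia.
rewrite !iotaD !filter_cat add0n /= inE.
have -> : m.-1.+1 = m by lia.
rewrite eqxx /= addn1 prednK; last by lia.
have -> : iota m (sumn k').-1 = map (addn m) (iota 0 (sumn k').-1).
  by rewrite -iotaDl addn0.
rewrite filter_map -[(a + sumn k)%N]/(sumn k'); congr (_ ++ _); last congr map.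
  apply/esym/all_filterP/allP => i; rewrite mem_iota => hi.
  rewrite inE negb_or; apply/andP; split; first by lia.
  by apply/mapP => -[j]; lia.
apply: eq_in_filter => i hi /=; rewrite inE negb_or -addnS mem_map; last exact: addnI.
by rewrite (_ : (m + i.+1)%N == m = false) //; lia.
Qed.

End CompositionWords.

Section CompositionPerm.
Variable n : nat.

Lemma word_of_seq (s : seq nat) : all (fun i => i < n.-1)%N s ->
  exists s' : seq 'I_n.-1, map val s' = s.
Proof.
elim: s => [|i s IH] /=; first by exists [::].
by case/andP=> lt /IH[s' <-]; exists (Ordinal lt :: s').
Qed.

Lemma w_comp_word kappa (s : seq 'I_n.-1) : is_composition n kappa ->
  map val s = comp_word 0 kappa -> w_comp n kappa = word_perm s.
Proof.
case/andP=> k0 /eqP sumk e; rewrite /w_comp /word_perm -big_filter.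
congr bigop; apply: (inj_map val_inj); rewrite e comp_word_inner // sumk.
rewrite -val_enum_ord filter_map; congr map.
by rewrite enumT.
Qed.

Lemma comp_word_ex kappa : is_composition n kappa ->
  exists s : seq 'I_n.-1, [/\ map val s = comp_word 0 kappa, sorted ltn (map val s)
    & w_comp n kappa = word_perm s].
Proof.
move=> kn; have /andP[k0 /eqP sumk] := kn.
have [s e] : exists s' : seq 'I_n.-1, map val s' = comp_word 0 kappa.
  by apply: word_of_seq; apply: sub_all (comp_word_bound 0 k0) => i; lia.
by exists s; split; rewrite ?e ?sorted_comp_word // (w_comp_word kn e).
Qed.

Lemma coxlen_w_comp kappa : is_composition n kappa ->
  coxlen (w_comp n kappa) = (n - size kappa)%N.
Proof.
move=> kn; have [s [e srt ->]] := comp_word_ex kn.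
have [_ ->] := sorted_word srt; rewrite -(size_map val) e.
by case/andP: kn => k0 /eqP <-; rewrite -(size_comp_word 0 k0) addnK.
Qed.

(** The last part p stands apart because the inductive step either lengthens it or closes it and
    opens a new part 1, depending on whether there is a cut at its end. *)
Lemma comp_of_cuts (c : pred nat) (m : nat) : (0 < m)%N -> exists k p,
  [/\ 0%N \notin k, (0 < p)%N, (sumn k + p)%N = m &
      forall i, (0 < i < m)%N -> (i \in [seq sumn (take j k) | j <- iota 1 (size k)]) = c i].
Proof.
elim: m => // -[|m] IH _; first by exists [::], 1%N; split=> // i; lia.
have [|k [p [k0 p0 e h]]] := IH _; first by [].
have hk j : j \in [seq sumn (take j k) | j <- iota 1 (size k)] -> (j <= sumn k)%N.
  case/mapP=> i _ ->; rewrite -{2}(cat_take_drop i k) sumn_cat; lia.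
have [cm|Ncm] := boolP (c m.+1); last first.
  exists k, p.+1; split=> //; first by lia.
  move=> i hi; have [lt|ge] := ltnP i m.+1; first by apply: h; lia.
  have -> : i = m.+1 by lia.
  by rewrite (negbTE Ncm); apply/negP => /hk; lia.
exists (rcons k p), 1%N; split=> //.
- by rewrite mem_rcons inE negb_or k0 andbT; lia.
- by rewrite sumn_rcons; lia.
move=> i hi.
have -> : [seq sumn (take j (rcons k p)) | j <- iota 1 (size (rcons k p))] =
          rcons [seq sumn (take j k) | j <- iota 1 (size k)] m.+1.
  rewrite size_rcons -[(size k).+1]addn1 iotaD map_cat /= cats1; congr rcons.
    apply/eq_in_map => j; rewrite mem_iota => hj.
    by rewrite -cats1 takel_cat //; lia.
  by rewrite take_oversize ?size_rcons ?sumn_rcons //; lia.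
rewrite mem_rcons inE; have [->|ne] /= := eqVneq i m.+1; first by rewrite cm.
by apply: h; lia.
Qed.

(** The cuts are the indices missing from the word. Indices count from 0, so a cut after i points is
    the missing letter i - 1. *)
Lemma sorted_word_comp (s : seq 'I_n.-1) : (0 < n)%N -> sorted ltn (map val s) ->
  exists2 kappa, is_composition n kappa & w_comp n kappa = word_perm s.
Proof.
move=> n_gt0 srt; have [k [p [k0 p0 e h]]] := comp_of_cuts (fun i => i.-1 \notin map val s) n_gt0.
exists (rcons k p).
  by rewrite /is_composition mem_rcons inE negb_or k0 sumn_rcons e eqxx andbT; lia.
rewrite /w_comp /word_perm -big_filter; congr bigop.
apply: (inj_map val_inj); apply: (irr_sorted_eq ltn_trans ltnn) => //.
  rewrite (_ : map val _ = [seq i <- iota 0 n.-1 | i.+1 \notin inner_sums (rcons k p)]).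
    exact: (sorted_filter ltn_trans) (iota_ltn_sorted _ _).
  by rewrite -val_enum_ord filter_map enumT.
move=> i; apply/mapP/idP => [[j]|].
  rewrite mem_filter inner_sums_rcons => /andP[+ _] -> /=.
  by rewrite h /= ?negbK //; have := ltn_ord j; lia.
case/mapP=> j js ->; exists j => //; rewrite mem_filter mem_index_enum andbT.
rewrite inner_sums_rcons h /= ?negbK ?map_f //.
by have := ltn_ord j; lia.
Qed.

End CompositionPerm.

(** * Cycle types of the elements w_kappa *)

Section CycleType.
Variable n : nat.
Local Notation sr := (@simple_refl n).
Implicit Types (w : 'S_n) (s : seq 'I_n.-1).

Lemma word_perm_fix s (x : 'I_n) :
  all (fun i : 'I_n.-1 => (x != i :> nat) && (x != i.+1 :> nat)) s ->
  word_perm s x = x.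
Proof.
elim: s => [|i s IH] /=; first by rewrite word_perm_nil perm1.
case/andP=> /andP[h1 h2] /IH e; rewrite word_perm_cons permM.
have -> : sr i x = x; last exact: e.
by apply/val_inj; rewrite /= simple_refl_val (negbTE h1) (negbTE h2).
Qed.

Lemma word_perm_iota s o r (x : 'I_n) : map val s = iota o r ->
  word_perm s x = (if x == o :> nat then (o + r)%N else
                   if (o < x <= o + r)%N then x.-1 else x) :> nat.
Proof.
elim: s o r x => [|i s IH] o [|r] x //=.
  by move=> _; rewrite word_perm_nil perm1 addn0; case: eqP => //; case: ifP => //; lia.
case=> ei es; rewrite word_perm_cons permM (IH _ _ _ es) simple_refl_val ei.
by do ![case: ifP => /eqP]; do ?[case: ifP]; lia.
Qed.

(** The entry at x is the size of the block of x, which will be the length of the cycle of w_kappa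
    through x. *)
Definition block_sizes (kappa : seq nat) : seq nat :=
  flatten [seq nseq m m | m <- kappa].

Lemma count_block_sizes m kappa :
  count_mem m (block_sizes kappa) = (m * count_mem m kappa)%N.
Proof.
elim: kappa => [|a kappa IH] /=; first by rewrite muln0.
rewrite count_cat -/(block_sizes kappa) IH count_nseq mulnDr /=.
by congr (_ + _)%N; case: eqP => [->|]; rewrite ?mul1n ?muln1 ?mul0n ?muln0.
Qed.

Lemma size_block_sizes kappa : size (block_sizes kappa) = sumn kappa.
Proof.
by rewrite size_flatten /shape -map_comp; congr sumn; apply: map_id_in => m _; rewrite /= size_nseq.
Qed.

Lemma nth_block_sizes kappa x : (x < sumn kappa)%N -> exists k1 m k2,
  [/\ kappa = k1 ++ m :: k2, (sumn k1 <= x < sumn k1 + m)%N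
    & nth 0%N (block_sizes kappa) x = m].
Proof.
elim: kappa x => [|a kappa IH] x //= lt.
have [ltx|gex] := ltnP x a.
  exists [::], a, kappa; split=> //.
  by rewrite nth_cat size_nseq ltx nth_nseq ltx.
have [|k1 [m [k2 [ek h e]]]] := IH (x - a)%N; first by lia.
exists (a :: k1), m, k2; split; rewrite /= ?ek //; first by lia.
rewrite -ek -[block_sizes _]/(nseq a a ++ block_sizes kappa).
by rewrite nth_cat size_nseq ltnNge gex /= -e.
Qed.

Lemma w_comp_block k1 m k2 (x : 'I_n) : is_composition n (k1 ++ m :: k2) ->
  (sumn k1 <= x < sumn k1 + m)%N ->
  w_comp n (k1 ++ m :: k2) x =
    (if x == sumn k1 :> nat then (sumn k1 + m.-1)%N else x.-1) :> nat.
Proof.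
move=> kn xin; have [s [e _ ->]] := comp_word_ex kn.
have /andP[k0 _] := kn; move: k0; rewrite mem_cat inE !negb_or => /and3P[k10 m0 k20].
move: e; rewrite comp_word_cat add0n /=; set W1 := comp_word 0 k1; set W3 := comp_word _ k2.
move=> e; pose s1 := take (size W1) s; pose s2 := take m.-1 (drop (size W1) s).
pose s3 := drop m.-1 (drop (size W1) s).
have e1 : map val s1 = W1 by rewrite map_take e take_size_cat.
have e2 : map val s2 = iota (sumn k1) m.-1.
  by rewrite map_take map_drop e drop_size_cat // take_size_cat ?size_iota.
have e3 : map val s3 = W3.
  by rewrite !map_drop e drop_size_cat // drop_size_cat ?size_iota.
have -> : s = s1 ++ s2 ++ s3 by rewrite !cat_take_drop.
have fix1 : word_perm s1 x = x.
  apply: word_perm_fix; rewrite -(all_map val (fun i => (x != i :> nat) && (x != i.+1 :> nat))) e1.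
  by apply: sub_all (comp_word_bound 0 k10) => i; lia.
rewrite !word_perm_cat !permM fix1.
have val2 := word_perm_iota x e2.
have -> : word_perm s3 (word_perm s2 x) = word_perm s2 x.
  apply: word_perm_fix.
  rewrite -(all_map val (fun i => (word_perm s2 x != i :> nat) && (word_perm s2 x != i.+1 :> nat))) e3.
  apply: sub_all (comp_word_bound _ k20) => i; rewrite val2.
  by case: ifP => /eqP; do ?[case: ifP]; lia.
rewrite val2; case: eqP => //; case: ifP => //; lia.
Qed.

Lemma card_porbit_w_comp kappa (x : 'I_n) : is_composition n kappa ->
  #|porbit (w_comp n kappa) x| = nth 0%N (block_sizes kappa) x.
Proof.
move=> kn; have /andP[_ /eqP sumk] := kn.
have [|k1 [m [k2 [ek xin ->]]]] := @nth_block_sizes kappa x; first by rewrite sumk.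
rewrite {}ek in kn sumk *; set w := w_comp n _.
move: sumk; rewrite sumn_cat /= => sumk; set o := sumn k1 in xin sumk *.
have lt (i : 'I_m) : (o + i < n)%N by have := ltn_ord i; lia.
pose f (i : 'I_m) : 'I_n := Ordinal (lt i).
have fI : injective f by move=> i j [/addnI/val_inj].
have step (y : 'I_n) : (o <= y < o + m)%N ->
    w y = (if y == o :> nat then (o + m.-1)%N else y.-1) :> nat.
  exact: w_comp_block.
rewrite -[RHS]card_ord -[RHS](card_imset _ fI); congr #|pred_of_set _|.
have m0 : (0 < m)%N by lia.
have elt : (o + m.-1 < n)%N by lia.
pose e : 'I_n := Ordinal elt.
have powe k : (k < m)%N -> (w ^+ k)%g e = (o + m.-1 - k)%N :> nat.
  elim: k => [|k IH] lk; first by rewrite expg0 perm1 /= subn0.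
  have h := IH (ltnW lk); rewrite expgSr permM step ?h; last by lia.
  by case: eqP; lia.
have inE' (y : 'I_n) : (o <= y < o + m)%N -> y \in porbit w e.
  move=> h; apply/porbitP; exists (o + m.-1 - y)%N; apply/val_inj => /=.
  by rewrite powe; lia.
have stab k (y : 'I_n) : (o <= y < o + m)%N -> (o <= (w ^+ k)%g y < o + m)%N.
  elim: k y => [|k IH] y h; first by rewrite expg0 perm1.
  rewrite expgSr permM; have h' := IH y h; rewrite (step _ h').
  by case: eqP; lia.
have -> : porbit w x = porbit w e by apply/eqP; rewrite eq_porbit_mem inE'.
apply/setP=> y; apply/idP/imsetP => [/porbitP[k ->]|[i _ ->]]; last first.
  by apply: inE' => /=; have := ltn_ord i; lia.
have he : (o <= e < o + m)%N by rewrite /=; lia.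
have hk := stab k e he; have hk' : ((w ^+ k)%g e - o < m)%N by lia.
by exists (Ordinal hk') => //; apply/val_inj => /=; lia.
Qed.

Lemma card_porbit_conj w g x : #|porbit (w ^ g)%g (g x)| = #|porbit w x|.
Proof.
rewrite -[RHS](card_imset _ (@perm_inj _ g)); congr #|pred_of_set _|.
apply/setP=> y; apply/porbitP/imsetP => [[k ->]|[z /porbitP[k ->] ->]].
  exists ((w ^+ k)%g x); first exact: mem_porbit.
  by rewrite -conjXg /conjg !permM permK.
by exists k; rewrite -conjXg /conjg !permM permK.
Qed.

(** Conjugation preserves the number of points on cycles of length m, which for w_kappa is m times
    the number of parts m. For m = 0, where this says nothing, the parts are positive. *)
Theorem w_comp_conj_perm_eq kappa kappa' g :
  is_composition n kappa -> is_composition n kappa' ->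
  (w_comp n kappa ^ g = w_comp n kappa')%g -> perm_eq kappa kappa'.
Proof.
move=> kn kn' e; apply/allP => m _ /=; apply/eqP.
have key k : is_composition n k ->
    (m * count_mem m k)%N = #|[set x | #|porbit (w_comp n k) x| == m]|.
  move=> hk; rewrite -count_block_sizes cardsE cardE size_filter.
  have /andP[_ /eqP sz] := hk.
  rewrite -{1}(mkseq_nth 0%N (block_sizes k)) size_block_sizes sz /mkseq.
  rewrite -val_enum_ord -map_comp count_map -enumT; apply: eq_count => x /=.
  by rewrite -[RHS]/(#|porbit (w_comp n k) x| == m) card_porbit_w_comp.
have kk : (m * count_mem m kappa = m * count_mem m kappa')%N.
  rewrite !key // -e -(card_imset _ (@perm_inj _ g)); congr #|pred_of_set _|.
  apply/setP=> y; rewrite !inE -(permKV g y) mem_imset ?inE ?card_porbit_conj //.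
  exact: perm_inj.
have [m0|] := posnP m; last by move=> m0; apply/eqP; rewrite -(eqn_pmul2l m0) kk.
case/andP: kn => k0 _; case/andP: kn' => k0' _.
by rewrite m0 !(count_memPn _).
Qed.

End CycleType.

(** * Traces on Hecke algebras *)

Section Traces.
Variables (F : fieldType) (n : nat) (q : F) (H : unitAlgType F) (T : 'I_n.-1 -> H).
Hypothesis q_neq0 : q != 0.
Hypothesis HT : hecke_relations q T.
Local Notation sr := (@simple_refl n).
Local Notation z := (q - q^-1).
Local Notation Tp := (T_perm T).

Lemma T_unit i : T i \is a GRing.unit.
Proof.
have e := T_sq q_neq0 HT i.
apply/unitrP; exists (T i - z%:A); rewrite mulrBl mulrBr e mulr_algl mulr_algr.
by rewrite addrK.
Qed.

Lemma T_inv i : (T i)^-1 = T i - z%:A.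
Proof.
apply: (mulrI (T_unit i)); rewrite divrr ?T_unit // mulrBr (T_sq q_neq0 HT) mulr_algr.
by rewrite addrK.
Qed.

Lemma T_perm_unit w : Tp w \is a GRing.unit.
Proof. by apply: rpred_prod => i _; exact: T_unit. Qed.

(** A trace may replace T_w = T_X T_i by T_i T_X, a twisted trace too, up to a sign and a multiple
    of T_X. The new product is T_v or T_v + z T_X, according to whether the conjugation keeps the
    length or lowers it by two. *)
Lemma conj_cases w i : descent w^-1 i -> let X := (w * sr i)%g in
  let v := (sr i * w * sr i)%g in
  [/\ Tp w = Tp X * T i, coxlen w = (coxlen X).+1 &
      coxlen v = coxlen w /\ T i * Tp X = Tp v \/
      coxlen w = (coxlen v).+2 /\ T i * Tp X = Tp v + z *: Tp X].
Proof.
move=> d X v; have dX : ~~ descent X^-1 i.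
  by rewrite /X invMg simple_reflV descent_mul d.
have vE : v = (sr i * X)%g by rewrite /v /X mulgA.
have lw : coxlen w = (coxlen X).+1 by rewrite (coxlen_descentr d).
split=> //; first by rewrite -(T_perm_ascentr q_neq0 HT dX) simple_reflmK.
have [dd|Nd] := boolP (descent X i); [right|left]; rewrite vE.
  by rewrite lw (coxlen_descent dd) (T_perm_descent q_neq0 HT).
by rewrite lw coxlen_ascent // (T_perm_ascent q_neq0 HT).
Qed.

Definition trace_fun (f : H -> F) : Prop :=
  (forall a x y, f (a *: x + y) = a * f x + f y) /\
  (forall x y, f (x * y) = f (y * x)).

Section OneTrace.
Variable f : H -> F.
Hypothesis ftr : trace_fun f.

Lemma trace0 : f 0 = 0.
Proof. by have := ftr.1 (-1) 0 0; rewrite scaler0 addr0 mulN1r addNr. Qed.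

Lemma traceD x y : f (x + y) = f x + f y.
Proof. by have := ftr.1 1 x y; rewrite scale1r mul1r. Qed.

Lemma traceZ a x : f (a *: x) = a * f x.
Proof. by have := ftr.1 a x 0; rewrite !addr0 trace0 addr0. Qed.

Lemma trace_conj u x : u \is a GRing.unit -> f (u * x * u^-1) = f x.
Proof. by move=> uu; rewrite ftr.2 mulrA mulVr ?mul1r. Qed.

(** The default 1 outside the range allows words of blocks to be shifted without carrying bounds in
    the indices. *)
Definition T_nat (i : nat) : H := if insub i is Some j then T j else 1.

Definition T_nats (s : seq nat) : H := \prod_(i <- s) T_nat i.

Lemma T_nats_cat s t : T_nats (s ++ t) = T_nats s * T_nats t.
Proof. exact: big_cat. Qed.

Lemma T_nat_ord (i : 'I_n.-1) : T_nat i = T i.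
Proof. by rewrite /T_nat valK. Qed.

Lemma T_nats_word (s : seq 'I_n.-1) : T_nats (map val s) = T_word T s.
Proof. by rewrite /T_nats big_map; apply: eq_bigr => i _; rewrite T_nat_ord. Qed.

Lemma T_perm_w_comp kappa : is_composition n kappa ->
  Tp (w_comp n kappa) = T_nats (comp_word 0 kappa).
Proof.
move=> kn; have [s [e srt ->]] := comp_word_ex kn.
have [_ len] := sorted_word srt.
by rewrite (T_perm_word q_neq0 HT) ?len // -e T_nats_word.
Qed.

Lemma T_nats_commute s t :
  (forall i j, i \in s -> j \in t -> (i.+1 < j)%N || (j.+1 < i)%N) ->
  T_nats s * T_nats t = T_nats t * T_nats s.
Proof.
move=> far; have comm i j : (i.+1 < j)%N || (j.+1 < i)%N ->
    T_nat i * T_nat j = T_nat j * T_nat i.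
  move=> hij; rewrite /T_nat; case: insubP => [i' _ ei|]; last by rewrite mul1r mulr1.
  case: insubP => [j' _ ej|]; last by rewrite mul1r mulr1.
  by apply: (T_commute HT); rewrite ei ej.
elim: s far => [|i s IH] far; first by rewrite /T_nats big_nil mul1r mulr1.
rewrite /T_nats !big_cons -/(T_nats s) -/(T_nats t).
rewrite -mulrA IH; last by move=> i' j' h; apply: far; rewrite inE h orbT.
rewrite !mulrA; congr (_ * _).
have : forall j, j \in t -> (i.+1 < j)%N || (j.+1 < i)%N.
  by move=> j; apply: far; rewrite inE eqxx.
elim: t {far IH} => [|j t IH] far; first by rewrite /T_nats big_nil mul1r mulr1.
rewrite /T_nats !big_cons -/(T_nats t) mulrA comm; last by apply: far; rewrite inE eqxx.
by rewrite -!mulrA IH // => j' h; apply: far; rewrite inE h orbT.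
Qed.

(** If x carries i and i + 1 to consecutive points in the same order, both products are T of the
    same element s_i x, one longer than x. *)
Lemma T_nats_conj (x : 'S_n) (phi : nat -> nat) (s : seq nat) :
  (forall i, i \in s -> exists j j' : 'I_n.-1, [/\ j = i :> nat, j' = phi i :> nat,
     x (lo_ord j) = lo_ord j' & x (hi_ord j) = hi_ord j']) ->
  T_nats s * Tp x = Tp x * T_nats (map phi s).
Proof.
elim: s => [|i s IH] h; first by rewrite /T_nats !big_nil mul1r mulr1.
rewrite /T_nats /= !big_cons -/(T_nats s) -/(T_nats (map phi s)).
rewrite -mulrA IH; last by move=> i' h'; apply: h; rewrite inE h' orbT.
rewrite !mulrA; congr (_ * _).
have [|j [j' [ej ej' xl xh]]] := h i; first by rewrite inE eqxx.
rewrite -ej' -ej !T_nat_ord -(T_perm_ascent q_neq0 HT); last first.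
  by rewrite descentN xl xh /=.
rewrite -(T_perm_ascentr q_neq0 HT); last first.
  by rewrite descentN -xl -xh !permK /=.
by rewrite conjgC /simple_refl tpermJ xl xh.
Qed.

(** It is enough to exchange two neighbouring groups of blocks. The permutation x that moves one
    group past the other preserves the order within each group, so T_x intertwines the two words by
    [T_nats_conj]. *)
Lemma trace_w_comp kappa kappa' : is_composition n kappa -> perm_eq kappa kappa' ->
  f (Tp (w_comp n kappa)) = f (Tp (w_comp n kappa')).
Proof.
move=> kn pe.
have kn' : is_composition n kappa'.
  by case/andP: kn => k0 ks; rewrite /is_composition -(perm_mem pe) k0 -(perm_sumn pe).
(* The default 0 makes the value defined on all sequences, as the induction over exchanges of
   segments requires. *)
pose V k := if is_composition n k then f (T_nats (comp_word 0 k)) else 0.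
have : V kappa = V kappa'; last by rewrite /V kn kn' !T_perm_w_comp.
apply: (@catCA_perm_subst nat _ V) pe => s1 s2 s3; rewrite /V.
have -> : is_composition n (s2 ++ s1 ++ s3) = is_composition n (s1 ++ s2 ++ s3).
  by rewrite /is_composition !mem_cat !sumn_cat orbCA addnCA.
case: ifP => //; rewrite /is_composition !mem_cat !negb_or !sumn_cat.
case/andP=> /and3P[s10 s20 s30] /eqP sn.
set A := sumn s1 in sn *; set B := sumn s2 in sn *; set D := sumn s3 in sn *.
have xlt (k : 'I_n) : ((if k < A then k + B else if k < A + B then k - A else k) < n)%N.
  by have := ltn_ord k; do ?case: ifP; lia.
pose x0 k : 'I_n := Ordinal (xlt k).
have xI : injective x0.
  move=> k l /(congr1 val) /= e; apply/val_inj => /=; move: e.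
  by do ?case: ifP; lia.
pose x := perm xI.
rewrite !comp_word_cat !add0n -/A -/B addnC -[(B + A)%N]addnC.
rewrite (comp_word_shift A s2) (comp_word_shift B s1).
set W1 := comp_word 0 s1; set W2 := comp_word 0 s2; set W3 := comp_word _ s3.
have xv (k : 'I_n) : x k = (if (k < A)%N then k + B else if (k < A + B)%N then k - A else k)%N :> nat.
  by rewrite permE.
have hc (c : nat -> nat) W : (forall i, i \in W -> [/\ (i.+1 < n)%N, (c i).+1 < n &
      forall k : 'I_n, ((k = i :> nat) -> x k = c i :> nat) /\
         ((k = i.+1 :> nat) -> x k = (c i).+1 :> nat)])%N ->
    T_nats W * Tp x = Tp x * T_nats (map c W).
  move=> hW; apply: T_nats_conj => i /hW[l1 l2 hx].
  have l1' : (i < n.-1)%N by lia.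
  have l2' : (c i < n.-1)%N by lia.
  exists (Ordinal l1'), (Ordinal l2'); split=> //; apply/val_inj => /=.
    by case: (hx (lo_ord (Ordinal l1'))) => + _; apply.
  by case: (hx (hi_ord (Ordinal l1'))) => _; apply.
have e1 : T_nats W1 * Tp x = Tp x * T_nats (map (addn B) W1).
  apply: hc => i /(allP (comp_word_bound 0 s10)) /= hi.
  split; [lia|lia|move=> k; rewrite xv; split=> ->; do ?case: ifP; lia].
have e2 : T_nats (map (addn A) W2) * Tp x = Tp x * T_nats W2.
  have k2 : map (subn^~ A) (map (addn A) W2) = W2.
    by rewrite -map_comp map_id_in // => i _ /=; rewrite addKn.
  rewrite -{2}k2.
  apply: hc => i /mapP[j /(allP (comp_word_bound 0 s20)) /= hj ->].
  split; [lia|lia|move=> k; rewrite xv; split=> ->; do ?case: ifP; lia].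
have e3 : T_nats W3 * Tp x = Tp x * T_nats W3.
  rewrite -{2}[W3]map_id; apply: hc => i /(allP (comp_word_bound _ s30)) /= hi.
  split; [lia|lia|move=> k; rewrite xv; split=> ->; do ?case: ifP; lia].
rewrite !T_nats_cat -(trace_conj (T_nats W1 * _) (T_perm_unit x^-1)).
have xu := T_perm_unit x.
have -> : T_nats W2 * (T_nats [seq (B + i)%N | i <- W1] * T_nats W3) =
   (Tp x)^-1 * (T_nats W1 * (T_nats [seq (A + i)%N | i <- W2] * T_nats W3)) * (Tp x)^-1^-1.
  apply: (mulrI xu); rewrite invrK !mulrA divrr // mul1r.
  rewrite -[T_nats W1 * _ * _ * Tp x]mulrA e3 !mulrA -[T_nats W1 * _ * Tp x]mulrA e2.
  rewrite mulrA e1 -!mulrA; congr (_ * _); rewrite !mulrA; congr (_ * _).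
  apply: T_nats_commute => i j /(allP (comp_word_bound 0 s20)) /= hi.
  by case/mapP=> j' /(allP (comp_word_bound 0 s10)) /= hj ->; lia.
by rewrite [RHS]trace_conj ?unitrV // trace_conj // T_perm_unit.
Qed.

End OneTrace.

(** Every conjugation in the descent keeps or lowers the length. If the final length equals the
    initial one, none lowered it, and each step replaced T_X T_i by T_i T_X = T_v. *)
Lemma trace_min_length (w : 'S_n) : (0 < n)%N -> exists kappa, [/\ is_composition n kappa,
  exists g, (w ^ g)%g = w_comp n kappa,
  (coxlen (w_comp n kappa) <= coxlen w)%N &
  coxlen (w_comp n kappa) = coxlen w ->
    forall f, trace_fun f -> f (Tp w) = f (Tp (w_comp n kappa))].
Proof.
move=> n_gt0; elim/cyclic_shift_ind: w => [s srt _|w i d IH IHeq].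
  have [kappa kn e] := sorted_word_comp n_gt0 srt.
  by exists kappa; rewrite -e; split=> //; exists 1%g; rewrite conjg1.
have [Tw lw cases] := conj_cases d.
have cg : (sr i * w * sr i = w ^ sr i)%g by rewrite /conjg simple_reflV mulgA.
case: cases => -[lv Tv].
  have [kappa [kn [g eg] le eq]] := IHeq lv.
  exists kappa; split; rewrite -?lv //.
    by exists (sr i * g)%g; rewrite conjgM -cg.
  by move=> e f ftr; rewrite -eq // -Tv Tw ftr.2.
have [|kappa [kn [g eg] le eq]] := IH (sr i * w * sr i)%g; first by rewrite lv.
exists kappa; split=> //; rewrite ?lv.
- by exists (sr i * g)%g; rewrite conjgM -cg.
- by move: le; lia.
by move=> e; move: le; rewrite e; lia.
Qed.

End Traces.

(** * Values at q of Laurent polynomials over Z[1/2] *)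

Section HalfLaurent.
Variables (F : fieldType) (q : F).
Hypotheses (q_neq0 : q != 0) (charF : 2%:R != 0 :> F).

(** Closure under the ring operations carries the whole descent, so the polynomials themselves need
    to be chosen only once, at the end. *)
Definition is_hl (c : F) : Prop := exists g, hl_eval g q = c.

Lemma int_eval_is_rmorph_facts :
  [/\ forall p r, int_eval (p + r) q = int_eval p q + int_eval r q,
      forall p r, int_eval (p * r) q = int_eval p q * int_eval r q,
      int_eval 'X q = q & forall m : int, int_eval m%:P q = m%:~R].
Proof.
split=> [p r|p r||m]; rewrite /int_eval ?rmorphD ?rmorphM ?hornerD ?hornerM //.
  by rewrite map_polyX hornerX.
by rewrite map_polyC hornerC.
Qed.

Lemma hl_int (m : int) : is_hl m%:~R.
Proof.
have [_ _ _ hC] := int_eval_is_rmorph_facts.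
by exists (HalfLaurent m%:P 0 0); rewrite /hl_eval hC !expr0 mul1r divr1.
Qed.

Lemma hlM a b : is_hl a -> is_hl b -> is_hl (a * b).
Proof.
have [_ hM _ _] := int_eval_is_rmorph_facts.
case=> -[p k l] <- [[r k' l'] <-].
exists (HalfLaurent (p * r) (k + k') (l + l')); rewrite /hl_eval hM /= !exprD.
by rewrite mulf_div [X in _ = _ / X]mulrACA.
Qed.

Lemma hlD a b : is_hl a -> is_hl b -> is_hl (a + b).
Proof.
have [hD hM hX hC] := int_eval_is_rmorph_facts.
have h1 : int_eval 1 q = 1 by have := hC 1; rewrite polyC1.
have hXn m : int_eval ('X^m) q = q ^+ m.
  by elim: m => [|m IH]; rewrite ?exprS ?hM ?hX ?IH // !expr0.
have h2 m : int_eval (2%:R ^+ m) q = 2%:R ^+ m.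
  by elim: m => [|m IH]; rewrite ?exprS ?hM ?hD ?h1 ?IH // !expr0.
case=> -[p k l] <- [[r k' l'] <-].
exists (HalfLaurent (p * (2%:R ^+ k' * 'X^l') + r * (2%:R ^+ k * 'X^l)) (k + k') (l + l')).
rewrite /hl_eval /= hD !hM !hXn !h2 !exprD.
have n2 m : 2%:R ^+ m != 0 :> F by rewrite expf_neq0.
have nq m : q ^+ m != 0 by rewrite expf_neq0.
by field; rewrite !n2 !nq.
Qed.

Lemma hlN a : is_hl a -> is_hl (- a).
Proof. by move=> h; rewrite -mulN1r; apply: hlM h; apply: (hl_int (-1)). Qed.

Lemma hl_q_sub : is_hl (q - q^-1).
Proof.
have [hD hM hX hC] := int_eval_is_rmorph_facts.
exists (HalfLaurent ('X * 'X + (-1)%:P) 0 1); rewrite /hl_eval /= hD hM hX hC.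
by rewrite !expr0 mul1r expr1 mulrDl -mulrA divff // mulr1 mulN1r.
Qed.

Lemma hl_half : is_hl 2%:R^-1.
Proof.
have [_ _ _ hC] := int_eval_is_rmorph_facts.
by exists (HalfLaurent 1%:P 1 0); rewrite /hl_eval /= hC expr1 expr0 mulr1 mul1r.
Qed.

End HalfLaurent.

(** * Traces invariant under #, and the coefficients g *)

Section AlternatingTraces.
Variables (F : fieldType) (n : nat) (q : F) (H : unitAlgType F) (T : 'I_n.-1 -> H).
Hypotheses (q_neq0 : q != 0) (charF : 2%:R != 0 :> F) (n_gt0 : (0 < n)%N).
Hypothesis HT : hecke_relations q T.
Variable sharp : {lrmorphism H -> H}.
Hypothesis sharpP : is_sharp T sharp.
Local Notation sr := (@simple_refl n).
Local Notation z := (q - q^-1).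
Local Notation Tp := (T_perm T).

Lemma sharp_T i : sharp (T i) = z%:A - T i.
Proof.
have := sharpP.2 (sr i); rewrite simple_reflV coxlen_simple expr1 scaleN1r.
by rewrite !(T_perm_simple q_neq0 HT) (T_inv q_neq0 HT) opprB.
Qed.

Lemma sharp_T_word s : sharp (sharp (T_word T s)) = T_word T s.
Proof.
rewrite /T_word !rmorph_prod; apply: eq_bigr => i _.
by rewrite /= sharp_T rmorphB /= linearZ /= rmorph1 sharp_T opprB addrC subrK.
Qed.

Lemma sharpK_T_perm w : sharp (sharp (Tp w)) = Tp w.
Proof. exact: sharp_T_word. Qed.

(* The span, with coefficients in Z[1/2, q, q^-1], of the T_v with v of length
   less than k. *)
Definition shorter (k : nat) (h : H) : Prop :=
  forall Q : H -> Prop, Q 0 -> (forall x y, Q x -> Q y -> Q (x + y)) ->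
    (forall c x, is_hl q c -> Q x -> Q (c *: x)) ->
    (forall v, (coxlen v < k)%N -> Q (Tp v)) -> Q h.

Lemma shorterD k x y : shorter k x -> shorter k y -> shorter k (x + y).
Proof. by move=> hx hy Q Q0 QD QZ QT; exact: QD (hx Q Q0 QD QZ QT) (hy Q Q0 QD QZ QT). Qed.

Lemma shorterZ k c x : is_hl q c -> shorter k x -> shorter k (c *: x).
Proof. by move=> hc hx Q Q0 QD QZ QT; exact: QZ (hx Q Q0 QD QZ QT). Qed.

Lemma shorter_T_perm k v : (coxlen v < k)%N -> shorter k (Tp v).
Proof. by move=> lt Q _ _ _ QT; apply: QT. Qed.

Lemma shorter_leq k l x : (k <= l)%N -> shorter k x -> shorter l x.
Proof.
move=> le hx Q Q0 QD QZ QT; apply: hx => // v lt.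
by apply: QT; apply: leq_trans le.
Qed.

Lemma shorter_T_mul k i x : shorter k x -> shorter k.+1 (T i * x).
Proof.
move=> hx; apply: (hx (fun x => shorter k.+1 (T i * x))) => [|y y'|c y|v lt].
- by rewrite mulr0 => Q.
- by rewrite mulrDr; apply: shorterD.
- by move=> hc; rewrite -scalerAr; apply: shorterZ.
have [d|Nd] := boolP (descent v i).
  rewrite (T_perm_descent q_neq0 HT) //; apply: shorterD.
    by apply: shorter_T_perm; move: lt; rewrite (coxlen_descent d); lia.
  by apply: shorterZ; [exact: hl_q_sub|apply: shorter_T_perm; lia].
rewrite -(T_perm_ascent q_neq0 HT) //.
by apply: shorter_T_perm; rewrite coxlen_ascent.
Qed.

(** Since T_i^# = z - T_i, the leading term of T_w^# is T_w up to the sign of w. For odd w this sign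
    is what will determine f(T_w). *)
Lemma sharp_T_perm w : exists2 R, shorter (coxlen w) R &
  sharp (Tp w) = (-1) ^+ coxlen w *: (Tp w + R).
Proof.
have [k] := ubnP (coxlen w); elim: k => // k IH in w *; rewrite ltnS => lek.
case: (pickP (descent w)) => [i d|Nd]; last first.
  have -> : w = 1%g by apply: perm_no_descent => i; rewrite Nd.
  exists 0; first by move=> Q.
  by rewrite (T_perm1 q_neq0 HT) rmorph1 coxlen1 expr0 scale1r addr0.
have lw := coxlen_descent d; pose v := (sr i * w)%g.
have [|R hR e] := IH v; first by rewrite -/v in lw; rewrite -ltnS -lw.
have dv : ~~ descent v i by rewrite /v descent_mul d.
have wE : w = (sr i * v)%g by rewrite /v simple_reflKm.
exists (T i * R - z *: Tp v - z *: R).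
  rewrite lw -/v; apply: shorterD; last first.
    rewrite -scaleNr; apply: shorterZ; first exact/hlN/hl_q_sub.
    exact: shorter_leq hR.
  apply: shorterD; first exact: shorter_T_mul.
  rewrite -scaleNr; apply: shorterZ; first exact/hlN/hl_q_sub.
  exact: shorter_T_perm.
rewrite lw -/v {1}wE (T_perm_ascent q_neq0 HT) // rmorphM /= e sharp_T.
rewrite -scalerAr exprS mulN1r scaleNr -scalerN; congr (_ *: _).
rewrite mulrBl mulr_algl -opprB; congr (- _).
rewrite wE (T_perm_ascent q_neq0 HT) // mulrDr scalerDr opprD !addrA.
by congr (_ + _); rewrite addrAC.
Qed.

(** The model is the average under # of the character of S(mu), whose value at T_w for even w is the
    character at A_w. *)
Definition alt_trace (f : H -> F) : Prop :=
  trace_fun f /\ forall w, f (sharp (Tp w)) = f (Tp w).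

Variable wC : {set 'S_n} -> 'S_n.
Hypothesis wCP : forall C, C \in classes (Alt 'I_n) -> wC C \in min_length C.

(** A single g works for all these functionals f; this makes the coefficients independent of mu. *)
Definition class_span (h : H) : Prop := exists2 g : {set 'S_n} -> F,
  (forall C, is_hl q (g C)) & forall f, alt_trace f ->
    f h = \sum_(C in classes (Alt 'I_n)) g C * f (Tp (wC C)).

Lemma class_span_eq h h' : (forall f, alt_trace f -> f h = f h') ->
  class_span h' -> class_span h.
Proof. by move=> e [g gP gE]; exists g => // f fP; rewrite e // gE. Qed.

Lemma class_span0 : class_span 0.
Proof.
exists (fun=> 0) => [C|f fP]; first exact: (hl_int q 0).
by rewrite (trace0 fP.1) big1 // => C _; rewrite mul0r.
Qed.

Lemma class_spanD x y : class_span x -> class_span y -> class_span (x + y).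
Proof.
move=> [g gP gE] [g' gP' gE']; exists (fun C => g C + g' C) => [C|f fP].
  exact: hlD.
rewrite (traceD fP.1) gE // gE' // -big_split; apply: eq_bigr => C _.
by rewrite /= mulrDl.
Qed.

Lemma class_spanZ c x : is_hl q c -> class_span x -> class_span (c *: x).
Proof.
move=> hc [g gP gE]; exists (fun C => c * g C) => [C|f fP]; first exact: hlM.
rewrite (traceZ fP.1) gE // big_distrr; apply: eq_bigr => C _.
by rewrite /= mulrA.
Qed.

(** The element w_C is at most as long as its conjugate w_kappa. The descent takes it to some
    w_kappa' of the same cycle type, so kappa' rearranges kappa and the lengths agree; hence no step
    was shortening, and traces take the same value at all three. *)
Lemma class_span_w_comp kappa : is_composition n kappa ->
  w_comp n kappa \in Alt 'I_n -> class_span (Tp (w_comp n kappa)).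
Proof.
move=> kn wA; set w0 := w_comp n kappa in wA *.
pose C := (w0 ^: Alt 'I_n)%g.
have CA : C \in classes (Alt 'I_n) by apply: mem_classes.
exists (fun C' => (C' == C)%:R) => [C'|f fP].
  by case: eqP => _; [exact: (hl_int q 1)|exact: (hl_int q 0)].
rewrite (bigD1 C) //= eqxx mul1r big1 ?addr0; last first.
  by move=> C' /andP[_ /negbTE->]; rewrite mul0r.
have := wCP CA; rewrite inE => /andP[wCin /forall_inP minC].
have [g gA wCE] := imsetP wCin.
have [kappa' [kn' [g' e']] le eq] := trace_min_length q_neq0 HT (wC C) n_gt0.
have pe : perm_eq kappa kappa'.
  by apply: (@w_comp_conj_perm_eq n _ _ (g * g')%g) => //; rewrite conjgM -wCE.
have sz := perm_size pe.
have len : coxlen (w_comp n kappa') = coxlen (wC C).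
  apply/eqP; rewrite eqn_leq le /= coxlen_w_comp // -sz -coxlen_w_comp //.
  by apply: minC; apply: class_refl.
by rewrite eq // ?(trace_w_comp q_neq0 HT fP.1 kn pe) //; exact: fP.1.
Qed.

Theorem class_span_T_perm w : class_span (Tp w).
Proof.
elim/cyclic_shift_ind: w => [s srt IH|w i d IH IHeq]; last first.
  have [Tw lw cases] := conj_cases q_neq0 HT d.
  case: cases => -[lv Tv].
    apply: class_span_eq (IHeq lv) => f fP; by rewrite -Tv Tw fP.1.2.
  apply: (@class_span_eq _ (T i * Tp (w * sr i)%g)) => [f fP|]; first by rewrite Tw fP.1.2.
  rewrite Tv; apply: class_spanD; first by apply: IH; rewrite lv.
  by apply: class_spanZ; [exact: hl_q_sub|apply: IH; rewrite lw].
have [kappa kn e] := sorted_word_comp n_gt0 srt; rewrite -e in IH *.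
set w := w_comp n kappa in IH *.
have [wA|wNA] := boolP (w \in Alt 'I_n); first exact: class_span_w_comp.
(* For odd w, invariance under # gives f(T_w) = - f(T_w) - f(R), so f(T_w) = - f(R)/2 with R a
   combination of shorter terms. Odd elements cannot be avoided, as X has the opposite parity to
   w. *)
have [R hR sE] := sharp_T_perm w.
have odd_w : (-1) ^+ coxlen w = -1 :> F.
  by rewrite -signr_odd odd_coxlen; move: wNA; rewrite Alt_even negbK => ->.
have hRs : class_span R.
  by apply: hR; [exact: class_span0|exact: class_spanD|exact: class_spanZ|exact: IH].
have half1 : 2%:R^-1 + 2%:R^-1 = 1 :> F by field.
apply: (@class_span_eq _ (- 2%:R^-1 *: R)); last first.
  by apply: class_spanZ => //; apply: hlN; exact: hl_half.
move=> f fP; have ftr := fP.1.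
have := fP.2 w; rewrite sE odd_w !(traceZ ftr) (traceD ftr) => e2.
have -> : f R = - (f (Tp w) + f (Tp w)) by rewrite -{1}e2; ring.
by rewrite mulrNN mulrDr -mulrDl half1 mul1r.
Qed.

End AlternatingTraces.

(** * Descent for twisted traces, with degrees and the relation on elements *)

Section TwistedTraces.
Variables (F : fieldType) (n : nat) (q : F) (H : unitAlgType F) (T : 'I_n.-1 -> H).
Hypotheses (q_neq0 : q != 0) (n_gt0 : (0 < n)%N).
Hypothesis HT : hecke_relations q T.
Local Notation sr := (@simple_refl n).
Local Notation z := (q - q^-1).
Local Notation Tp := (T_perm T).

Definition twisted_trace (f : H -> F) : Prop :=
  (forall a x y, f (a *: x + y) = a * f x + f y) /\
  (forall x i, f (x * T i) = z * f x - f (T i * x)).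

Variables (f : H -> F) (hooks : seq nat) (K : F).
Hypothesis ftw : twisted_trace f.
Hypothesis hooks_comp : is_composition n hooks.
Hypothesis f_w_comp : forall kappa, is_composition n kappa ->
  exists e : int, f (Tp (w_comp n kappa)) = e%:~R * K /\
    (e != 0 -> sort geq kappa = hooks).

Lemma reduces_to_step (w v u : 'S_n) : cyclic_step w v || drop_step w v ->
  reduces_to v u -> reduces_to w u.
Proof.
move=> st h; apply: t_trans h; apply: t_step.
by case/orP: st => [/connect1->|->]; rewrite ?orbT.
Qed.

(** If the conjugation keeps the length, the polynomial is x times that of X minus that of v; X is
    shorter by one, which pays for the factor x in the degree bound. *)
Theorem twisted_trace_T_perm w : exists a : {poly int},
  [/\ a != 0 -> ((size a).-1 + coxlen (w_comp n hooks) <= coxlen w)%N,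
      f (Tp w) = int_eval a z * K &
      a != 0 -> exists kappa, [/\ is_composition n kappa,
        sort geq kappa = hooks & reduces_to w (w_comp n kappa)]].
Proof.
have [hD hM hX hC] := int_eval_is_rmorph_facts z.
have hN (a : {poly int}) : int_eval (- a) z = - int_eval a z.
  by rewrite -mulN1r -polyC1 -polyCN hM hC mulN1r.
elim/cyclic_shift_ind: w => [s srt _|w i d IH IHeq].
  have [kappa kn e] := sorted_word_comp n_gt0 srt; rewrite -e.
  have [m [fE mP]] := f_w_comp kn; exists m%:P; rewrite hC polyC_eq0; split=> // m0.
    have sK := mP m0; rewrite size_polyC m0 /= add0n !coxlen_w_comp //.
    by rewrite -sK size_sort.
  exists kappa; split=> //; first exact: mP.
  by apply: t_step; rewrite connect0.
have [Tw lw cases] := conj_cases q_neq0 HT d.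
set X := (w * sr i)%g in Tw lw cases; set v := (sr i * w * sr i)%g in cases IHeq.
have stepv : (coxlen v <= coxlen w)%N -> cyclic_step w v.
  by move=> le; rewrite /cyclic_step le andbT; apply/existsP; exists i.
have ftwZ a x : f (a *: x) = a * f x.
  have f0 : f 0 = 0 by have := ftw.1 (-1) 0 0; rewrite scaler0 addr0 mulN1r addNr.
  by have := ftw.1 a x 0; rewrite !addr0 f0 addr0.
have fTw : f (Tp w) = z * f (Tp X) - f (T i * Tp X) by rewrite Tw ftw.2.
case: cases => -[lv Tv].
  have [av [degv valv redv]] := IHeq lv.
  have [ax [degx valx redx]] := IH X (eq_leq (esym lw)).
  exists ('X * ax - av); split=> [a0||a0].
  - have [x0|x0] := eqVneq ax 0.
      rewrite x0 mulr0 sub0r size_polyN in a0 *; rewrite -lv.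
      by apply: degv; rewrite -oppr_eq0.
    have dx := degx x0.
    have := size_poly_gt0 ax; rewrite x0 => px.
    have s1 : size ('X * ax) = (size ax).+1 by rewrite mulrC size_mulX.
    have le : (size ('X * ax - av)%R <= maxn (size ax).+1 (size av))%N.
      by rewrite -s1 -(size_polyN av) size_polyD.
    move: le dx px degv; rewrite lw lv.
    have [v0|v0] := eqVneq av 0; first by rewrite v0 size_poly0; lia.
    move=> le dx px /(_ isT) dv; have := size_poly_gt0 av; rewrite v0 => pv.
    by move: (size ('X * ax - av)) le => A; lia.
  - rewrite fTw Tv valv valx hD hN hM hX; ring.
  (* At least one of the two polynomials is nonzero. If it is the one of v, then w moves to v by
     conjugation; otherwise w drops to X, a legitimate step because v is as long as w. *)
  have [v0|v0] := eqVneq av 0.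
    have x0 : ax != 0 by apply: contraNneq a0 => ->; rewrite v0 mulr0 subr0.
    have [kappa [kn sk red]] := redx x0; exists kappa; split=> //.
    apply: reduces_to_step red; apply/orP; right; apply/existsP; exists i => /=.
    by rewrite -/v lv eqxx /= -/X eqxx orbT -lw eqxx.
  have [kappa [kn sk red]] := redv v0; exists kappa; split=> //.
  by apply: reduces_to_step red; rewrite stepv // lv.
(* When the length drops by two, T_i T_X = T_v + z T_X and the two terms z f(T_X) cancel, so f(T_w)
   = - f(T_v). *)
have [|a [deg val red]] := IH v; first by rewrite lv.
exists (- a); rewrite oppr_eq0 size_polyN; split=> [a0||a0].
- by apply: leq_trans (deg a0) _; rewrite lv -addn2 leq_addr.
- rewrite fTw Tv addrC [Tp v + _]addrC ftw.1 val hN; ring.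
have [kappa [kn sk rd]] := red a0; exists kappa; split=> //.
by apply: reduces_to_step rd; rewrite stepv // lv; lia.
Qed.

End TwistedTraces.

(** * Specht modules and the map tau *)

Section SpechtTrace.
Variables (F : fieldType) (n : nat) (lam : seq nat).
Local Notation V := (specht F n lam).
Local Notation b t := (@bvec F n lam (val t)).
Local Notation St := (std n lam).

Lemma bvecE (t : tableau n) (s : St) : @bvec F n lam t s = (val s == t)%:R.
Proof. by rewrite ffunE. Qed.

Lemma specht_sum (v : V) : v = \sum_(t : St) (v t : F) *: b t.
Proof.
apply/ffunP => s; rewrite sum_ffunE (bigD1 s) //= big1 => [|t ne].
  by rewrite addr0 !ffunE eqxx; apply/esym/mulr1.
by rewrite !ffunE val_eqE eq_sym (negbTE ne); apply/mulr0.
Qed.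

Definition linear_map (f : V -> V) : Prop := forall a u v, f (a *: u + v) = a *: f u + f v.

Section LinearMap.
Variable f : V -> V.
Hypothesis fL : linear_map f.

Lemma linear_map0 : f 0 = 0.
Proof. by have := fL (-1) 0 0; rewrite scaler0 addr0 scaleN1r addNr. Qed.

Lemma linear_mapD u v : f (u + v) = f u + f v.
Proof. by have := fL 1 u v; rewrite !scale1r. Qed.

Lemma linear_mapZ a u : f (a *: u) = a *: f u.
Proof. by have := fL a u 0; rewrite !addr0 linear_map0 addr0. Qed.

Lemma linear_map_sum (I : Type) (r : seq I) (P : pred I) (c : I -> F) (u : I -> V) :
  f (\sum_(i <- r | P i) c i *: u i) = \sum_(i <- r | P i) c i *: f (u i).
Proof.
by elim/big_rec2: _ => [|i x y _ <-]; [exact: linear_map0|rewrite fL].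
Qed.

Lemma linear_map_sum1 (I : Type) (r : seq I) (P : pred I) (u : I -> V) :
  f (\sum_(i <- r | P i) u i) = \sum_(i <- r | P i) f (u i).
Proof.
by elim/big_rec2: _ => [|i x y _ <-]; [exact: linear_map0|rewrite linear_mapD].
Qed.

Lemma linear_map_eval v s : f v s = \sum_(t : St) (v t : F) * (f (b t) s : F).
Proof.
by rewrite {1}(specht_sum v) linear_map_sum sum_ffunE; apply: eq_bigr => t _; rewrite ffunE.
Qed.

End LinearMap.

Lemma linear_map_ext f g : linear_map f -> linear_map g ->
  (forall t : St, f (b t) = g (b t)) -> f =1 g.
Proof.
move=> fL gL e v; rewrite (specht_sum v) !linear_map_sum //.
by apply: eq_bigr => t _; rewrite e.
Qed.

Definition spur (f : V -> V) : F := \sum_(t : St) f (b t) t.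

Lemma eq_spur f g : f =1 g -> spur f = spur g.
Proof. by move=> e; apply: eq_bigr => t _; rewrite e. Qed.

Lemma spurC f g : linear_map f -> linear_map g ->
  spur (fun v => f (g v)) = spur (fun v => g (f v)).
Proof.
move=> fL gL; rewrite /spur.
under eq_bigr do rewrite (linear_map_eval fL).
under [RHS]eq_bigr do rewrite (linear_map_eval gL).
rewrite exchange_big; apply: eq_bigr => t _; apply: eq_bigr => s _.
exact: mulrC.
Qed.

(** A projection p onto U spares the choice of an explicit basis of U: expand p (b t) in a basis of
    U, then the images of the basis vectors in the b t. *)
Lemma trace_on_proj (U : {vspace V}) f p : linear_map f -> linear_map p ->
  (forall v, p v \in U) -> (forall v, v \in U -> p v = v /\ f v \in U) ->
  trace_on U f = spur (fun v => f (p v)).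
Proof.
move=> fL pL pU UP; rewrite /trace_on /spur; set X := vbasis U.
have XU (i : 'I_(\dim U)) : X`_i \in U.
  by apply/vbasis_mem/mem_nth; rewrite size_tuple.
have fr := basis_free (vbasisP U).
have fpE t : f (p (b t)) = \sum_(i < \dim U) coord X i (p (b t)) *: f X`_i.
  by rewrite {1}(coord_vbasis (pU (b t))) linear_map_sum.
under [RHS]eq_bigr => t _ do rewrite fpE sum_ffunE.
rewrite exchange_big; apply: eq_bigr => i _ /=.
transitivity (\sum_(t : St) (f X`_i t : F) * coord X i (p (b t))); last first.
  by apply: eq_bigr => t _; rewrite ffunE; apply: mulrC.
have [_ fU] := UP _ (XU i); have [pf _] := UP _ fU.
rewrite -{1}pf {1}(specht_sum (f X`_i)) linear_map_sum // linear_sum.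
by apply: eq_bigr => t _; rewrite linearZ.
Qed.

Lemma trace_on_full f : linear_map f -> trace_on fullv f = spur f.
Proof.
move=> fL; rewrite (@trace_on_proj fullv f id) // => [v|v _]; first exact: memvf.
by rewrite memvf.
Qed.

End SpechtTrace.

(** * Shapes and standard tableaux *)

Section Shape.
Variables (n : nat) (lam : seq nat).
Hypothesis lamP : is_partition n lam.

Lemma nth_conj_part j : nth 0%N (conj_part lam) j = count (leq j.+1) lam.
Proof.
have srt : sorted geq lam by case/andP: lamP.
rewrite /conj_part; have [lt|ge] := ltnP j (head 0%N lam).
  by rewrite (nth_map 0%N) ?size_iota // nth_iota.
rewrite nth_default ?size_map ?size_iota //; apply/esym/eqP.
rewrite -leqn0 leqNgt -has_count; apply/hasPn => x xl /=.
rewrite -ltnNge ltnS; apply: leq_trans ge.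
case: lam srt xl => //= a l; rewrite (path_sortedE (rev_trans leq_trans)) => /andP[al _].
by rewrite inE => /predU1P[->//|/(allP al)].
Qed.

Lemma conj_partE r c : (r < nth 0 (conj_part lam) c)%N = (c < nth 0 lam r)%N.
Proof.
rewrite nth_conj_part; have srt : sorted geq lam by case/andP: lamP.
elim: lam r srt => [|a l IH] r /=; first by rewrite nth_nil !ltn0.
move=> srt; have al : all (geq a) l.
  by move: srt; rewrite (path_sortedE (rev_trans leq_trans)) => /andP[].
have [lt|ge] := ltnP c a.
  by case: r => [|r] //=; rewrite add1n ltnS IH // (path_sorted srt).
have -> : count (leq c.+1) l = 0%N.
  apply/eqP; rewrite -leqn0 leqNgt -has_count; apply/hasPn => x /(allP al) /= xa.
  by rewrite -leqNgt; apply: leq_trans ge.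
rewrite addn0 ltn0; apply/esym/negbTE; rewrite -leqNgt.
case: r => [|r] //=; have [lt|ge'] := ltnP r (size l); last by rewrite nth_default.
by apply: leq_trans ge; apply: (allP al); apply: mem_nth.
Qed.

Lemma part_bounds r c : (c < nth 0 lam r)%N -> (r + c < n)%N.
Proof.
case/andP: lamP => srt /andP[l0 /eqP <-].
elim: lam r srt l0 => [|a l IH] r /=; first by rewrite nth_nil.
rewrite inE negb_or => srt /andP[a0 l0].
case: r => [|r] /= h; first by lia.
have := IH r (path_sorted srt) l0 h; lia.
Qed.

(** The number of rows plus the length of the first row is at most n + 1; this bounds the difference
    of the contents of any two boxes. *)
Lemma part_bounds2 r c r' c' : (c < nth 0 lam r)%N -> (c' < nth 0 lam r')%N ->
  (r + c' < n)%N.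
Proof.
case/andP: lamP => srt /andP[l0 /eqP sn].
move=> h h'; have a : (c' < nth 0 lam 0)%N.
  apply: leq_trans h' _; case: r' => // r'.
  have [lt|ge'] := ltnP r'.+1 (size lam); last by rewrite nth_default.
  by apply: (sorted_leq_nth (rev_trans leq_trans) leqnn 0%N srt) => //; rewrite inE; lia.
have hs : (r < size lam)%N by rewrite ltnNge; apply/negP => /(nth_default 0%N) e; rewrite e in h.
have : (size lam + nth 0 lam 0 <= n.+1)%N.
  rewrite -sn; case: lam l0 {srt sn h h' a hs} => //= x l; rewrite inE negb_or => /andP[_].
  suff : 0%N \notin l -> (size l <= sumn l)%N by move=> h /h; lia.
  by elim: l => //= y l IH; rewrite inE negb_or => /andP[y0 /IH]; lia.
lia.
Qed.

Lemma sum_parts : (\sum_(r < n) nth 0%N lam r = n)%N.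
Proof.
case/andP: lamP => srt /andP[l0 /eqP sn].
rewrite -[RHS]sn sumnE (big_nth 0%N) big_mkord.
have szn : (size lam <= n)%N.
  by rewrite -sn; elim: (lam) l0 => //= y l IH; rewrite inE negb_or => /andP[y0 /IH]; lia.
rewrite (big_ord_widen n (fun i => nth 0%N lam i) szn) [RHS]big_mkcond /=.
apply: eq_bigr => r _; case: ifP => // /negbT; rewrite -leqNgt => h.
by rewrite nth_default.
Qed.

(** An upper bound is enough: a standard tableau injects n entries into these boxes and thereby
    fills all of them. *)
Lemma card_boxes : (#|[set p : 'I_n * 'I_n | p.2 < nth 0 lam p.1]%N| <= n)%N.
Proof.
case/andP: lamP => srt /andP[l0 /eqP sn].
have row m : (#|[set c : 'I_n | c < m]%N| <= m)%N.
  rewrite cardE -(size_map val) -[leqRHS](size_iota 0); apply: uniq_leq_size.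
    by rewrite map_inj_uniq ?enum_uniq //; exact: val_inj.
  by move=> i /mapP[j]; rewrite mem_enum inE mem_iota => h ->.
rewrite -sum1_card.
have -> : (\sum_(p in [set p : 'I_n * 'I_n | (p.2 < nth 0 lam p.1)%N]) 1 =
   \sum_(r < n) #|[set c : 'I_n | (c < nth 0 lam r)%N]|)%N.
  rewrite [RHS](eq_bigr (fun r : 'I_n => \sum_(c < n | (c < nth 0 lam r)%N) 1)%N).
    by rewrite pair_big_dep; apply: eq_bigl => -[r c]; rewrite inE.
  by move=> r _; rewrite -sum1_card; apply: eq_bigl => c; rewrite inE.
by rewrite -[leqRHS]sum_parts; apply: leq_sum => r _.
Qed.

Variable t : tableau n.
Hypothesis t_std : is_std lam t.

Lemma std_inj : injective t.
Proof. by case/and4P: t_std => /injectiveP. Qed.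

Lemma std_shape k : ((t k).2 < nth 0 lam (t k).1)%N.
Proof. by case/and4P: t_std => _ /forallP. Qed.

Lemma std_row k l : (t k).1 = (t l).1 -> ((t k).2 < (t l).2)%N -> (k < l)%N.
Proof.
case/and4P: t_std => _ _ /forallP/(_ k)/forallP/(_ l)/implyP h _ e lt.
by apply: h; rewrite e eqxx.
Qed.

Lemma std_col k l : (t k).2 = (t l).2 -> ((t k).1 < (t l).1)%N -> (k < l)%N.
Proof.
case/and4P: t_std => _ _ _ /forallP/(_ k)/forallP/(_ l)/implyP h e lt.
by apply: h; rewrite e eqxx.
Qed.

Lemma std_surj (p : 'I_n * 'I_n) : (p.2 < nth 0 lam p.1)%N -> exists k, t k = p.
Proof.
move=> hp; set B := [set p : 'I_n * 'I_n | (p.2 < nth 0 lam p.1)%N].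
have sub : t @: [set: 'I_n] \subset B.
  by apply/subsetP => x /imsetP[k _ ->]; rewrite inE std_shape.
have : t @: [set: 'I_n] == B.
  rewrite eqEcard sub /= card_imset; last exact: std_inj.
  by rewrite cardsT card_ord card_boxes.
move/eqP => e; have : p \in B by rewrite inE.
by rewrite -e => /imsetP[k _ ->]; exists k.
Qed.

(* Two boxes on the same diagonal are never filled consecutively: a corner of the
   square they span is filled in between. *)
Lemma axial_neq0 i : axial t i != 0.
Proof.
rewrite /axial /content subr_eq0; apply/eqP => e.
have ne : t (lo_ord i) != t (hi_ord i) by rewrite (inj_eq std_inj) lo_neq_hi.
set k := lo_ord i in e ne; set l := hi_ord i in e ne.
have kl : l = k.+1 :> nat by [].
have sk := std_shape k; have sl := std_shape l.
have hr : (t k).1 != (t l).1 :> nat.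
  apply: contraNneq ne => hr; rewrite -pair_eqE /pair_eq -!val_eqE /= hr eqxx /=.
  by apply/eqP; lia.
have [lt|gt] : ((t k).1 < (t l).1)%N \/ ((t l).1 < (t k).1)%N by lia.
  have [|m em] := std_surj (p := ((t l).1, (t k).2)); first by rewrite /=; apply: leq_ltn_trans sl; lia.
  have h1 : (k < m)%N by apply: std_col; rewrite em.
  have h2 : (m < l)%N by apply: std_row; rewrite em //=; lia.
  lia.
have [|m em] := std_surj (p := ((t k).1, (t l).2)); first by rewrite /=; apply: leq_ltn_trans sk; lia.
have h1 : (l < m)%N by apply: std_col; rewrite em.
have h2 : (m < k)%N by apply: std_row; rewrite em //=; lia.
lia.
Qed.

Lemma axial_bound i : (`|axial t i| < n)%N.
Proof.
rewrite /axial /content; have sk := std_shape (lo_ord i); have sl := std_shape (hi_ord i).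
have := part_bounds2 sk sl; have := part_bounds2 sl sk.
have := part_bounds sk; have := part_bounds sl; lia.
Qed.

End Shape.

(** * Quantum integers *)

Section QuantumIntegers.
Variables (F : fieldType) (q : F).
Hypothesis q_neq0 : q != 0.
Local Notation z := (q - q^-1).
Local Notation qi := (qint q).
Local Notation Q a := ((q ^+ 2) ^ (a : int)).

Lemma Q_neq0 (a : int) : Q a != 0.
Proof. by rewrite expfz_neq0 // expf_neq0. Qed.

Lemma QD (a c : int) : Q (a + c) = Q a * Q c.
Proof. by rewrite expfzDr // expf_neq0. Qed.

Lemma QN (a : int) : Q (- a) = (Q a)^-1.
Proof. by rewrite -invr_expz. Qed.

Lemma qnatS k : qnat q k.+1 = qnat q k + q ^+ (2 * k).+1.
Proof. by rewrite /qnat big_ord_recr. Qed.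

Lemma qnat_geo k : qnat q k * (q ^+ 2 - 1) = q * (q ^+ (2 * k) - 1).
Proof.
elim: k => [|k IH]; first by rewrite /qnat big_ord0 muln0 expr0 subrr mul0r mulr0.
by rewrite qnatS mulrDl IH mulnS !exprS exprD; ring.
Qed.

Lemma qint_nat k : qi (k%:Z) = qnat q k.
Proof. by []. Qed.

Lemma qintN_nat k : qi (- k%:Z) = - Q (- k%:Z) * qnat q k.
Proof.
case: k => [|k]; first by rewrite oppr0 /= /qnat big_ord0 mulr0.
by rewrite -NegzE /= NegzE QN -exprnP -exprM.
Qed.

Lemma qint_succ (a : int) : qi (a + 1) = qi a + Q a * q.
Proof.
case: (intP a) => [|m|m].
- by rewrite add0r /= /qnat big_ord0 big_ord1 expr0z mul1r add0r.
- by rewrite -PoszD addn1 /= qnatS -exprnP -exprM exprSr.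
have -> : - m.+1%:Z + 1 = - m%:Z by lia.
rewrite !qintN_nat qnatS !QN -!exprnP -!exprM.
have qm : q ^+ (2 * m) != 0 by rewrite expf_neq0.
have geo := qnat_geo m.
have -> : q ^- (2 * m) = q ^- (2 * m.+1) * q ^+ 2.
  by rewrite mulnS exprD invfM mulrAC mulVf ?expf_neq0 // mul1r.
apply/eqP; rewrite -subr_eq0; apply/eqP.
transitivity (- q ^- (2 * m.+1) * (qnat q m * (q ^+ 2 - 1) - q * (q ^+ (2 * m) - 1))).
  by rewrite [q ^+ (2 * m).+1]exprS; move: (q ^- _) (q ^+ (2 * m)) => A B; ring.
by rewrite geo subrr mulr0.
Qed.

(** The later identities between the [a] rest on this addition formula, which stays meaningful when
    q^2 = 1. *)
Lemma qintD (a c : int) : qi (a + c) = qi a + Q a * qi c.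
Proof.
elim/int_rec: c => [|m IH|m IH]; first by rewrite addr0 /= /qnat big_ord0 mulr0 addr0.
  by rewrite -addn1 PoszD addrA !qint_succ IH QD mulrDr addrA mulrA.
have e : qi (a - m%:Z) = qi (a - m.+1%:Z) + Q (a - m.+1%:Z) * q.
  by rewrite -qint_succ; congr qint; lia.
have e' : qi (- m%:Z) = qi (- m.+1%:Z) + Q (- m.+1%:Z) * q.
  by rewrite -qint_succ; congr qint; lia.
by move: IH; rewrite e e' QD mulrDr mulrA addrA => /addIr.
Qed.

Lemma qint0 : qi 0 = 0.
Proof. by rewrite /= /qnat big_ord0. Qed.

Lemma qintN (a : int) : qi (- a) = - Q (- a) * qi a.
Proof.
have := qintD (- a) a; rewrite addNr qint0 => /eqP.
by rewrite eq_sym addr_eq0 => /eqP ->; rewrite mulNr.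
Qed.

(** Compares the two ways of expanding [a + c]. *)
Lemma qint_swap (a c : int) : qi a * (Q c - 1) = qi c * (Q a - 1).
Proof.
have := qintD a c; rewrite addrC qintD => /eqP; rewrite -subr_eq0 => /eqP e.
apply/eqP; rewrite -subr_eq0; apply/eqP; rewrite -[RHS]e; ring.
Qed.

Lemma qint1 : qi 1 = q.
Proof. by rewrite /= /qnat big_ord1. Qed.

Lemma qint_z (a : int) : qi a * z = Q a - 1.
Proof.
apply: (mulfI q_neq0); have := qint_swap a 1; rewrite expr1z qint1 => e.
by rewrite -e; field.
Qed.

Lemma qint_neq0 n : (forall k, (1 <= k <= n)%N -> qnat q k != 0) ->
  forall a : int, a != 0 -> (`|a| <= n)%N -> qi a != 0.
Proof.
move=> qnat_neq0 [m|m] a0 an /=; first by apply: qnat_neq0; lia.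
by rewrite mulf_neq0 // ?oppr_eq0 ?invr_eq0 ?expf_neq0 // qnat_neq0 //; lia.
Qed.

End QuantumIntegers.

(** * The map tau and the two halves of a self-conjugate Specht module *)

Section SpechtTau.
Variables (F : fieldType) (n : nat) (lam : seq nat) (q im : F) (rt : nat -> F).
Hypotheses (q_neq0 : q != 0) (charF : 2%:R != 0 :> F) (n_ge2 : (2 <= n)%N).
Hypothesis qnat_neq0 : forall k, (1 <= k <= n)%N -> qnat q k != 0.
Hypothesis lamP : is_partition n lam.
Variables (H : unitAlgType F) (T : 'I_n.-1 -> H) (sharp : {lrmorphism H -> H}).
Hypothesis HT : hecke_relations q T.
Hypothesis sharpP : is_sharp T sharp.
Local Notation V := (specht F n lam).
Local Notation St := (std n lam).
Local Notation bv t := (@bvec F n lam t).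
Local Notation z := (q - q^-1).
Local Notation Tp := (T_perm T).
Variable act : V -> H -> V.
Hypothesis actP : specht_action q im rt T act.

Lemma bvec_nonstd (t : tableau n) : ~~ is_std lam t -> bv t = 0.
Proof.
move=> Nt; apply/ffunP => s; rewrite bvecE ffunE; case: eqP => // e.
by case/negP: Nt; rewrite -e (valP s).
Qed.

Lemma bvec_val (t : tableau n) : is_std lam t -> exists s : St, val s = t.
Proof. by move=> ts; exists (exist _ t ts). Qed.

Lemma act_linear h : linear_map (fun v => act v h).
Proof. by case: actP => -[+ _ _ _] _; apply. Qed.

Lemma act_linearr v a x y : act v (a *: x + y) = a *: act v x + act v y.
Proof. by case: actP => -[_ + _ _] _; apply. Qed.

Lemma act_mul v h k : act v (h * k) = act (act v h) k.
Proof. by case: actP => -[_ _ _ +] _; apply. Qed.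

Lemma act_one v : act v 1 = v.
Proof. by case: actP => -[_ _ + _] _; apply. Qed.

Lemma act0 v : act v 0 = 0.
Proof. by have := act_linearr v (-1) 0 0; rewrite scaler0 addr0 scaleN1r addNr. Qed.

Lemma actZ v a x : act v (a *: x) = a *: act v x.
Proof. by have := act_linearr v a x 0; rewrite !addr0 act0 addr0. Qed.

Lemma actD v x y : act v (x + y) = act v x + act v y.
Proof. by have := act_linearr v 1 x y; rewrite !scale1r. Qed.

Lemma act_T (t : tableau n) i : is_std lam t -> act (bv t) (T i) =
  (- 1 / qint q (axial t i)) *: bv t + alpha_tab lam q im rt t i *: bv (swap_tab t i).
Proof. by case/bvec_val => s <-; case: actP => _ ->. Qed.

Lemma alphaN (a : int) : alpha q im rt (- a) = - alpha q im rt a.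
Proof.
case: (intP a) => [|m|m]; rewrite ?opprK //=.
by rewrite /alpha_nat /qnat big_ord0 invr0 mulr0 oppr0.
Qed.

Lemma chiE h : chi act h = spur (fun v => act v h).
Proof. by rewrite /chi trace_on_full //; exact: act_linear. Qed.

Lemma chi_linear a x y : chi act (a *: x + y) = a * chi act x + chi act y.
Proof.
rewrite !chiE /spur big_distrr -big_split; apply: eq_bigr => t _.
by rewrite act_linearr !ffunE.
Qed.

Lemma chi_trace : trace_fun (chi act).
Proof.
split=> [|x y]; first exact: chi_linear.
rewrite !chiE (eq_spur (fun v => act_mul v x y)) (eq_spur (fun v => act_mul v y x)).
exact: (spurC (act_linear y) (act_linear x)).
Qed.

Lemma chi_sym_alt_trace :
  alt_trace T sharp (fun h => 2%:R^-1 * (chi act h + chi act (sharp h))).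
Proof.
have [cl ct] := chi_trace; split; first split=> [a x y|x y].
- by rewrite rmorphD /= linearZ /= !cl; ring.
- by rewrite !rmorphM /= ct (ct (sharp x)).
by move=> w; rewrite (sharpK_T_perm q_neq0 HT sharpP) addrC.
Qed.

Lemma chi_A_perm w : ~~ odd_perm w ->
  chi act (A_perm T sharp w) = 2%:R^-1 * (chi act (Tp w) + chi act (sharp (Tp w))).
Proof.
move=> ew; have [cl ct] := chi_trace; rewrite /A_perm (traceZ chi_trace).
by rewrite -signr_odd odd_coxlen (negbTE ew) scale1r (traceD chi_trace).
Qed.

Hypothesis lamC : conj_part lam = lam.

Lemma conj_shape r c : (c < nth 0 lam r)%N = (r < nth 0 lam c)%N.
Proof. by rewrite -(conj_partE lamP) lamC. Qed.

Lemma conj_tabK : involutive (@conj_tab n).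
Proof. by move=> t; apply/ffunP => k; rewrite !ffunE /=; case: (t k). Qed.

Lemma conj_tab_std (t : tableau n) : is_std lam t -> is_std lam (conj_tab t).
Proof.
move=> ts; apply/and4P; split.
- apply/injectiveP => k l; rewrite !ffunE => -[e1 e2]; apply: (std_inj ts).
  by case: (t k) (t l) e1 e2 => a c [a' c'] /= -> ->.
- by apply/forallP => k; rewrite !ffunE /= conj_shape std_shape.
- apply/forallP => k; apply/forallP => l; rewrite !ffunE /=.
  by apply/implyP => /andP[/eqP e lt]; exact: (std_col ts e lt).
apply/forallP => k; apply/forallP => l; rewrite !ffunE /=.
by apply/implyP => /andP[/eqP e lt]; exact: (std_row ts e lt).
Qed.

Lemma conj_tab_stdE (t : tableau n) : is_std lam (conj_tab t) = is_std lam t.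
Proof. by apply/idP/idP => /conj_tab_std //; rewrite conj_tabK. Qed.

Lemma swap_conj_tab (t : tableau n) i : swap_tab (conj_tab t) i = conj_tab (swap_tab t i).
Proof. by apply/ffunP => k; rewrite !ffunE. Qed.

Lemma axial_conj (t : tableau n) i : axial (conj_tab t) i = - axial t i.
Proof. by rewrite /axial /content !ffunE /=; lia. Qed.

Lemma tau_linear : linear_map (@tau F n lam).
Proof.
move=> a u v; rewrite /tau scaler_sumr -big_split; apply: eq_bigr => t _.
by rewrite /= scalerA -scalerDl !ffunE.
Qed.

Lemma tau_bvec (t : tableau n) : tau (bv t) = bv (conj_tab t).
Proof.
have [ts|Nt] := boolP (is_std lam t); last first.
  by rewrite !bvec_nonstd ?conj_tab_stdE // linear_map0 //; exact: tau_linear.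
have [s <-] := bvec_val ts; rewrite /tau (bigD1 s) //= big1 => [|s' ne].
  by rewrite bvecE eqxx scale1r addr0.
by rewrite bvecE val_eqE (negbTE ne) scale0r.
Qed.

Lemma tauK (v : V) : tau (tau v) = v.
Proof.
apply: (@linear_map_ext _ _ _ (fun v => tau (tau v)) id) => [a x y|//|t].
  by rewrite !tau_linear.
by rewrite !tau_bvec conj_tabK.
Qed.

Lemma tau_eval (v : V) (t s : St) : val s = conj_tab (val t) -> tau v t = v s.
Proof.
move=> e; rewrite /tau sum_ffunE (bigD1 s) //= big1 => [|s' ne].
  by rewrite !ffunE e conj_tabK eqxx addr0; apply/mulr1.
rewrite !ffunE; case: eqP => [e'|_]; last exact/mulr0.
by case/eqP: ne; apply/val_inj; rewrite /= e e' conj_tabK.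
Qed.

(** Transposition negates the axial distance rho. So alpha changes sign, as in z - T_i, and the
    diagonal coefficients agree because z [rho] = q^(2 rho) - 1 and [-rho] = - q^(-2 rho) [rho]. *)
Lemma tau_act_T v i : tau (act v (T i)) = act (tau v) (sharp (T i)).
Proof.
rewrite (sharp_T q_neq0 HT sharpP).
apply: (@linear_map_ext _ _ _ (fun v => tau (act v (T i)))
   (fun v => act (tau v) (z%:A - T i))) => [a x y|a x y|t].
- by rewrite act_linear tau_linear.
- by rewrite tau_linear act_linear.
have ts := valP t; have ts' := conj_tab_std ts.
rewrite act_T // tau_linear (linear_mapZ tau_linear) !tau_bvec.
rewrite -[X in act _ X]addrC -scaleN1r act_linearr actZ act_one act_T //.
rewrite swap_conj_tab axial_conj /alpha_tab swap_conj_tab conj_tab_stdE axial_conj alphaN.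
rewrite scalerDr !scalerA !mulN1r addrAC -scalerDl.
have a0 := axial_neq0 lamP ts i; have ab := axial_bound lamP ts i.
congr (_ *: _ + _ *: _); last by case: ifP => _; rewrite ?opprK ?oppr0.
have n1 : qint q (axial (val t) i) != 0 by apply: (qint_neq0 q_neq0 qnat_neq0) => //; exact: ltnW.
have n2 : qint q (- axial (val t) i) != 0.
  by apply: (qint_neq0 q_neq0 qnat_neq0); rewrite ?oppr_eq0 ?abszN //; exact: ltnW.
have Qz := qint_z q_neq0 (axial (val t) i); have Q0 := Q_neq0 q_neq0 (axial (val t) i).
move: n2; rewrite qintN // QN //; set x := qint _ _ in n1 Qz *; set y := _ ^ _ in Qz Q0 *.
move=> n2; have -> : z = (y - 1) / x by rewrite -Qz mulrAC divff // mul1r.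
by field; rewrite n1 Q0 oppr_eq0 oner_neq0.
Qed.

Lemma tau_act_T_perm v w : tau (act v (Tp w)) = act (tau v) (sharp (Tp w)).
Proof.
rewrite /T_perm; elim: (reduced_word w) v => [|i s IH] v.
  by rewrite big_nil rmorph1 !act_one.
by rewrite big_cons rmorphM !act_mul IH tau_act_T.
Qed.

Lemma chi_tauE h : chi_tau act h = spur (fun v => tau (act v h)).
Proof.
rewrite /chi_tau trace_on_full // => a u v.
by rewrite act_linear tau_linear.
Qed.

Lemma chi_tau_linear a x y : chi_tau act (a *: x + y) = a * chi_tau act x + chi_tau act y.
Proof.
rewrite !chi_tauE /spur big_distrr -big_split; apply: eq_bigr => t _.
by rewrite act_linearr tau_linear !ffunE.
Qed.

Lemma chi_tauZ a x : chi_tau act (a *: x) = a * chi_tau act x.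
Proof.
have c0 : chi_tau act 0 = 0.
  by have := chi_tau_linear (-1) 0 0; rewrite scaler0 addr0 mulN1r addNr.
by have := chi_tau_linear a x 0; rewrite !addr0 c0 addr0.
Qed.

Lemma chi_tau_twisted : twisted_trace q T (chi_tau act).
Proof.
split=> [|x i]; first exact: chi_tau_linear.
transitivity (chi_tau act (sharp (T i) * x)); last first.
  rewrite (sharp_T q_neq0 HT sharpP) mulrBl mulr_algl chi_tau_linear; congr (_ + _).
  by rewrite -scaleN1r chi_tauZ mulN1r.
rewrite !chi_tauE.
have fL : linear_map (fun v => tau (act v x)).
  by move=> a u v; rewrite act_linear tau_linear.
rewrite (eq_spur (fun v => congr1 (@tau F n lam) (act_mul v x (T i)))).
rewrite (eq_spur (fun v => tau_act_T (act v x) i)).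
rewrite [RHS](eq_spur (fun v => congr1 (@tau F n lam) (act_mul v (sharp (T i)) x))).
exact: (spurC (act_linear _) fL).
Qed.

Lemma tau_act_sharp v w : tau (act v (sharp (Tp w))) = act (tau v) (Tp w).
Proof. by rewrite -{1}(tauK v) -tau_act_T_perm tauK. Qed.

Lemma chi_tau_sharp w : chi_tau act (sharp (Tp w)) = chi_tau act (Tp w).
Proof.
rewrite !chi_tauE (eq_spur (fun v => tau_act_sharp v w)).
exact: (spurC (act_linear (Tp w)) tau_linear).
Qed.

Lemma tau_act_A_perm v w : tau (act v (A_perm T sharp w)) =
  act (tau v) (2%:R^-1 *: (sharp (Tp w) + (-1) ^+ coxlen w *: Tp w)).
Proof.
rewrite /A_perm !actZ (linear_mapZ tau_linear) !actD (linear_mapD tau_linear) !actZ.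
by rewrite (linear_mapZ tau_linear) tau_act_sharp tau_act_T_perm.
Qed.

(** The entry 2 lies in the first row or the first column: otherwise the corner and the first box of
    its row would hold two smaller entries. *)
Lemma two_in_first_row_conj (t : tableau n) : is_std lam t ->
  ~~ two_in_first_row t -> two_in_first_row (conj_tab t).
Proof.
move=> ts /forallPn[k]; rewrite negb_imply => /andP[/eqP k1 h].
apply/forallP => l; apply/implyP => /eqP l1; rewrite ffunE /=.
have -> : l = k by apply/val_inj; rewrite l1 k1.
have sk := std_shape ts k; rewrite eqn0Ngt; apply/negP => c0.
have r0 : (0 < (t k).1)%N by rewrite lt0n.
have i0 : (0 < n)%N by lia.
pose O := Ordinal i0.
have hs r c : (r <= (t k).1)%N -> (c <= (t k).2)%N -> (c < nth 0 lam r)%N.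
  move=> hr hc; apply: leq_ltn_trans hc _; rewrite conj_shape.
  by apply: leq_ltn_trans hr _; rewrite conj_shape.
have [|a ea] := std_surj lamP ts (p := (O, O)); first exact: hs.
have [|b eb] := std_surj lamP ts (p := ((t k).1, O)); first exact: hs.
have h1 : (a < b)%N by apply: (std_col ts); rewrite ea eb.
have h2 : (b < k)%N by apply: (std_row ts); rewrite eb.
have k1' : k = 1%N :> nat := k1; lia.
Qed.

Lemma tau_half (e : bool) v : v \in @specht_half F n lam e -> tau v = (-1) ^+ e *: v.
Proof.
rewrite /specht_half; have sq : (-1) ^+ e * (-1) ^+ e = 1 :> F.
  by rewrite -expr2 sqrr_sign.
case/memv_sumP => vs vsP ->; rewrite (linear_map_sum1 tau_linear) scaler_sumr.
apply: eq_bigr => t /vsP /vlineP[k ->].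
rewrite (linear_mapZ tau_linear) (linear_mapD tau_linear) (linear_mapZ tau_linear).
rewrite !tau_bvec conj_tabK scalerA mulrC -scalerA; congr (_ *: _).
by rewrite scalerDr scalerA sq scale1r addrC.
Qed.

Lemma half_mem (e : bool) (t : tableau n) : is_std lam t ->
  bv t + (-1) ^+ e *: bv (conj_tab t) \in @specht_half F n lam e.
Proof.
move=> ts; have sq : (-1) ^+ e * (-1) ^+ e = 1 :> F by rewrite -expr2 sqrr_sign.
have mem (s : St) : two_in_first_row (val s) ->
    bv (val s) + (-1) ^+ e *: bv (conj_tab (val s)) \in @specht_half F n lam e.
  move=> h; rewrite /specht_half (bigD1 s) //=.
  by apply: (subvP (addvSl _ _)); exact: memv_line.
have [h|Nh] := boolP (two_in_first_row t).
  by have [s e'] := bvec_val ts; rewrite -e'; apply: mem; rewrite e'.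
have [s e'] := bvec_val (conj_tab_std ts).
have := mem s; rewrite e' conj_tabK => /(_ (two_in_first_row_conj ts Nh)) h.
have -> : bv t + (-1) ^+ e *: bv (conj_tab t) =
    (-1) ^+ e *: (bv (conj_tab t) + (-1) ^+ e *: bv t).
  by rewrite scalerDr scalerA sq scale1r addrC.
exact: memvZ.
Qed.

(** The trace on a half is the full trace after the projection (1 + (-1)^e tau)/2. For even w the
    action of A_w commutes with tau, and the two summands of A_w have the same twisted trace. *)
Theorem chi_half_A_perm (e : bool) w : ~~ odd_perm w ->
  chi_half act e (A_perm T sharp w) =
  2%:R^-1 * chi act (A_perm T sharp w) + (-1) ^+ e * (2%:R^-1 * chi_tau act (Tp w)).
Proof.
move=> ew; set A := A_perm T sharp w.
have sgn : (-1) ^+ coxlen w = 1 :> F.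
  by rewrite -signr_odd odd_coxlen (negbTE ew).
have tauA v : tau (act v A) = act (tau v) A.
  by rewrite tau_act_A_perm sgn scale1r /A /A_perm sgn scale1r addrC.
pose p (v : V) : V := 2%:R^-1 *: (v + (-1) ^+ e *: tau v).
have pL : linear_map p.
  move=> a u v; rewrite /p tau_linear !scalerDr !scalerA [RHS]addrACA.
  by congr ((_ *: _ + _) + (_ *: _ + _)); ring.
have sq : (-1) ^+ e * (-1) ^+ e = 1 :> F by rewrite -expr2 sqrr_sign.
have pU v : p v \in @specht_half F n lam e.
  rewrite (specht_sum v) linear_map_sum //; apply: memv_suml => t _; apply: memvZ.
  by rewrite /p tau_bvec; apply: memvZ; apply: half_mem; exact: valP.
have pid v : tau v = (-1) ^+ e *: v -> p v = v.
  move=> h; rewrite /p h scalerA sq scale1r -mulr2n -scaler_nat scalerA mulVf //.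
  by rewrite scale1r.
rewrite /chi_half (@trace_on_proj _ _ _ _ (fun v => act v A) p) //; last 2 first.
- exact: act_linear.
- move=> v /tau_half tv; split; first exact: pid.
  by rewrite -(pid (act v A)) // tauA tv (linear_mapZ (act_linear _)).
have -> : spur (fun v => act (p v) A) = 2%:R^-1 * (chi act A + (-1) ^+ e * chi_tau act A).
  rewrite chiE chi_tauE /spur big_distrr -big_split big_distrr /=.
  apply: eq_bigr => t _; rewrite /p (linear_mapZ (act_linear A)) /=.
  rewrite (linear_mapD (act_linear A)) (linear_mapZ (act_linear A)) /=.
  by rewrite -tauA !ffunE.
rewrite mulrDr mulrCA; congr (_ + _ * (_ * _)).
rewrite /A /A_perm chi_tauZ sgn scale1r.
have -> x y : chi_tau act (x + y) = chi_tau act x + chi_tau act y.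
  by have := chi_tau_linear 1 x y; rewrite scale1r mul1r.
by rewrite chi_tau_sharp; field.
Qed.

End SpechtTau.

(** * Weights of a hopping particle *)

Section PartialFractions.
Variables (F : fieldType) (I : eqType) (A B x : I -> F).
Implicit Types (r : seq I) (Y : F).

(** The first claim is the expansion in partial fractions in Y; the second compares the coefficients
    of 1/Y at infinity. Both go by induction on the list, as an arbitrary field has no limits. *)
Lemma prod_partial_fractions_sum r : uniq r -> {in r &, injective x} ->
  (forall Y, (forall j, j \in r -> Y != x j) ->
  \prod_(j <- r) (A j + B j / (Y - x j)) = \prod_(j <- r) A j +
   \sum_(j <- r) B j / (Y - x j) * \prod_(k <- r | k != j) (A k + B k / (x j - x k)))
  /\ \sum_(j <- r) B j * \prod_(k <- r | k != j) (A k + B k / (x j - x k)) =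
   \sum_(j <- r) B j * \prod_(k <- r | k != j) A k.
Proof.
elim: r => [|i r IH]; first by split=> [Y _|]; rewrite !big_nil ?addr0.
case/andP=> ir ur xI.
have xI' : {in r &, injective x} by move=> j k jr kr; apply: xI; rewrite inE (jr, kr) orbT.
have xi j : j \in r -> x i != x j.
  by move=> jr; apply: contraNneq ir => /xI ->; rewrite ?inE ?eqxx ?jr ?orbT.
have nji j : j \in r -> i != j by apply: contraTneq => <-.
have [IHY e3] := IH ur xI'; have e2 := IHY (x i) xi.
have own (G : I -> F) : \prod_(k <- i :: r | k != i) G k = \prod_(k <- r) G k.
  rewrite big_cons eqxx /= big_seq_cond [RHS]big_seq; apply: eq_bigl => k.
  by case kr: (k \in r) => //=; rewrite eq_sym nji.
have other j (G : I -> F) : j \in r ->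
    \prod_(k <- i :: r | k != j) G k = G i * \prod_(k <- r | k != j) G k.
  by move=> jr; rewrite big_cons nji.
set R := fun j => \prod_(k <- r | k != j) (A k + B k / (x j - x k)) in IHY e2 e3 *.
have ij j : j \in r -> x j - x i != 0 by move=> jr; rewrite subr_eq0 eq_sym xi.
have ji j : j \in r -> x i - x j != 0 by move=> jr; rewrite subr_eq0 xi.
split=> [Y Yx|].
  have e1 := IHY Y (fun j jr => Yx j (mem_behead (s := i :: r) jr)).
  have Yi : Y - x i != 0 by rewrite subr_eq0 Yx // inE eqxx.
  have Yj j : j \in r -> Y - x j != 0 by move=> jr; rewrite subr_eq0 Yx // inE jr orbT.
  rewrite [LHS]big_cons [\prod_(j <- i :: r) A j]big_cons e1 [\sum_(j <- i :: r) _]big_cons own e2.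
  (* The poles at the x j of the cross terms between i and the rest of the list. *)
  pose U := \sum_(j <- r) B j / (Y - x j) * (B i / (x j - x i) * R j).
  have -> : \sum_(j <- r) B j / (Y - x j) *
      \prod_(k <- i :: r | k != j) (A k + B k / (x j - x k)) =
      A i * (\sum_(j <- r) B j / (Y - x j) * R j) + U.
    rewrite big_distrr -big_split; apply: eq_big_seq => j jr.
    by rewrite other //= -/(R j); ring.
  have : B i / (Y - x i) * (\sum_(j <- r) B j / (Y - x j) * R j) =
      B i / (Y - x i) * (\sum_(j <- r) B j / (x i - x j) * R j) + U.
    rewrite !big_distrr -big_split; apply: eq_big_seq => j jr /=.
    by field; rewrite Yi Yj ?ij ?ji.
  rewrite mulrDl mulrDr [(B i / _) * (_ + _)]mulrDr => ->.
  by ring.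
rewrite [LHS]big_cons [RHS]big_cons !own e2.
have -> : \sum_(j <- r) B j * \prod_(k <- i :: r | k != j) (A k + B k / (x j - x k)) =
   A i * (\sum_(j <- r) B j * R j) + \sum_(j <- r) B j * (B i / (x j - x i) * R j).
  rewrite big_distrr -big_split; apply: eq_big_seq => j jr.
  by rewrite other //= -/(R j); ring.
have -> : \sum_(j <- r) B j * \prod_(k <- i :: r | k != j) A k =
   A i * (\sum_(j <- r) B j * \prod_(k <- r | k != j) A k).
  by rewrite big_distrr; apply: eq_big_seq => j jr /=; rewrite other //; ring.
rewrite e3 mulrDr -!addrA; congr (_ + _); rewrite addrCA -[RHS]addr0; congr (_ + _).
rewrite big_distrr -big_split big1_seq // => j /andP[_ jr] /=.
by rewrite -/(R j); field; rewrite ij ?ji.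
Qed.

End PartialFractions.

(** * Transfer determinants of independent particles *)

Section OneParticle.
Variables (F : fieldType) (Zs be : nat -> F).

(* [hop_gen Y j l]: weight of a particle hopping from j to l, the last hop being
   linked to Y; the hop to l carries the factor [be l]. *)
Fixpoint hop_gen (Y : F) (j l : nat) : F :=
  if l is l'.+1 then
    (j == l)%:R + be l / (Y - Zs l) * hop_gen (Zs l) j l'
  else (j == 0)%:R.

Lemma hop_gen_lt Y j l : (l < j)%N -> hop_gen Y j l = 0.
Proof.
elim: l Y => [|l IH] Y /=; first by case: j.
by move=> lt; rewrite IH ?(ltnW lt) // mulr0 addr0; case: eqP => // e; rewrite e ltnn in lt.
Qed.

Lemma hop_gen_eq Y j : hop_gen Y j j = 1.
Proof. by case: j => [|j] //=; rewrite eqxx hop_gen_lt // mulr0 addr0. Qed.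

Variable d : nat.
Implicit Types (al a : nat -> nat).

(** Rows are final parts, columns initial ones. The alternating sum cancels the configurations in
    which two particles meet, as for families of non-intersecting paths. *)
Definition hop_det Y al a : F := \det (\matrix_(j < d, i < d) hop_gen Y (al i) (a j)).
Definition id_det al a : F := \det (\matrix_(j < d, i < d) (al i == a j)%:R).

Definition decr a (j k : nat) : nat := if k == j then (a k).-1 else a k.

Lemma det_sum (M : nat -> nat -> F) : \det (\matrix_(j < d, i < d) M j i) =
  \sum_(s : 'S_d) (-1) ^+ s * \prod_(j < d) M j (s j).
Proof. by apply: eq_bigr => s _; congr (_ * _); apply: eq_bigr => j _; rewrite mxE. Qed.

Lemma sum_decr a (j : 'I_d) : (0 < a j)%N ->
  ((\sum_(k < d) decr a j k).+1 = \sum_(k < d) a k)%N.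
Proof.
move=> aj; rewrite (bigD1 j) //= [RHS](bigD1 j) //= /decr eqxx -addSn prednK //.
by congr (_ + _)%N; apply: eq_bigr => k /negbTE; rewrite -val_eqE /= => ->.
Qed.

(** Weights to a smaller part vanish, so with equal totals only the terms in which no particle moves
    survive, and these do not involve Y. *)
Lemma hop_det_id Y al a : (\sum_(i < d) al i = \sum_(j < d) a j)%N ->
  hop_det Y al a = id_det al a.
Proof.
move=> sm; rewrite /hop_det /id_det (det_sum (fun j i => hop_gen Y (al i) (a j)))
  (det_sum (fun j i => (al i == a j)%:R)).
apply: eq_bigr => s _; congr (_ * _).
have sm' : (\sum_(j < d) al (s j) = \sum_(j < d) a j)%N.
  by rewrite -sm [RHS](reindex_inj (@perm_inj _ s)).
have [/forallP le|] := boolP [forall j : 'I_d, al (s j) <= a j]%N; last first.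
  move=> /forallPn[j]; rewrite -ltnNge => lt; rewrite (bigD1 j) //= hop_gen_lt // mul0r.
  by rewrite (bigD1 j) //= gtn_eqF // mul0r.
have eq : forall j : 'I_d, al (s j) = a j.
  move=> j; apply/eqP; rewrite eqn_leq le /= leqNgt; apply/negP => lt.
  have : (\sum_(j < d) al (s j) < \sum_(j < d) a j)%N.
    rewrite (bigD1 j) //= [X in (_ < X)%N](bigD1 j) //= -addSn.
    by apply: leq_add => //; apply: leq_sum.
  by rewrite sm' ltnn.
by apply: eq_bigr => j _; rewrite eq hop_gen_eq eqxx.
Qed.

Lemma id_det_sum_neq al a : (\sum_(i < d) al i != \sum_(j < d) a j)%N -> id_det al a = 0.
Proof.
move=> ne; rewrite /id_det (det_sum (fun j i => (al i == a j)%:R)) big1 // => s _.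
have [/forallP e|] := boolP [forall j : 'I_d, al (s j) == a j]; last first.
  by move=> /forallPn[j] /negbTE nej; rewrite (bigD1 j) //= nej mul0r mulr0.
case/eqP: ne; rewrite (reindex_inj (@perm_inj _ s)) /=.
by apply: eq_bigr => j _; apply/eqP.
Qed.

Section Recursion.
Variables (al a : nat -> nat).
Hypothesis a_gt0 : forall j, (j < d)%N -> (0 < a j)%N.
Hypothesis Za_inj : forall j k, (j < d)%N -> (k < d)%N -> Zs (a j) = Zs (a k) -> j = k.

Local Notation coef s j k := ((al (s k) == a k)%:R + be (a k) * hop_gen (Zs (a k)) (al (s k)) (a k).-1 / (Zs (a j) - Zs (a k))).

Lemma hop_gen_step Y j l : (0 < l)%N ->
  hop_gen Y j l = (j == l)%:R + be l * hop_gen (Zs l) j l.-1 / (Y - Zs l).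
Proof. by case: l => //= l _; rewrite mulrAC. Qed.

Lemma hop_det_decr (j : 'I_d) : hop_det (Zs (a j)) al (decr a j) =
  \sum_(s : 'S_d) (-1) ^+ s * (hop_gen (Zs (a j)) (al (s j)) (a j).-1 *
     \prod_(k < d | k != j) coef s j k).
Proof.
rewrite /hop_det (det_sum (fun k i => hop_gen (Zs (a j)) (al i) (decr a j k))).
apply: eq_bigr => s _; congr (_ * _); rewrite (bigD1 j) //= /decr eqxx; congr (_ * _).
by apply: eq_bigr => k; rewrite -val_eqE /= => /negbTE ->; rewrite hop_gen_step ?a_gt0.
Qed.

(** For each permutation the product over the particles consists of simple fractions in Y. Its term
    at Zs (a j) is the product evaluated there, with particle j set back by its last hop; thus j
    runs over the last mover. *)
Lemma hop_det_rec Y : (forall j, (j < d)%N -> Y != Zs (a j)) ->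
  hop_det Y al a = id_det al a +
   \sum_(j < d) be (a j) / (Y - Zs (a j)) * hop_det (Zs (a j)) al (decr a j).
Proof.
move=> Ya; under eq_bigr do rewrite hop_det_decr big_distrr.
rewrite exchange_big /hop_det (det_sum (fun j i => hop_gen Y (al i) (a j))).
rewrite /id_det (det_sum (fun j i => (al i == a j)%:R)) -big_split.
apply: eq_bigr => s _ /=.
have [e0 _] := @prod_partial_fractions_sum F 'I_d
  (fun k => (al (s k) == a k)%:R) (fun k => be (a k) * hop_gen (Zs (a k)) (al (s k)) (a k).-1)
  (fun k => Zs (a k)) (index_enum 'I_d) (index_enum_uniq _)
  (fun j k _ _ e => val_inj (Za_inj (ltn_ord j) (ltn_ord k) e)).
rewrite (eq_bigr (fun k : 'I_d => (al (s k) == a k)%:R +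
   be (a k) * hop_gen (Zs (a k)) (al (s k)) (a k).-1 / (Y - Zs (a k)))); last first.
  by move=> k _; rewrite hop_gen_step ?a_gt0.
rewrite e0 => [|j _]; last exact: Ya.
rewrite mulrDr big_distrr; congr (_ + _); apply: eq_bigr => j _ /=.
move: ((-1) ^+ s) (\prod_(k < d | k != j) _) (hop_gen _ _ _) => S P G.
by rewrite mulrCA [be _ * G / _]mulrAC -[LHS]mulrA; congr (_ * _); rewrite mulrCA.
Qed.

(* The reservoir column [al e = 0] must be matched by the particle created in the
   current block. *)
Lemma hop_det_total e L : d = e.+1 -> (forall i, (i < e)%N -> (0 < al i)%N) -> al e = 0%N ->
  (\sum_(j < d) a j = (\sum_(i < d) al i) + L)%N ->
  \sum_(j < d) be (a j) * hop_det (Zs (a j)) al (decr a j) =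
  be L * hop_gen (Zs L) 0 L.-1 * id_det (fun i => if i == e then L else al i) a.
Proof.
move=> de al_gt0 ale sm; under eq_bigr do rewrite hop_det_decr big_distrr.
rewrite exchange_big /id_det
  (det_sum (fun j i => ((if i == e then L else al i) == a j)%:R)) big_distrr.
apply: eq_bigr => s _ /=.
have [_ tot] := @prod_partial_fractions_sum F 'I_d
  (fun k => (al (s k) == a k)%:R) (fun k => be (a k) * hop_gen (Zs (a k)) (al (s k)) (a k).-1)
  (fun k => Zs (a k)) (index_enum 'I_d) (index_enum_uniq _)
  (fun j k _ _ e => val_inj (Za_inj (ltn_ord j) (ltn_ord k) e)).
transitivity ((-1) ^+ s * \sum_(j < d) be (a j) * hop_gen (Zs (a j)) (al (s j)) (a j).-1 *
    \prod_(k < d | k != j) (al (s k) == a k)%:R).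
  rewrite -tot big_distrr; apply: eq_bigr => j _ /=.
  move: ((-1) ^+ s) (\prod_(k < d | k != j) _) (hop_gen _ _ _) => S P G.
  by rewrite mulrCA; congr (_ * _); rewrite mulrA.
rewrite mulrCA; congr (_ * _).
have lte : (e < d)%N by rewrite de.
pose E := Ordinal lte; pose j0 : 'I_d := (s^-1)%g E.
have sj0 : s j0 = E by rewrite permKV.
have nE k : k != j0 -> (s k == e :> nat) = false.
  move=> nk; apply/negP => /eqP h; case/eqP: nk; apply: (@perm_inj _ s).
  by rewrite sj0; apply/val_inj.
(* Every other j keeps the factor of j0, which compares the reservoir 0 with the positive part
   [a j0] and so vanishes. *)
rewrite (bigD1 j0) //= [X in _ + X]big1 ?addr0; last first.
  move=> j nj; have e0 : (al (s j0) == a j0) = false.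
    by rewrite sj0 /= ale ltn_eqF ?a_gt0.
  have nj' : j0 != j by rewrite eq_sym.
  by rewrite (bigD1 j0) // e0 /= mul0r mulr0.
rewrite [in RHS](bigD1 j0) //= sj0 /= eqxx ale.
have -> : \prod_(i < d | i != j0) ((if s i == e :> nat then L else al (s i)) == a i)%:R =
   \prod_(i < d | i != j0) (al (s i) == a i)%:R :> F.
  by apply: eq_bigr => k nk; rewrite nE.
have [/forallP h|] := boolP [forall k : 'I_d, (k != j0) ==> (al (s k) == a k)]; last first.
  move=> /forallPn[k]; rewrite negb_imply => /andP[nk /negbTE ne].
  by rewrite (bigD1 k) //= ne mul0r !mulr0.
(* Once all other parts match, the total determines the remaining one. *)
have -> : L = a j0; last by rewrite eqxx mul1r.
apply: (@addnI (\sum_(i < d) al i)%N); rewrite -sm [in RHS](reindex_inj (@perm_inj _ s)) /=.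
rewrite (bigD1 j0) //= [in RHS](bigD1 j0) //= sj0 /= ale add0n addnC; congr (_ + _)%N.
by apply/esym/eq_bigr => k nk; apply/eqP; have /implyP := h k; apply.
Qed.

End Recursion.
End OneParticle.

Section HopDetVanish.
Variables (F : fieldType) (Zs be : nat -> F) (d : nat).
Implicit Types (al a : nat -> nat).

Lemma hop_det_row0 Y al a j : (j < d)%N -> a j = 0%N ->
  (forall i, (i < d)%N -> (0 < al i)%N) -> hop_det Zs be d Y al a = 0.
Proof.
move=> ltj aj al0; rewrite /hop_det (det_sum d (fun j i => hop_gen Zs be Y (al i) (a j))).
rewrite big1 // => s _; rewrite (bigD1 (Ordinal ltj)) //= aj /=.
by rewrite gtn_eqF ?al0 //= mul0r mulr0.
Qed.

Lemma hop_det_eq_rows Y al a j k : (j < d)%N -> (k < d)%N -> j != k -> a j = a k ->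
  hop_det Zs be d Y al a = 0.
Proof.
move=> ltj ltk ne e; apply: (@determinant_alternate _ _ _ (Ordinal ltj) (Ordinal ltk)) => //.
by move=> i; rewrite !mxE /= e.
Qed.

Lemma id_det_col0 al a i : (i < d)%N -> (forall j, (j < d)%N -> al i != a j) ->
  id_det F d al a = 0.
Proof.
move=> lti ne; rewrite /id_det (det_sum d (fun j i => (al i == a j)%:R)).
rewrite big1 // => s _; pose j := (s^-1)%g (Ordinal lti).
by rewrite (bigD1 j) //= permKV /= (negbTE (ne _ (ltn_ord j))) /= mul0r mulr0.
Qed.

End HopDetVanish.

(** A particle still in the reservoir can be left out, since its row has a single nonzero entry. *)
Lemma hop_det_last (F : fieldType) (Zs be : nat -> F) d Y al a : a d = 0%N -> al d = 0%N ->
  (forall i, (i < d)%N -> (0 < al i)%N) ->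
  hop_det Zs be d.+1 Y al a = hop_det Zs be d Y al a.
Proof.
move=> ad ald al0; rewrite /hop_det (expand_det_row _ ord_max) (bigD1 ord_max) //= big1; last first.
  move=> i ni; rewrite mxE /= ad /= gtn_eqF ?mul0r // al0 //.
  by rewrite ltn_neqAle -ltnS ltn_ord andbT; rewrite -val_eqE in ni.
rewrite mxE /= ad ald /= mul1r addr0 /cofactor addnn -signr_odd odd_double mul1r.
congr (\det _); apply/matrixP => j i; rewrite !mxE /= /bump.
by rewrite (leqNgt d j) (leqNgt d i) !ltn_ord.
Qed.

Lemma eq_hop_det (F : fieldType) (Zs be : nat -> F) d Y al a a' :
  (forall j, (j < d)%N -> a j = a' j) -> hop_det Zs be d Y al a = hop_det Zs be d Y al a'.
Proof.
by move=> e; congr (\det _); apply/matrixP => j i; rewrite !mxE e.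
Qed.

(** * Link factors as simple fractions *)

Section LinkWeights.
Variables (F : fieldType) (n : nat) (q im : F) (rt : nat -> F).
Hypothesis q_neq0 : q != 0.
Hypothesis qnat_neq0 : forall k, (1 <= k <= n)%N -> qnat q k != 0.
Local Notation qi := (qint q).
Local Notation Q a := ((q ^+ 2) ^ (a : int)).

Definition link (x y : int) : F := - 1 / qi (x - y).

(* By [Zq_int], [Zq] depends on a content only up to sign; summed over both signs,
   the link weights become simple fractions in [Zq]. *)
Definition Zq (c : nat) : F := qnat q c ^+ 2 / q ^+ (2 * c).

(** For c > 0 this is alpha_(2c) times the factor [2c] / q^(2c) that comes from [link_diff], see
    [alpha_link]; the value 1 at 0 belongs to a diagonal box. *)
Definition beta (c : nat) : F :=
  if c is c'.+1 then im * rt (2 * c).+1 * rt (2 * c).-1 / q ^+ (2 * c) else 1.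

Lemma Zq_int (y : int) : Zq `|y|%N = qi y ^+ 2 / Q y.
Proof.
rewrite /Zq; case: (intP y) => [|k|k]; rewrite ?abszN.
- by rewrite /= expr0z expr0.
- by rewrite absz_nat exprM.
rewrite qintN // absz_nat /= QN // -exprnP -exprM.
have := expf_neq0 (2 * k.+1) q_neq0; move: (q ^+ _) => u u0.
by field; rewrite u0 ?oppr_eq0 ?oner_neq0.
Qed.

Section Identities.
Variables (c : nat) (y : int).
Hypotheses (c_gt0 : (0 < c)%N) (yc : `|y|%N != c) (cn : (c + `|y| <= n)%N).

(** The q-analogue of y^2 - c^2 = - (c - y)(c + y), with [c + y] = [c] + q^(2c) [y]; in the given
    range no factor vanishes. *)
Lemma link_facts :
  [/\ qi (c%:Z - y) != 0, qi (- c%:Z - y) != 0 & Zq `|y| - Zq c != 0] /\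
  (qi y ^+ 2 / Q y - qi c%:Z ^+ 2 / Q c%:Z) =
    - (qi (c%:Z - y) * (qi c%:Z + Q c%:Z * qi y)) / Q c%:Z.
Proof.
have n1 : qi (c%:Z - y) != 0 by apply: (qint_neq0 q_neq0 qnat_neq0); lia.
have n2 : qi (- c%:Z - y) != 0 by apply: (qint_neq0 q_neq0 qnat_neq0); lia.
have QA := Q_neq0 q_neq0 c; have QB := Q_neq0 q_neq0 y.
have sw := qint_swap q_neq0 c y.
have key : (qi y ^+ 2 / Q y - qi c%:Z ^+ 2 / Q c%:Z) =
    - (qi (c%:Z - y) * (qi c%:Z + Q c%:Z * qi y)) / Q c%:Z.
  rewrite qintD // qintN // QN //.
  move: sw QA QB; set C := qi c; set D := qi y; set A := Q c; set B := Q y.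
  move=> sw QA QB.
  have e1 : A * D * (A - 1) = A * C * (B - 1) by rewrite -mulrA -sw mulrA.
  apply: (mulfI QB); apply: (mulfI QA).
  have -> : A * (B * (D ^+ 2 / B - C ^+ 2 / A)) = A * D ^+ 2 - B * C ^+ 2.
    by field; rewrite QA QB.
  have -> : A * (B * (- ((C + A * (- B^-1 * D)) * (C + A * D)) / A)) =
      - ((B * C - A * D) * (C + A * D)) by field; rewrite QA QB.
  apply/eqP; rewrite -subr_eq0; apply/eqP.
  transitivity (- D * (A * D * (A - 1) - A * C * (B - 1))); first by ring.
  by rewrite e1 subrr mulr0.
split=> //; split=> //.
have -> : Zq c = qi c%:Z ^+ 2 / Q c%:Z by rewrite -Zq_int.
rewrite Zq_int key mulf_neq0 ?invr_eq0 // oppr_eq0 mulf_neq0 // -qintD //.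
by apply: (qint_neq0 q_neq0 qnat_neq0); lia.
Qed.

(** The two orders of filling a symmetric pair leave the contents c and -c with opposite alpha, so
    the links enter through their difference. For q = 1 this reads 1/(y - c) - 1/(y + c) = 2c/(y^2 -
    c^2). *)
Lemma link_diff : link c%:Z y - link (- c%:Z) y =
  qi (2 * c)%N%:Z / Q c%:Z / (Zq `|y| - Zq c).
Proof.
have [[n1 n2 n3] key] := link_facts.
have QA := Q_neq0 q_neq0 c; have QB := Q_neq0 q_neq0 y.
have sw := qint_swap q_neq0 c y.
have n4 : qi c%:Z + Q c%:Z * qi y != 0 by rewrite -qintD //; apply: (qint_neq0 q_neq0 qnat_neq0); lia.
have -> : Zq c = qi c%:Z ^+ 2 / Q c%:Z by rewrite -Zq_int.
rewrite Zq_int key /link.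
have -> : - c%:Z - y = - (c%:Z + y) by lia.
rewrite [qi (- (_ + _))]qintN // QN // QD // [qi (c%:Z + y)]qintD //.
have -> : ((2 * c)%N)%:Z = c%:Z + c%:Z by lia.
move: n1; rewrite !qintD // qintN // QN //.
move: sw QA QB n4; set C := qi c; set D := qi y; set A := Q c; set B := Q y.
move=> sw QA QB n4 n1.
have e0 : C + A * (- B^-1 * D) = (B * C - A * D) / B by field; rewrite QB.
have n5 : B * C - A * D != 0 by apply: contraNneq n1 => e; rewrite e0 e mul0r.
rewrite e0; apply/eqP; rewrite -subr_eq0; apply/eqP.
transitivity ((B * A) * (D * (A - 1) - C * (B - 1)) / (B * C - A * D) / (C + A * D)); last by rewrite sw subrr mulr0 !mul0r.
by field; rewrite QA QB n4 n5 ?oppr_eq0 ?oner_neq0 /= ?andbT mulf_neq0.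
Qed.

(** The variant for an odd number of entries: the factor [content] comes back as [y] for the next
    entry, which keeps the closed form stable. *)
Lemma link_diff_weighted : qi c%:Z * link c%:Z y - qi (- c%:Z) * link (- c%:Z) y =
  qi (2 * c)%N%:Z / Q c%:Z * qi y / (Zq `|y| - Zq c).
Proof.
have [[n1 n2 n3] key] := link_facts.
have QA := Q_neq0 q_neq0 c; have QB := Q_neq0 q_neq0 y.
have sw := qint_swap q_neq0 c y.
have n4 : qi c%:Z + Q c%:Z * qi y != 0 by rewrite -qintD //; apply: (qint_neq0 q_neq0 qnat_neq0); lia.
have -> : Zq c = qi c%:Z ^+ 2 / Q c%:Z by rewrite -Zq_int.
rewrite Zq_int key /link.
have -> : - c%:Z - y = - (c%:Z + y) by lia.
rewrite [qi (- (_ + _))]qintN // [qi (- c%:Z)]qintN // !QN // QD // [qi (c%:Z + y)]qintD //.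
have -> : ((2 * c)%N)%:Z = c%:Z + c%:Z by lia.
move: n1; rewrite !qintD // qintN // QN //.
move: sw QA QB n4; set C := qi c; set D := qi y; set A := Q c; set B := Q y.
move=> sw QA QB n4 n1.
have e0 : C + A * (- B^-1 * D) = (B * C - A * D) / B by field; rewrite QB.
have n5 : B * C - A * D != 0 by apply: contraNneq n1 => e; rewrite e0 e mul0r.
rewrite e0; apply/eqP; rewrite -subr_eq0; apply/eqP.
transitivity (- (B * C) * (D * (A - 1) - C * (B - 1)) / (B * C - A * D) / (C + A * D)); last by rewrite sw subrr mulr0 !mul0r.
by field; rewrite QA QB n4 n5 ?oppr_eq0 ?oner_neq0 /= ?andbT mulf_neq0.
Qed.

End Identities.
End LinkWeights.

(** * Strict partitions of half hooks *)

Section StrictParts.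

Definition strict_parts d (A : nat -> nat) : Prop :=
  (forall j, (j < d)%N -> (0 < A j)%N) /\ (forall j k, (j < k < d)%N -> (A k < A j)%N).

(** The size of the self-conjugate shape with half hooks A j: a full diagonal hook has 2 A j - 1
    boxes. *)
Definition hook_sum d (A : nat -> nat) : nat := (\sum_(j < d) (2 * A j).-1)%N.

Lemma hook_sumE d A : strict_parts d A -> (hook_sum d A + d = 2 * \sum_(j < d) A j)%N.
Proof.
case=> A0 _; have e : (\sum_(j < d) 1 = d)%N by rewrite sum1_card card_ord.
rewrite /hook_sum -[X in (_ + X)%N]e -big_split big_distrr /=.
by apply: eq_bigr => j _; have := A0 j (ltn_ord j); lia.
Qed.

Lemma hook_sum_seq als : all (leq 1) als ->
  (hook_sum (size als) (nth 0 als) + size als = 2 * \sum_(j < size als) nth 0 als j)%N.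
Proof.
move=> h; have e : (\sum_(j < size als) 1 = size als)%N by rewrite sum1_card card_ord.
rewrite /hook_sum -[X in (_ + X)%N]e -big_split big_distrr /=.
by apply: eq_bigr => j _; have := all_nthP 0%N h j (ltn_ord j); lia.
Qed.

Lemma hook_sum_ge d A j k : strict_parts d A -> (j < d)%N -> (k < d)%N -> j != k ->
  ((2 * A j).-1 + (2 * A k).-1 <= hook_sum d A)%N.
Proof.
move=> _ jd kd ne; rewrite /hook_sum (bigD1 (Ordinal jd)) //= (bigD1 (Ordinal kd)) /=.
  by rewrite addnA leq_addr.
by rewrite -val_eqE /= eq_sym.
Qed.

Lemma hook_sum_ge1 d A j : (j < d)%N -> ((2 * A j).-1 <= hook_sum d A)%N.
Proof. by move=> jd; rewrite /hook_sum (bigD1 (Ordinal jd)) //= leq_addr. Qed.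

Lemma strict_inj d A j k : strict_parts d A -> (j < d)%N -> (k < d)%N -> A j = A k -> j = k.
Proof.
case=> _ dec jd kd e; apply/eqP; rewrite eqn_leq; apply/andP; split; rewrite leqNgt.
  by apply/negP => lt; have := dec k j; rewrite lt jd e ltnn => /(_ isT).
by apply/negP => lt; have := dec j k; rewrite lt kd e ltnn => /(_ isT).
Qed.

Lemma last_part d A j : strict_parts d A -> (j < d)%N -> (A j <= 1)%N -> j = d.-1 /\ A j = 1%N.
Proof.
move=> sA jd Aj; have A0 := sA.1 j jd; split; last by lia.
apply/eqP/negPn/negP => ne; have lt : (j < d.-1 < d)%N by lia.
have h := sA.2 _ _ lt; have h' : (0 < A d.-1)%N by apply: sA.1; lia.
lia.
Qed.

End StrictParts.

(** * Recursion for the closed form inside a block *)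

Section BlockWeights.
Variables (F : fieldType) (n : nat) (q im : F) (rt : nat -> F).
Hypothesis q_neq0 : q != 0.
Hypothesis qnat_neq0 : forall k, (1 <= k <= n)%N -> qnat q k != 0.
Local Notation qi := (qint q).
Local Notation al2 c := (alpha q im rt (2 * c)).
Local Notation lk := (link q).
Local Notation Zq := (Zq q).
Local Notation beta := (beta q im rt).

(* Parts of strict partitions are lengths of half hooks, so the particle with part
   p sits on the content p - 1, and the part 0 stands for a particle still to be
   created. *)
Definition Zpart (p : nat) : F := Zq p.-1.
Definition beta_part (p : nat) : F := beta p.-1.
Local Notation hdet := (hop_det Zpart beta_part).

(* Closed form of the sums over the first entries: the completed blocks contribute
   [K] and have created the parts [als], [r] entries of the current block have been
   placed, [A] describes the shape of all these entries, and [y] is the content of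
   the next entry. *)
Definition prefix_sum (K : F) (als : seq nat) (r d : nat) (A : nat -> nat) (y : int) : F :=
  K * (if odd r then qi y else 1) * (size als + odd r == d)%N%:R * hdet d (Zq `|y|) (nth 0%N als) A.

(** This says that lowering A j by one leaves a strict partition, that is, that the symmetric pair
    at the end of the j-th hook can be removed. *)
Definition pair_ok d (A : nat -> nat) j : bool :=
  (1 < A j)%N && ((j.+1 == d) || (A j.+1 < (A j).-1)%N).

(** A sum over fillings split by the last entry: it is a diagonal box, possible when the smallest
    part is 1, or it completes a symmetric pair in one of two orders. A pair takes two entries of
    the current block, hence 2 <= r. *)
Definition step_sum (phi : int -> F) (W : nat -> nat -> (nat -> nat) -> int -> F)
    (r d : nat) (A : nat -> nat) : F :=
  (if (0 < d)%N && (A d.-1 == 1%N) then phi 0 * W r.-1 d.-1 A 0 else 0) +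
  (if (2 <= r)%N then \sum_(j < d | pair_ok d A j)
      (phi (A j).-1%:Z * al2 (A j).-1%:Z * W r.-2 d (decr A j) (A j).-1%:Z +
       phi (- (A j).-1%:Z) * al2 (- (A j).-1%:Z) * W r.-2 d (decr A j) (- (A j).-1%:Z))
   else 0).

Lemma Zq_inj b c : b != c -> (b + c < n)%N -> Zq b != Zq c.
Proof.
move=> ne lt; have [c0|c0] := posnP c.
  have b0 : (0 < b)%N by lia.
  have [_ _ n3] := (@link_facts F n q q_neq0 qnat_neq0 b 0 b0 (ltac:(lia)) (ltac:(lia))).1.
  by rewrite c0; move: n3; rewrite subr_eq0 eq_sym.
have [_ _ n3] := (@link_facts F n q q_neq0 qnat_neq0 c b%:Z c0 (ltac:(lia)) (ltac:(lia))).1.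
by move: n3; rewrite subr_eq0.
Qed.

Lemma Zpart_inj d A j k : strict_parts d A -> (hook_sum d A <= n)%N ->
  (j < d)%N -> (k < d)%N -> Zpart (A j) = Zpart (A k) -> j = k.
Proof.
move=> sA hn jd kd e; apply/eqP/negPn/negP => ne.
have h := hook_sum_ge sA jd kd ne.
have n1 : A j != A k by apply: contraNneq ne => /(strict_inj sA jd kd) ->.
have [a0 _] := sA; have := a0 j jd; have := a0 k kd => k0 j0.
have : Zq (A j).-1 != Zq (A k).-1 by apply: Zq_inj; lia.
by rewrite -/(Zpart (A j)) e eqxx.
Qed.

Lemma alpha_link c : (0 < c)%N -> (2 * c <= n)%N ->
  al2 c%:Z * (qi (2 * c)%N%:Z / (q ^+ 2) ^ c%:Z) = beta c.
Proof.
case: c => // c _ cn; have n1 : qnat q (2 * c.+1) != 0 by apply: qnat_neq0; lia.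
have -> : 2 * c.+1%:Z = (2 * c.+1)%N%:Z by lia.
rewrite qint_nat /= /alpha_nat -exprnP -exprM.
have n2 : q ^+ (2 * c.+1) != 0 by rewrite expf_neq0.
by rewrite !mulrA divfK.
Qed.

Lemma alpha2N c : al2 (- c%:Z) = - al2 c%:Z.
Proof.
case: c => [|c]; last by rewrite mulrN.
by rewrite oppr0 mulr0 /= /alpha_nat /qnat big_ord0 invr0 mulr0 oppr0.
Qed.

Section OneBlock.
Variables (K : F) (als : seq nat) (r d : nat) (A : nat -> nat).
Hypotheses (als_gt0 : all (leq 1) als) (sA : strict_parts d A) (r_gt0 : (0 < r)%N).
Hypothesis size_eq : hook_sum d A = (hook_sum (size als) (nth 0%N als) + r)%N.
Hypothesis size_n : (hook_sum d A <= n)%N.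

Let theta (y : int) : F := if odd r then qi y else 1.
Let al := nth 0%N als.

Lemma al_gt0 i : (i < size als)%N -> (0 < al i)%N.
Proof. by move=> h; apply: (all_nthP 0%N als_gt0). Qed.

Lemma al_size : al (size als) = 0%N.
Proof. exact: nth_default. Qed.

Lemma sum_al : (size als + odd r)%N = d ->
  (2 * \sum_(j < d) A j = 2 * \sum_(i < d) al i + r + odd r)%N.
Proof.
move=> e; have h1 := hook_sumE sA; have h2 := hook_sum_seq als_gt0.
have -> : (\sum_(i < d) al i = \sum_(i < size als) al i)%N.
  rewrite -e; case: (odd r); last by rewrite addn0.
  by rewrite addn1 big_ord_recr /= al_size addn0.
have h3 := size_eq; rewrite -/al in h2 h3; lia.
Qed.

Lemma strict_decr_gt0 j k : (j < d)%N -> (1 < A j)%N -> (k < d)%N -> (0 < decr A j k)%N.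
Proof. by move=> jd Aj kd; rewrite /decr; case: eqP => [->|_]; [lia|apply: sA.1]. Qed.

(** The sum over removable corners becomes a sum over all particles: the surplus terms vanish, and a
    diagonal box counts as a hop between the part 1 and the reservoir 0. *)
Lemma step_sumE (phi : int -> F) (w : nat -> F) :
  (forall j, (j < d)%N -> (1 < A j)%N ->
    phi (A j).-1%:Z * al2 (A j).-1%:Z * theta (A j).-1%:Z +
    phi (- (A j).-1%:Z) * al2 (- (A j).-1%:Z) * theta (- (A j).-1%:Z) = w (A j)) ->
  (odd r -> (0 < d)%N -> A d.-1 = 1%N -> phi 0 = w 1%N) ->
  step_sum phi (prefix_sum K als) r d A =
  K * (size als + odd r == d)%N%:R * \sum_(j < d) w (A j) * hdet d (Zpart (A j)) al (decr A j).
Proof.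
move=> wP w1; rewrite /step_sum.
have oddr2 : (2 <= r)%N -> odd r.-2 = odd r by case: r r_gt0 => [|[|k]] //= _ _; rewrite negbK.
have oddr1 : odd r.-1 = ~~ odd r by case: r r_gt0 => //= k _; rewrite negbK.
have pairE (j : 'I_d) : (2 <= r)%N -> pair_ok d A j ->
   phi (A j).-1%:Z * al2 (A j).-1%:Z * prefix_sum K als r.-2 d (decr A j) (A j).-1%:Z +
   phi (- (A j).-1%:Z) * al2 (- (A j).-1%:Z) * prefix_sum K als r.-2 d (decr A j) (- (A j).-1%:Z) =
   K * (size als + odd r == d)%N%:R * (w (A j) * hdet d (Zpart (A j)) al (decr A j)).
  move=> r2 /andP[Aj _]; rewrite -wP //.
  rewrite /prefix_sum oddr2 // abszN absz_nat -/(theta _) -/(theta (- _)) -/(Zpart (A j)) -/al.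
  move: (hdet _ _ _ _) (theta _) (theta _) (al2 _) (al2 _) (phi _) (phi _) => a1 a2 a3 a4 a5 a6 a7.
  ring.
have [de|nde] := eqVneq (size als + odd r)%N d; last first.
  rewrite mulr0n mulr0 mul0r [X in _ + X](_ : _ = 0) ?addr0; last first.
    case: ifP => // r2; apply: big1 => j jok.
    by rewrite pairE // (negbTE nde) mulr0n mulr0 mul0r.
  case: ifP => // /andP[d0 /eqP A1]; rewrite /prefix_sum oddr1 qint0.
  case: (odd r) nde => /= nde; last by rewrite mulr0 !mul0r mulr0.
  by rewrite addn0 [_ == d.-1](_ : _ = false) ?mulr0 ?mul0r ?mulr0 //; lia.
rewrite mulr1 big_distrr /= [in LHS]addrC [RHS](bigID (fun j : 'I_d => 1 < A j)%N) /=.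
have sm := sum_al de.
congr (_ + _).
  have [r2|r1] := leqP 2 r.
    rewrite [RHS](bigID (fun j : 'I_d => pair_ok d A j)) /= [X in _ = _ + X]big1 ?addr0.
      under eq_bigr => j jok do rewrite pairE // de eqxx mulr1.
      by apply: eq_bigl => j; rewrite /pair_ok; case: (1 < A j)%N.
    (* A forbidden move lowers A j onto A (j + 1) and gives two equal rows. *)
    move=> j /andP[Aj]; rewrite /pair_ok Aj /= negb_or -leqNgt => /andP[jd le].
    have jd' : (j.+1 < d)%N by rewrite ltn_neqAle jd ltn_ord.
    have lt := sA.2 j j.+1; rewrite ltnSn jd' in lt; have := lt isT => {}lt.
    rewrite (@hop_det_eq_rows _ _ _ _ _ _ _ j j.+1) ?mulr0 //; first by rewrite ltn_eqF.
    by rewrite /decr eqxx gtn_eqF //; lia.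
  (* A single entry leaves no room for a pair. Lowering A j makes the totals equal, so the
     determinant would have to match the reservoir column 0 with one of the parts, which are all
     positive. *)
  rewrite big1 // => j Aj; have re : r = 1%N by lia.
  have o1 : odd r by rewrite re.
  rewrite hop_det_id; last by have := sum_decr (sA.1 j (ltn_ord j)); lia.
  rewrite (@id_det_col0 _ _ _ _ (size als)) ?mulr0 //; first by rewrite -de o1; lia.
  by move=> k kd; rewrite al_size eq_sym -lt0n strict_decr_gt0.
case: ifP => [/andP[d0 /eqP A1]|Nlast]; last first.
  rewrite big1 // => j; rewrite -leqNgt => /(last_part sA (ltn_ord j))[ej Aj].
  by move: Nlast; rewrite -ej Aj eqxx andbT; have := ltn_ord j; lia.
have ltd : (d.-1 < d)%N by lia.
rewrite (bigD1 (Ordinal ltd)) /= ?A1 // [X in _ + X]big1 ?addr0; last first.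
  move=> j /andP[]; rewrite -leqNgt => /(last_part sA (ltn_ord j))[ej _].
  by rewrite -val_eqE /= ej eqxx.
have dec0 : decr A d.-1 d.-1 = 0%N by rewrite /decr eqxx A1.
(* For even r the factor [0] of the remaining entries vanishes, as does the determinant, which has a
   row for the part 0 but no reservoir column. For odd r the row and column of the reservoir are
   stripped off. *)
rewrite /prefix_sum oddr1 qint0; case oddr: (odd r) => /=; last first.
  rewrite mulr0 !mul0r mulr0 (@hop_det_row0 _ _ _ _ _ _ _ d.-1) ?mulr0 //.
  by move=> i id; apply: al_gt0; move: de; rewrite oddr addn0 => ->.
have ed : size als = d.-1 by rewrite -de oddr addn1.
rewrite -w1 // addn0 ed eqxx !mulr1 mulrCA; congr (_ * (_ * _)).
have := @hop_det_last F Zpart beta_part d.-1 (Zpart 1) al (decr A d.-1).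
rewrite prednK // => ->; rewrite ?dec0 // -?ed ?al_size //; last exact: al_gt0.
by rewrite ed; apply: eq_hop_det => j jd; rewrite /decr ltn_eqF.
Qed.

(** This is [hop_det_rec], once the two orders of each pair have merged into a simple fraction; its
    first term drops out because r > 0 makes the totals differ. *)
Lemma prefix_sum_link y :
  (forall j, (j < d)%N -> `|y|%N != (A j).-1 /\ (`|y| + (A j).-1 < n)%N) ->
  step_sum (fun x => lk x y) (prefix_sum K als) r d A = prefix_sum K als r d A y.
Proof.
move=> yA; rewrite (@step_sumE _ (fun p => theta y * (beta_part p / (Zq `|y| - Zpart p)))).
- rewrite /prefix_sum -/(theta y) -/al.
  have [de|nde] := eqVneq (size als + odd r)%N d; last by rewrite !mulr0n !(mulr0, mul0r).
  rewrite (@hop_det_rec _ Zpart beta_part d al A); first 1 last.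
  + exact: sA.1.
  + by move=> j k; apply: Zpart_inj.
  + by move=> j jd; have [n1 n2] := yA j jd; apply: Zq_inj.
  rewrite id_det_sum_neq; last first.
    have := sum_al de; case: (odd r); lia.
  rewrite add0r !mulr1 -[RHS]mulrA; congr (_ * _); rewrite big_distrr /=.
  by apply: eq_bigr => j _; rewrite !mulrA.
- move=> j jd Aj; have [n1 n2] := yA j jd; have c0 : (0 < (A j).-1)%N by lia.
  have hA := hook_sum_ge1 A jd.
  have c2 : (2 * (A j).-1 <= n)%N by lia.
  have cy : ((A j).-1 + `|y| <= n)%N by lia.
  rewrite alpha2N /beta_part /Zpart; set c := (A j).-1 in n1 n2 c0 c2 cy *.
  rewrite -(alpha_link c0 c2) /theta; case: (odd r).
    have := link_diff_weighted q_neq0 qnat_neq0 c0 n1 cy.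
    move=> e; transitivity (al2 c%:Z * (qi c%:Z * lk c%:Z y - qi (- c%:Z) * lk (- c%:Z) y)).
      by move: (lk _ _) (lk _ _) (qi _) (qi _) (al2 _) => a1 a2 a3 a4 a5; ring.
    by rewrite e; move: (_^-1) (al2 _) (qi _) (qi _) => a1 a2 a3 a4; ring.
  have := link_diff q_neq0 qnat_neq0 c0 n1 cy.
  move=> e; transitivity (al2 c%:Z * (lk c%:Z y - lk (- c%:Z) y)).
    by move: (lk _ _) (lk _ _) (al2 _) => a1 a2 a3; ring.
  by rewrite e mul1r !mulrA.
(* A diagonal box is linked to y by -1/[-y] = q^(2y)/[y] = [y]/(Zq y - Zq 0); this is the origin of
   the factor [y] for odd r. *)
move=> o d0 A1; rewrite /theta o /beta_part /= mul1r /Zpart /= /link add0r.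
have [|n1 n2] := yA d.-1; first by lia.
rewrite A1 /= in n1 n2; have y0 : y != 0 by rewrite -absz_eq0.
have n3 : qi y != 0 by apply: (qint_neq0 q_neq0 qnat_neq0) => //; lia.
rewrite Zq_int // /Zq /qnat big_ord0 expr0n /= mul0r subr0 qintN // QN //.
have Qy := Q_neq0 q_neq0 y; move: n3 Qy; move: (qi y) (_ ^ _) => u v u0 v0.
by field; rewrite u0 v0 ?oppr_eq0 ?oner_neq0.
Qed.

(** At the end of a block nothing depends on the content left behind, so the two orders of each pair
    cancel through the sign of alpha. *)
Lemma prefix_sum_end_even : ~~ odd r ->
  step_sum (fun=> 1) (prefix_sum K als) r d A = 0.
Proof.
move=> Nodd; rewrite (@step_sumE _ (fun=> 0)).
- by rewrite big1 ?mulr0 // => j _; rewrite mul0r.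
- by move=> j jd Aj; rewrite /theta (negbTE Nodd) alpha2N; ring.
by rewrite (negbTE Nodd).
Qed.

(** Here the contents enter through [c] - [-c] = [2c] / q^(2c), which again completes alpha to
    [beta]; [hop_det_total] then turns the reservoir column into the new part. *)
Lemma prefix_sum_end_odd : odd r ->
  step_sum (fun=> 1) (prefix_sum K als) r d A =
  K * (beta_part (r.+1)./2 * hop_gen Zpart beta_part (Zpart (r.+1)./2) 0 (r.+1)./2.-1) *
  (size (rcons als (r.+1)./2) == d)%:R * id_det F d (nth 0%N (rcons als (r.+1)./2)) A.
Proof.
move=> o; rewrite (@step_sumE _ beta_part).
- rewrite o addn1 size_rcons; have [de|_] := eqVneq (size als).+1 d; last by rewrite !mulr0n !(mulr0, mul0r).
  set L := (r.+1)./2.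
  have := @hop_det_total F Zpart beta_part d al A sA.1 _ (size als) L (esym de).
  move=> ->; first 1 last.
  + by move=> j k; apply: Zpart_inj.
  + exact: al_gt0.
  + exact: al_size.
  + have := @sum_al; rewrite o addn1 => /(_ de); rewrite /L; lia.
  rewrite !mulr1 mulrA; congr (_ * _); congr (\det _); apply/matrixP => j i.
  rewrite !mxE nth_rcons; case: ltngtP => // lt.
  by have := ltn_ord i; move: de lt; lia.
- move=> j jd Aj; have hA := hook_sum_ge1 A jd.
  have c0 : (0 < (A j).-1)%N by lia.
  have c2 : (2 * (A j).-1 <= n)%N by lia.
  rewrite alpha2N /beta_part -(alpha_link c0 c2) /theta o; set c := (A j).-1.
  rewrite qintN // QN //.
  have -> : ((2 * c)%N)%:Z = c%:Z + c%:Z by lia.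
  rewrite qintD //; have Qc := Q_neq0 q_neq0 c; move: Qc; move: (_ ^ _) (qi _) (al2 _) => a1 a2 a3 a10.
  by field; rewrite a10.
by rewrite /beta_part.
Qed.

End OneBlock.
End BlockWeights.

(** * Expansion of the twisted trace over tableaux *)

Section Coefficients.
Variables (F : fieldType) (n : nat) (lam : seq nat) (q im : F) (rt : nat -> F).
Hypothesis q_neq0 : q != 0.
Hypothesis lamP : is_partition n lam.
Hypothesis lamC : conj_part lam = lam.
Variables (H : unitAlgType F) (T : 'I_n.-1 -> H).
Local Notation V := (specht F n lam).
Local Notation St := (std n lam).
Local Notation bv t := (@bvec F n lam t).
Variable act : V -> H -> V.
Hypothesis actP : specht_action q im rt T act.
Variable s : seq 'I_n.-1.
Hypothesis s_sorted : sorted ltn (map val s).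

Definition coef (v : V) (x : tableau n) : F := if insub x is Some u then v u else 0.

Lemma coef_std v (u : St) : coef v (val u) = v u.
Proof. by rewrite /coef valK. Qed.

Lemma coef_nonstd v x : ~~ is_std lam x -> coef v x = 0.
Proof. by move=> h; rewrite /coef insubF //; exact: negbTE. Qed.

Lemma swap_tabK (x : tableau n) i : swap_tab (swap_tab x i) i = x.
Proof. by apply/ffunP => k; rewrite !ffunE tpermK. Qed.

Lemma coef_act_T v x i : is_std lam x -> coef (act v (T i)) x =
  - 1 / qint q (axial x i) * coef v x +
  alpha q im rt (axial (swap_tab x i) i) * coef v (swap_tab x i).
Proof.
case/bvec_val=> u <-; rewrite !coef_std (linear_map_eval (act_linear actP (T i))).
have eqn t : act (bv (val t)) (T i) u =
    - 1 / qint q (axial (val t) i) * (t == u)%:R +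
    alpha_tab lam q im rt (val t) i * (swap_tab (val t) i == val u)%:R.
  by rewrite (act_T actP) ?(valP t) // !ffunE eq_sym -val_eqE [val u == _]eq_sym.
under eq_bigr do rewrite eqn mulrDr.
rewrite big_split /=; congr (_ + _).
  rewrite (bigD1 u) //= eqxx mulr1 big1 ?addr0 => [|t /negbTE ->]; first exact: mulrC.
  by rewrite !mulr0.
have [us|Nus] := boolP (is_std lam (swap_tab (val u) i)); last first.
  rewrite (coef_nonstd _ Nus) mulr0; apply: big1 => t _.
  case: eqP => [e|_]; last by rewrite !mulr0.
  have := congr1 (fun x => swap_tab x i) e; rewrite swap_tabK => e1.
  by case/negP: Nus; rewrite -e1; exact: valP t.
have [u' e'] := bvec_val us.
rewrite -e' coef_std (bigD1 u') //= big1 => [|t nt].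
  rewrite e' swap_tabK eqxx addr0 mulr1 /alpha_tab swap_tabK (valP u).
  exact: mulrC.
case: eqP => [e|_]; last by rewrite !mulr0.
case/eqP: nt; apply/val_inj; rewrite e' -[LHS](swap_tabK _ i).
by congr (swap_tab _ i).
Qed.

(** Only the letters that exchange two of the first m entries have acted. *)
Definition partial_act (m : nat) (t : tableau n) : V :=
  act (bv t) (T_word T [seq i : 'I_n.-1 <- s | (i.+1 < m)%N]).

Lemma filter_lt_succ (i : 'I_n.-1) : [seq j : 'I_n.-1 <- s | (j.+1 < i.+2)%N] =
  [seq j : 'I_n.-1 <- s | (j.+1 < i.+1)%N] ++ (if i \in s then [:: i] else [::]).
Proof.
elim: s s_sorted => //= j s' IH srt.
have als : all (fun k : 'I_n.-1 => j < k)%N s'.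
  by move: srt; rewrite (path_sortedE ltn_trans) all_map => /andP[].
have := IH (path_sorted srt); rewrite !ltnS leq_eqVlt inE => {}IH.
have [ji|ij|/val_inj e] := ltngtP j i.
- by rewrite IH /= -val_eqE (gtn_eqF ji).
- rewrite IH -val_eqE (ltn_eqF ij) /=.
  by [].
subst j; rewrite eqxx /=.
have -> : [seq j : 'I_n.-1 <- s' | (j.+1 < i.+2)%N] = [::].
  apply/eqP; rewrite -[_ == _]negbK -has_filter; apply/negP => /hasP[k ks].
  by have := allP als k ks; rewrite /= !ltnS; lia.
have -> // : [seq j : 'I_n.-1 <- s' | (j.+1 < i.+1)%N] = [::].
apply/eqP; rewrite -[_ == _]negbK -has_filter; apply/negP => /hasP[k ks].
by have := allP als k ks; rewrite /= !ltnS; lia.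
Qed.

Lemma partial_act_succ (i : 'I_n.-1) t : partial_act i.+2 t =
  if i \in s then act (partial_act i.+1 t) (T i) else partial_act i.+1 t.
Proof.
rewrite /partial_act filter_lt_succ; case: (i \in s); last by rewrite cats0.
by rewrite T_word_cat (act_mul actP) T_word_cons /T_word big_nil mulr1.
Qed.

Lemma partial_act_01 m t : (m <= 1)%N -> partial_act m t = bv t.
Proof.
move=> m1; rewrite /partial_act (@eq_filter _ _ pred0) ?filter_pred0.
  by rewrite /T_word big_nil (act_one actP).
by move=> i /=; lia.
Qed.

Lemma partial_act_support m (t x : tableau n) (k : 'I_n) : (m <= k)%N ->
  coef (partial_act m t) x != 0 -> x k = t k.
Proof.
elim: m x k => [|m IH] x k mk.
  rewrite partial_act_01 // /coef; case: insubP => [u _ <-|]; last by rewrite eqxx.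
  by rewrite bvecE; have [->//|_] := eqVneq (val u) t; rewrite eqxx.
case: m IH mk => [|m] IH mk.
  rewrite partial_act_01 // /coef; case: insubP => [u _ <-|]; last by rewrite eqxx.
  by rewrite bvecE; have [->//|_] := eqVneq (val u) t; rewrite eqxx.
have ltm : (m < n.-1)%N by have := ltn_ord k; lia.
have := partial_act_succ (Ordinal ltm) t; rewrite [partial_act (Ordinal ltm).+2 t]/(partial_act m.+2 t) => ->.
case: ifP => _; last by apply: IH; apply: ltnW.
have [xs|Nx] := boolP (is_std lam x); last by rewrite coef_nonstd ?eqxx.
rewrite coef_act_T //.
have [e1|n1 _] := eqVneq (coef (partial_act m.+1 t) x) 0; last by apply: IH n1; exact: ltnW.
have [e2|n2 _] := eqVneq (coef (partial_act m.+1 t) (swap_tab x (Ordinal ltm))) 0.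
  by rewrite [partial_act _ _]/(partial_act m.+1 t) e1 e2 !mulr0 addr0 eqxx.
rewrite -(IH (swap_tab x (Ordinal ltm)) k (ltnW mk) n2) ffunE; congr (x _).
by apply/val_inj; rewrite /= simple_refl_val /=; do ![case: ifP => /eqP]; lia.
Qed.

Lemma partial_act_support0 m (t x : tableau n) (k : 'I_n) : (m <= k)%N ->
  x k != t k -> coef (partial_act m t) x = 0.
Proof. by move=> mk; apply: contraNeq => /(partial_act_support mk)/eqP. Qed.

Definition flip (p : 'I_n * 'I_n) := (p.2, p.1).

Lemma flipK : involutive flip. Proof. by case. Qed.

(* The coefficient [mix_coef t n] of v_{t'} in v_t T_w is the contribution of t to the
   twisted trace; [mix] interpolates between t and t'. *)
Definition mix (t : tableau n) (m : nat) : tableau n :=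
  [ffun k : 'I_n => if (k < m)%N then flip (t k) else t k].

Definition mix_coef (t : tableau n) (m : nat) : F := coef (partial_act m t) (mix t m).

(** The condition under which [mix t m] is again standard. *)
Definition conj_closed (t : tableau n) (m : nat) : Prop :=
  forall k : 'I_n, (k < m)%N -> exists2 k' : 'I_n, (k' < m)%N & t k' = flip (t k).

Lemma mix0 t : mix t 0 = t.
Proof. by apply/ffunP => k; rewrite ffunE. Qed.

Lemma mix_full t : mix t n = conj_tab t.
Proof. by apply/ffunP => k; rewrite !ffunE ltn_ord. Qed.

Lemma mix_std t m : is_std lam t -> conj_closed t m -> is_std lam (mix t m).
Proof.
move=> ts cl; have ts' := conj_tab_std lamP lamC ts.
have conjE k : conj_tab t k = flip (t k) by rewrite ffunE.
apply/and4P; split.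
- apply/injectiveP => k l; rewrite !ffunE; case: ifP => lk; case: ifP => ll.
  + by move/(can_inj flipK)/(std_inj ts).
  + by have [k' lk' <-] := cl k lk => /(std_inj ts) e; rewrite -e lk' in ll.
  + by have [l' ll' <-] := cl l ll => /(std_inj ts) e; rewrite e ll' in lk.
  + exact: (std_inj ts).
- apply/forallP => k; rewrite ffunE; case: ifP => _; last exact: (std_shape ts).
  by rewrite -conjE (std_shape ts').
- apply/forallP => k; apply/forallP => l; apply/implyP; rewrite !ffunE.
  case: ifP => lk; case: ifP => ll; rewrite -?conjE => /andP[/eqP e lt].
  + exact: (std_row ts' e lt).
  + by rewrite (leq_trans lk) // leqNgt ll.
  + have [l' ll' e'] := cl l ll; move: e lt; rewrite conjE -e' => e lt.
    have := std_row ts e lt; move/negbT: lk; lia.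
  + exact: (std_row ts e lt).
apply/forallP => k; apply/forallP => l; apply/implyP; rewrite !ffunE.
case: ifP => lk; case: ifP => ll; rewrite -?conjE => /andP[/eqP e lt].
+ exact: (std_col ts' e lt).
+ by rewrite (leq_trans lk) // leqNgt ll.
+ have [l' ll' e'] := cl l ll; move: e lt; rewrite conjE -e' => e lt.
  have := std_col ts e lt; move/negbT: lk; lia.
+ exact: (std_col ts e lt).
Qed.

Definition box_content (p : 'I_n * 'I_n) : int := p.2%:Z - p.1%:Z.

Lemma box_content_flip p : box_content (flip p) = - box_content p.
Proof. by rewrite /box_content /= opprB. Qed.

(* [linkat i x y]: factor contributed by T_i when the entry i leaves the content x
   to the entry i + 1, which has content y; it is 1 at the end of a block. *)
Definition linkat (i : nat) (x y : int) : F :=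
  if i \in map val s then link q x y else 1.

(** The content in [mix t m] of the m-th entry, counted from 1; the sign comes from the
    transposition. *)
Definition out (t : tableau n) (m : nat) : int :=
  if insub m.-1 is Some k then - box_content (t k) else 0.

Lemma out_val t m (k : 'I_n) : k = m.-1 :> nat -> out t m = - box_content (t k).
Proof.
move=> e; rewrite /out; case: insubP => [k' _ ek|]; last by rewrite -e ltn_ord.
by congr (- box_content (t _)); apply/val_inj; rewrite /= ek e.
Qed.

Lemma mix_coef0 t : is_std lam t -> mix_coef t 0 = 1.
Proof.
move=> ts; rewrite /mix_coef mix0 partial_act_01 //; have [u <-] := bvec_val ts.
by rewrite coef_std bvecE eqxx.
Qed.

(* The hypothesis on [x] discards the second term of the action of T_i: after
   [partial_act m t] the entries from [m] on are still placed as in [t]. *)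
Lemma coef_keep (t x : tableau n) (m : nat) : is_std lam x -> (0 < m)%N ->
  (forall i : 'I_n.-1, i.+1 = m :> nat -> x (lo_ord i) != t (hi_ord i)) ->
  coef (partial_act m.+1 t) x =
    (if insub m.-1 is Some i then
       if i \in s then - 1 / qint q (axial x i) else 1 else 1) * coef (partial_act m t) x.
Proof.
move=> xs m0 nx; case: insubP => [i _ ei|ge]; last first.
  rewrite mul1r /partial_act; congr (coef (act _ (T_word T _)) _).
  by apply: eq_in_filter => j _; have := ltn_ord j; move: ge; lia.
have em : m = i.+1 :> nat by rewrite ei prednK.
rewrite em partial_act_succ; case: ifP => _; last by rewrite mul1r.
rewrite coef_act_T // -em (@partial_act_support0 m t (swap_tab x i) (hi_ord i)).
- by rewrite mulr0 addr0.
- by rewrite em.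
by rewrite ffunE simple_reflR nx.
Qed.

Lemma mix_coef_diag (t : tableau n) (k : 'I_n) : is_std lam t -> conj_closed t k ->
  flip (t k) = t k ->
  mix_coef t k.+1 = (if (0 < k)%N then linkat k.-1 (out t k) 0 else 1) * mix_coef t k.
Proof.
move=> ts cl dk; rewrite /mix_coef.
have -> : mix t k.+1 = mix t k.
  apply/ffunP => l; rewrite !ffunE ltnS leq_eqVlt; case: eqP => [/val_inj ->|] //=.
  by rewrite ltnn dk.
have xs := mix_std ts cl.
have [k0|k0] := posnP k.
  by rewrite k0 !partial_act_01 // mul1r.
rewrite coef_keep // => [|i ei]; last first.
  have -> : hi_ord i = k by apply/val_inj.
  rewrite ffunE /= -ei ltnSn; apply: contraTneq isT => e.
  have : lo_ord i = k by apply: (std_inj ts); rewrite -dk -e flipK.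
  by move=> /(congr1 val) /=; rewrite -ei; lia.
congr (_ * _); rewrite /linkat; case: insubP => [i ik ei|]; last first.
  by have := ltn_ord k; lia.
have loi : lo_ord i = k.-1 :> nat by [].
have hi : hi_ord i = k by apply/val_inj; rewrite /= ei prednK.
rewrite -ei (mem_map val_inj); case: ifP => // _; rewrite /link; congr (_ / qint q _).
rewrite /axial hi -[content _ _]/(box_content _) -[content _ k]/(box_content _) !ffunE ltnn.
rewrite (_ : (lo_ord i < k)%N); last by rewrite loi prednK.
rewrite box_content_flip (out_val t loi); congr (_ - _).
by have := box_content_flip (t k); rewrite dk; lia.
Qed.

(** Of the letters acting so far only T_(k-1) can move the entry k, by exchanging it with k - 1. The
    box t k must then be the one of k - 1 in [mix], so that in t the entry k - 1 fills the mirror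
    image of t k. *)
Lemma mix_coef_pair0 (t : tableau n) (k : 'I_n) : is_std lam t -> conj_closed t k.+1 ->
  flip (t k) != t k ->
  (forall i : 'I_n.-1, hi_ord i = k -> i \in s -> t (lo_ord i) != flip (t k)) ->
  mix_coef t k.+1 = 0.
Proof.
move=> ts cl dk np; rewrite /mix_coef.
have xs := mix_std ts cl.
have xk : mix t k.+1 k != t k by rewrite ffunE ltnSn.
have [k0|k0] := posnP k.
  have -> : partial_act k.+1 t = partial_act k t by rewrite !partial_act_01 ?k0.
  by rewrite (partial_act_support0 (k := k)).
have ki : (k.-1 < n.-1)%N by have := ltn_ord k; lia.
pose i := Ordinal ki; have hi : hi_ord i = k by apply/val_inj; rewrite /= prednK.
have ek : k = i.+1 :> nat by rewrite /= prednK.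
have := partial_act_succ i t; rewrite -ek => ->.
case: ifP => [ins|_]; last by rewrite (partial_act_support0 (k := k)).
rewrite coef_act_T // (partial_act_support0 (k := k) _ xk) // mulr0 add0r.
rewrite (partial_act_support0 (k := k)) ?mulr0 // ffunE -hi simple_reflR hi ffunE.
have -> : (lo_ord i < k.+1)%N by rewrite /=; lia.
by apply: contra (np i hi ins) => /eqP <-; rewrite flipK.
Qed.

(** T_i has to exchange the pair, whose axial distance is twice the content; T_(i-1) must leave the
    entry i in place and contributes its diagonal coefficient. *)
Lemma mix_coef_pair (t : tableau n) (i : 'I_n.-1) : is_std lam t -> conj_closed t i.+2 ->
  conj_closed t i -> i \in s -> t (lo_ord i) = flip (t (hi_ord i)) ->
  mix_coef t i.+2 = alpha q im rt (2 * box_content (t (lo_ord i))) *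
    (if (0 < i)%N then linkat i.-1 (out t i) (box_content (t (lo_ord i))) else 1) * mix_coef t i.
Proof.
move=> ts cl2 cl ins pr; rewrite /mix_coef.
have xs := mix_std ts cl2; have xs2 := mix_std ts cl.
have ne : flip (t (hi_ord i)) != t (hi_ord i).
  by rewrite -pr (inj_eq (std_inj ts)) lo_neq_hi.
have sw : swap_tab (mix t i.+2) i = mix t i.
  apply/ffunP => l; rewrite !ffunE; have := simple_refl_val i l.
  case: eqP => [e|ne1].
    move=> e2; have -> : simple_refl i l = hi_ord i by apply/val_inj.
    have -> : l = lo_ord i by apply/val_inj.
    by rewrite /= ltnSn ltnn pr.
  case: eqP => [e|ne2].
    move=> e2; have -> : simple_refl i l = lo_ord i by apply/val_inj.
    have -> : l = hi_ord i by apply/val_inj.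
    by rewrite /= ltnS leqnSn ltnNge leqnSn /= pr flipK.
  move=> /val_inj ->; congr (if _ then _ else _); lia.
rewrite partial_act_succ ins coef_act_T // sw.
rewrite (@partial_act_support0 i.+1 t (mix t i.+2) (hi_ord i)) //; last first.
  by rewrite ffunE /= ltnSn.
rewrite mulr0 add0r.
have -> : axial (mix t i) i = 2 * box_content (t (lo_ord i)).
  rewrite /axial -[content _ _]/(box_content _) -[content _ (hi_ord i)]/(box_content _) !ffunE /= ltnn.
  rewrite ltnNge leqnSn /=; have -> : t (hi_ord i) = flip (t (lo_ord i)) by rewrite pr flipK.
  by rewrite box_content_flip; lia.
rewrite -mulrA; congr (_ * _).
have [i0|i0] := posnP i.
  by rewrite i0 !partial_act_01 // mul1r.
rewrite coef_keep // => [|j ej]; last first.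
  have -> : hi_ord j = lo_ord i by apply/val_inj.
  rewrite ffunE /= -ej ltnSn pr (inj_eq (can_inj flipK)) (inj_eq (std_inj ts)).
  by rewrite -val_eqE /= -ej; lia.
congr (_ * _); rewrite /linkat; case: insubP => [j jk ej|]; last first.
  by have := ltn_ord i; lia.
have loj : lo_ord j = i.-1 :> nat by [].
have hj : hi_ord j = lo_ord i by apply/val_inj; rewrite /= ej prednK.
rewrite -ej (mem_map val_inj); case: ifP => // _; rewrite /link; congr (_ / qint q _).
rewrite /axial hj -[content _ _]/(box_content _) -[content _ (lo_ord i)]/(box_content _) !ffunE /= ltnn.
rewrite (_ : (j < i)%N); last by rewrite ej prednK.
by rewrite box_content_flip (out_val t loj).
Qed.

End Coefficients.

(** * Self-conjugate shapes given by their half hooks *)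

Section HalfHookShapes.
Implicit Types (A : nat -> nat).

(* The self-conjugate shape with d diagonal boxes whose i-th half hook, corner
   included, has A i boxes. *)
Definition boxn (d : nat) A (r c : nat) : bool :=
  (minn r c < d)%N && (maxn r c - minn r c < A (minn r c))%N.

Lemma boxn_sym d A r c : boxn d A r c = boxn d A c r.
Proof. by rewrite /boxn minnC maxnC. Qed.

Lemma boxn_diag d A i : (i < d)%N -> (0 < A i)%N -> boxn d A i i.
Proof. by move=> h1 h2; rewrite /boxn minnn maxnn subnn h1. Qed.

Lemma corner_diag d A i : strict_parts d A -> boxn d A i i -> ~~ boxn d A i i.+1 ->
  i = d.-1 /\ A i = 1%N.
Proof.
move=> sA; rewrite /boxn minnn => /andP[id _].
rewrite (minn_idPl (leqnSn i)) (maxn_idPr (leqnSn i)) id /= subSnn -leqNgt => A1.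
exact: (last_part sA).
Qed.

Lemma corner_pair d A (r c : nat) : strict_parts d A -> r != c -> boxn d A r c ->
  ~~ boxn d A r c.+1 -> ~~ boxn d A r.+1 c -> let j := minn r c in
  [/\ (j < d)%N, pair_ok d A j & maxn r c = (j + (A j).-1)%N].
Proof.
wlog lt : r c / (r < c)%N.
  move=> W sA ne b1 b2 b3; have [h|h] : (r < c)%N \/ (c < r)%N by lia.
  - exact: (W r c h sA ne b1 b2 b3).
  - rewrite minnC maxnC; apply: (W c r h sA); rewrite 1?eq_sym //.
    + by rewrite boxn_sym.
    + by rewrite boxn_sym.
    + by rewrite boxn_sym.
move=> sA _; rewrite /boxn (minn_idPl (ltnW lt)) (maxn_idPr (ltnW lt)).
have lt' : (r < c.+1)%N by lia.
rewrite (minn_idPl (ltnW lt')) (maxn_idPr (ltnW lt')) (minn_idPl lt) (maxn_idPr lt).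
move=> /andP[rd lA] h1 h2 /=.
have e1 : A r = (c - r).+1 by move: h1; rewrite rd /= -leqNgt; lia.
split=> //; last by lia.
rewrite /pair_ok; apply/andP; split; first by lia.
case: eqP => //= ne; have rd' : (r.+1 < d)%N by lia.
have := sA.2 r r.+1; rewrite ltnSn rd' => /(_ isT) dec.
by move: h2; rewrite rd' /= -leqNgt; lia.
Qed.

Lemma boxn_remove_diag d A r c : strict_parts d A -> (0 < d)%N -> A d.-1 = 1%N ->
  boxn d.-1 A r c = boxn d A r c && ((r, c) != (d.-1, d.-1)).
Proof.
move=> sA d0 A1; rewrite /boxn xpair_eqE.
have [lt|ge] := ltnP (minn r c) d.-1.
  rewrite (leq_trans lt (leq_pred d)) /=.
  have -> : (r == d.-1) && (c == d.-1) = false by apply/negP; lia.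
  by rewrite andbT.
have [e|ne] := eqVneq (minn r c) d.-1; last first.
  by have -> : (minn r c < d)%N = false by lia.
rewrite e A1 /=; apply/esym/negP; lia.
Qed.

Lemma boxn_remove_pair d A j r c : strict_parts d A -> (j < d)%N -> pair_ok d A j ->
  boxn d (decr A j) r c =
  boxn d A r c && ((r, c) != ((j + (A j).-1)%N, j)) && ((r, c) != (j, (j + (A j).-1)%N)).
Proof.
move=> sA jd /andP[A1 _]; rewrite /boxn /decr !xpair_eqE.
have [lt|ge] //= := ltnP (minn r c) d.
have [e|ne] := eqVneq (minn r c) j; last first.
  rewrite -andbA [X in _ = _ && X](_ : _ = true) ?andbT //.
  by apply/andP; split; apply/negP; lia.
rewrite e; apply/idP/idP; first by move=> h; rewrite -andbA; apply/and3P; split; lia.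
by rewrite -andbA => /and3P[h1 h2 h3]; lia.
Qed.

Lemma strict_parts_pred d A : strict_parts d A -> strict_parts d.-1 A.
Proof. by case=> A0 dec; split=> [j jd|j k jk]; [apply: A0; lia|apply: dec; lia]. Qed.

Lemma strict_parts_decr d A j : strict_parts d A -> (j < d)%N -> pair_ok d A j ->
  strict_parts d (decr A j).
Proof.
case=> A0 dec jd /andP[A1 ok]; split=> [k kd|k l /andP[kl ld]].
  by rewrite /decr; case: eqP => [->|_]; [lia|apply: A0].
rewrite /decr; case: (k =P j) => [ek|_]; case: (l =P j) => [el|_].
- by lia.
- rewrite ek; have jl : (j < l)%N by rewrite -ek.
  have lt : (A j.+1 < (A j).-1)%N by case/orP: ok => // /eqP; lia.
  apply: leq_ltn_trans lt; move: jl; rewrite leq_eqVlt => /orP[/eqP <- //|jl].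
  by apply: ltnW; apply: dec; lia.
- by have := dec k l; rewrite kl ld el => /(_ isT); lia.
by apply: dec; rewrite kl.
Qed.

Lemma hook_sum_pred d A : (0 < d)%N -> A d.-1 = 1%N -> hook_sum d A = (hook_sum d.-1 A).+1.
Proof. by case: d => // d _ /= A1; rewrite /hook_sum big_ord_recr /= A1 addn1. Qed.

Lemma hook_sum_decr d A j : (j < d)%N -> (1 < A j)%N ->
  hook_sum d A = (hook_sum d (decr A j)).+2.
Proof.
move=> jd A1; rewrite /hook_sum (bigD1 (Ordinal jd)) //= [in RHS](bigD1 (Ordinal jd)) //=.
have -> : decr A j j = (A j).-1 by rewrite /decr eqxx.
rewrite -!addSn; congr (_ + _)%N; first by lia.
by apply: eq_bigr => k; rewrite -val_eqE /= /decr => /negbTE ->.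
Qed.

End HalfHookShapes.

(** * Standard tableaux with a prescribed tail *)

Section TailInvariant.
Variables (n : nat) (lam : seq nat).
Hypothesis lamP : is_partition n lam.
Implicit Types (u t : tableau n) (P : nat -> nat -> bool) (p : 'I_n * 'I_n).

(* The entries of [u] from number [m] on can be the last entries of a standard
   tableau whose first [m] entries fill the boxes [P]. *)
Record tail_inv (m : nat) u P : Prop := TailInv {
  ti_shape : forall k : 'I_n, (m <= k)%N ->
    ((u k).2 < nth 0 lam (u k).1)%N /\ ~~ P (u k).1 (u k).2;
  ti_inj : forall k l : 'I_n, (m <= k)%N -> (m <= l)%N -> u k = u l -> k = l;
  ti_row : forall k l : 'I_n, (m <= k)%N -> (m <= l)%N -> (u k).1 = (u l).1 ->
    ((u k).2 < (u l).2)%N -> (k < l)%N;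
  ti_col : forall k l : 'I_n, (m <= k)%N -> (m <= l)%N -> (u k).2 = (u l).2 ->
    ((u k).1 < (u l).1)%N -> (k < l)%N;
  ti_prow : forall (k : 'I_n) c, (m <= k)%N -> P (u k).1 c -> (c < (u k).2)%N;
  ti_pcol : forall (k : 'I_n) r, (m <= k)%N -> P r (u k).2 -> (r < (u k).1)%N;
  ti_cover : forall r c, (c < nth 0 lam r)%N -> P r c \/
    exists2 k : 'I_n, (m <= k)%N & ((u k).1 = r :> nat /\ (u k).2 = c :> nat);
  ti_sub : forall r c, P r c -> (c < nth 0 lam r)%N
}.

Definition upd u (k : 'I_n) p : tableau n := [ffun l => if l == k then p else u l].

Lemma tail_inv_ext m u P P' : (forall r c, P r c = P' r c) -> tail_inv m u P -> tail_inv m u P'.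
Proof.
move=> e [h1 h2 h3 h4 h5 h6 h7 h8]; split=> // [k mk|k c mk|k r mk|r c rc|r c].
- by rewrite -e; apply: h1.
- by rewrite -e; apply: h5.
- by rewrite -e; apply: h6.
- by rewrite -e; apply: h7.
- by rewrite -e; apply: h8.
Qed.

Lemma tail_inv_step (k : 'I_n) u P p : tail_inv k.+1 u P -> P p.1 p.2 ->
  (forall c, P p.1 c -> (c <= p.2)%N) -> (forall r, P r p.2 -> (r <= p.1)%N) ->
  tail_inv k (upd u k p)
    (fun r c => P r c && ((r, c) != (nat_of_ord p.1, nat_of_ord p.2))).
Proof.
move=> [h1 h2 h3 h4 h5 h6 h7 h8] Pp rowp colp.
have U (l : 'I_n) : (k <= l)%N -> upd u k p l = p /\ l = k \/ upd u k p l = u l /\ (k < l)%N.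
  rewrite ffunE leq_eqVlt => /orP[/eqP/val_inj <-|lt]; first by left; rewrite eqxx.
  by right; rewrite -val_eqE /= gtn_eqF.
split.
- move=> l kl; case: (U l kl) => -[-> h]; first by rewrite h8 // Pp eqxx.
  by have [e1 e2] := h1 l h; rewrite e1 (negbTE e2).
- move=> l l' kl kl'; case: (U l kl) => -[-> h]; case: (U l' kl') => -[-> h'].
  + by rewrite h h'.
  + by move=> e; have [_] := h1 l' h'; rewrite -e Pp.
  + by move=> e; have [_] := h1 l h; rewrite e Pp.
  + exact: h2.
- move=> l l' kl kl'; case: (U l kl) => -[-> h]; case: (U l' kl') => -[-> h'].
  + by rewrite ltnn.
  + by rewrite h.
  + by move=> e lt; have := h5 l p.2 h; rewrite e Pp => /(_ isT); lia.
  + exact: h3.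
- move=> l l' kl kl'; case: (U l kl) => -[-> h]; case: (U l' kl') => -[-> h'].
  + by rewrite ltnn.
  + by rewrite h.
  + by move=> e lt; have := h6 l p.1 h; rewrite e Pp => /(_ isT); lia.
  + exact: h4.
- move=> l c kl; case: (U l kl) => -[-> h] /andP[Pc ne]; last exact: h5.
  have := rowp c Pc; rewrite leq_eqVlt => /orP[/eqP e|//].
  by rewrite e eqxx in ne.
- move=> l r kl; case: (U l kl) => -[-> h] /andP[Pc ne]; last exact: h6.
  have := colp r Pc; rewrite leq_eqVlt => /orP[/eqP e|//].
  by rewrite e eqxx in ne.
- move=> r c rc; have [Prc|[l kl e]] := h7 r c rc; last first.
    by right; exists l; [exact: ltnW|rewrite ffunE -val_eqE /= gtn_eqF].
  have [[-> ->]|ne] := eqVneq (r, c) (nat_of_ord p.1, nat_of_ord p.2); last by left; rewrite Prc.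
  by right; exists k => //; rewrite ffunE eqxx.
by move=> r c /andP[Prc _]; apply: h8.
Qed.

Definition agree t u (m : nat) : bool := [forall k : 'I_n, (m <= k)%N ==> (t k == u k)].

Lemma agreeP t u m : reflect (forall k : 'I_n, (m <= k)%N -> t k = u k) (agree t u m).
Proof.
apply: (iffP forallP) => [h k mk|h k]; first by apply/eqP; have /implyP := h k; apply.
by apply/implyP => mk; apply/eqP/h.
Qed.

Lemma agree_upd t u (k : 'I_n) p : agree t (upd u k p) k = (t k == p) && agree t u k.+1.
Proof.
apply/agreeP/andP => [h|[/eqP e /agreeP h] l].
  split; first by rewrite h // ffunE eqxx.
  by apply/agreeP => l kl; rewrite h 1?ltnW // ffunE -val_eqE /= gtn_eqF.
rewrite ffunE leq_eqVlt => /orP[/eqP/val_inj <-|lt]; first by rewrite eqxx.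
by rewrite -val_eqE /= gtn_eqF // h.
Qed.

Lemma tail_prefix m u P t (k : 'I_n) : tail_inv m u P -> is_std lam t -> agree t u m ->
  (k < m)%N = P (t k).1 (t k).2.
Proof.
move=> ti ts /agreeP ag; apply/idP/idP => [km|Pk].
  have [//|[l ml [e1 e2]]] := ti_cover ti (std_shape ts k).
  have : t l = t k by rewrite ag //; apply/eqP; rewrite -pair_eqE /pair_eq -!val_eqE /= e1 e2 !eqxx.
  by move/(std_inj ts) => e; rewrite e leqNgt km in ml.
by rewrite ltnNge; apply/negP => mk; have [_] := ti_shape ti mk; rewrite -ag // Pk.
Qed.

Lemma tail_std u P : tail_inv 0 u P -> is_std lam u.
Proof.
move=> ti; apply/and4P; split.
- by apply/injectiveP => k l; apply: (ti_inj ti).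
- by apply/forallP => k; have [] := ti_shape ti (leq0n k).
- apply/forallP => k; apply/forallP => l; apply/implyP => /andP[/eqP e lt].
  exact: (ti_row ti _ _ e).
apply/forallP => k; apply/forallP => l; apply/implyP => /andP[/eqP e lt].
exact: (ti_col ti _ _ e).
Qed.

Lemma box_pos m u P r c : tail_inv m u P -> P r c ->
  exists p : 'I_n * 'I_n, p.1 = r :> nat /\ p.2 = c :> nat.
Proof.
move=> ti /(ti_sub ti)/(part_bounds lamP) lt.
have rn : (r < n)%N by lia.
have cn : (c < n)%N by lia.
by exists (Ordinal rn, Ordinal cn).
Qed.

Lemma tail_corner (k : 'I_n) u P t : tail_inv k.+1 u P -> is_std lam t -> agree t u k.+1 ->
  [/\ P (t k).1 (t k).2, forall c, P (t k).1 c -> (c <= (t k).2)%N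
    & forall r, P r (t k).2 -> (r <= (t k).1)%N].
Proof.
move=> ti ts ag; have Pk : P (t k).1 (t k).2 by rewrite -(tail_prefix _ ti ts ag).
have fill p : P p.1 p.2 -> exists2 l : 'I_n, (l <= k)%N & t l = p.
  move=> Pp; have [l e] := std_surj lamP ts (ti_sub ti Pp); exists l => //.
  by rewrite -ltnS (tail_prefix l ti ts ag) e.
split=> // [c Pc|r Pr]; rewrite leqNgt; apply/negP => lt.
  have [p [e1 e2]] := box_pos ti Pc.
  have [|l lk e] := fill p; first by rewrite e1 e2.
  have : (k < l)%N by apply: (std_row ts); rewrite e ?e2 //; apply/val_inj; rewrite /= e1.
  by rewrite ltnNge lk.
have [p [e1 e2]] := box_pos ti Pr.
have [|l lk e] := fill p; first by rewrite e1 e2.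
have : (k < l)%N by apply: (std_col ts); rewrite e ?e1 //; apply/val_inj; rewrite /= e2.
by rewrite ltnNge lk.
Qed.

Lemma tail_closed m u P t : tail_inv m u P -> is_std lam t -> agree t u m ->
  (forall r c, P r c = P c r) -> conj_closed t m.
Proof.
move=> ti ts ag sym k km; have Pk : P (flip (t k)).1 (flip (t k)).2.
  by rewrite /= sym -(tail_prefix _ ti ts ag).
have [l e] := std_surj lamP ts (ti_sub ti Pk); exists l => //.
by rewrite (tail_prefix _ ti ts ag) e.
Qed.

End TailInvariant.

Section HalfHookCorners.
Implicit Types (A : nat -> nat).

Lemma strict_parts_gap d A j l : strict_parts d A -> (j <= l < d)%N -> (A l + (l - j) <= A j)%N.
Proof.
move=> sA; elim: l => [|l IH] /andP[jl ld].
  have -> : j = 0%N by lia.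
  by rewrite subnn addn0.
move: jl; rewrite leq_eqVlt => /orP[/eqP ->|jl]; first by rewrite subnn addn0.
have h : (j <= l < d)%N by rewrite -ltnS jl ltnW.
have dec : (A l.+1 < A l)%N by apply: sA.2; rewrite ltnSn.
by have := IH h; lia.
Qed.

Lemma pair_corner d A j : strict_parts d A -> (j < d)%N -> pair_ok d A j ->
  let c := (A j).-1 in
  [/\ boxn d A (j + c) j, forall c', boxn d A (j + c) c' -> (c' <= j)%N
    & forall r', boxn d A r' j -> (r' <= j + c)%N].
Proof.
move=> sA jd /andP[A1 ok] c; split=> [|c'|r'].
- by rewrite /boxn (minn_idPr (leq_addr _ _)) (maxn_idPl (leq_addr _ _)) jd /c; lia.
- rewrite /boxn [(c' <= j)%N]leqNgt => /andP[md lt]; apply/negP => jc.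
  have jm : (j < minn (j + c) c')%N by rewrite /c; lia.
  have j1 : (j.+1 < d)%N by lia.
  have dec : (A j.+1 < (A j).-1)%N by case/orP: ok => // /eqP; lia.
  have h : (j.+1 <= minn (j + c) c' < d)%N by rewrite jm md.
  by have := strict_parts_gap sA h; rewrite -/c in dec; move: lt; lia.
rewrite /boxn [(r' <= _)%N]leqNgt => /andP[md lt]; apply/negP => jr.
have e : minn r' j = j by lia.
by move: lt; rewrite e /c in jr *; lia.
Qed.

Lemma diag_corner d A : strict_parts d A -> (0 < d)%N -> A d.-1 = 1%N ->
  [/\ boxn d A d.-1 d.-1, forall c', boxn d A d.-1 c' -> (c' <= d.-1)%N
    & forall r', boxn d A r' d.-1 -> (r' <= d.-1)%N].
Proof.
move=> sA d0 A1; split=> [|c'|r'].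
- by rewrite boxn_diag ?A1 //; lia.
- rewrite /boxn [(c' <= _)%N]leqNgt => /andP[md lt]; apply/negP => jc.
  have e : minn d.-1 c' = d.-1 by lia.
  by move: lt; rewrite e A1; lia.
rewrite /boxn [(r' <= _)%N]leqNgt => /andP[md lt]; apply/negP => jc.
have e : minn r' d.-1 = d.-1 by lia.
by move: lt; rewrite e A1; lia.
Qed.

Lemma minn_maxn_cases r c x : maxn r c = (minn r c + x)%N ->
  (r = minn r c /\ c = (minn r c + x)%N) \/ (r = (minn r c + x)%N /\ c = minn r c).
Proof. by case: (leqP r c) => _ ->; [left|right]. Qed.

Lemma leq_ltn_succ2 i l : (i <= l)%N -> (l < i.+2)%N -> l = i \/ l = i.+1.
Proof. lia. Qed.

End HalfHookCorners.

(** * Removing the last entry of a sum over tableaux *)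

Section PrefixSums.
Variables (F : fieldType) (n : nat) (lam : seq nat) (q im : F) (rt : nat -> F).
Hypothesis q_neq0 : q != 0.
Hypothesis lamP : is_partition n lam.
Hypothesis lamC : conj_part lam = lam.
Variables (H : unitAlgType F) (T : 'I_n.-1 -> H).
Local Notation St := (std n lam).
Variable act : specht F n lam -> H -> specht F n lam.
Hypothesis actP : specht_action q im rt T act.
Variable s : seq 'I_n.-1.
Hypothesis s_sorted : sorted ltn (map val s).
Local Notation mix_coef t m := (mix_coef T act s t m).
Local Notation linkat := (linkat q s).
Local Notation al2 c := (alpha q im rt (2 * c)).

Definition link_before (k : nat) (x y : int) : F := if (0 < k)%N then linkat k.-1 x y else 1.

(* Contribution to the twisted trace of the first [m] entries, when the other ones
   are frozen as in [u]; [phi] weighs the content left by entry number [m]. *)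
Definition tail_trace (m : nat) (u : tableau n) (phi : int -> F) : F :=
  \sum_(t : St | agree (val t) u m) phi (out (val t) m) * mix_coef (val t) m.

Definition pt (k : 'I_n) (r c : nat) : 'I_n * 'I_n := (insubd k r, insubd k c).

Lemma pt_val k r c : (r < n)%N -> (c < n)%N ->
  (pt k r c).1 = r :> nat /\ (pt k r c).2 = c :> nat.
Proof. by move=> rn cn; rewrite /pt !val_insubd rn cn. Qed.

Lemma pos_eq (p p' : 'I_n * 'I_n) : p.1 = p'.1 :> nat -> p.2 = p'.2 :> nat -> p = p'.
Proof. by case: p p' => a b [a' b'] /= /val_inj -> /val_inj ->. Qed.

Section Step.
Variables (k : 'I_n) (u : tableau n) (d : nat) (A : nat -> nat).
Hypothesis sA : strict_parts d A.
Hypothesis ti : tail_inv lam k.+1 u (boxn d A).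

Let pd := pt k d.-1 d.-1.
Let pv j := pt k (j + (A j).-1) j.
Let ph j := pt k j (j + (A j).-1).

Lemma box_ltn r c : boxn d A r c -> (r < n)%N /\ (c < n)%N.
Proof. by move=> /(ti_sub ti)/(part_bounds lamP); lia. Qed.

Lemma pd_val : (0 < d)%N -> A d.-1 = 1%N -> pd.1 = d.-1 :> nat /\ pd.2 = d.-1 :> nat.
Proof.
move=> d0 A1; have [b _ _] := diag_corner sA d0 A1; have [rn _] := box_ltn b.
exact: pt_val.
Qed.

Lemma pv_val j : (j < d)%N -> pair_ok d A j ->
  [/\ (pv j).1 = (j + (A j).-1)%N :> nat, (pv j).2 = j :> nat,
      (ph j).1 = j :> nat & (ph j).2 = (j + (A j).-1)%N :> nat].
Proof.
move=> jd ok; have [b _ _] := pair_corner sA jd ok; have [rn cn] := box_ltn b.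
by have [] := pt_val k rn cn; have [] := pt_val k cn rn.
Qed.

Lemma off_diag j : (j < d)%N -> pair_ok d A j ->
  (pv j).1 != (pv j).2 :> nat /\ (ph j).1 != (ph j).2 :> nat.
Proof.
move=> jd ok; have [e1 e2 e3 e4] := pv_val jd ok; have /andP[A1 _] := ok.
have ne : (j + (A j).-1 == j)%N = false.
  by rewrite -[X in _ == X]addn0 eqn_add2l -subn1 subn_eq0 leqNgt A1.
by split; [rewrite e1 e2 ne|rewrite e3 e4 eq_sym ne].
Qed.

Lemma ctn_pv j : (j < d)%N -> pair_ok d A j ->
  [/\ flip (pv j) = ph j, box_content (ph j) = (A j).-1%:Z, box_content (pv j) = - (A j).-1%:Z & pv j != ph j].
Proof.
move=> jd ok; have [e1 e2 e3 e4] := pv_val jd ok.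
have /andP[A1 _] := ok; split.
- by apply: pos_eq.
- by rewrite /box_content e3 e4; lia.
- by rewrite /box_content e1 e2; lia.
by apply/eqP => /(congr1 (fun p => nat_of_ord p.1)); rewrite e1 e3; lia.
Qed.

Lemma tail_diag : (0 < d)%N -> A d.-1 = 1%N ->
  tail_inv lam k (upd u k pd) (boxn d.-1 A) /\ box_content (upd u k pd k) = 0.
Proof.
move=> d0 A1; have [b h1 h2] := diag_corner sA d0 A1; have [e1 e2] := pd_val d0 A1.
split; last by rewrite ffunE eqxx /box_content e1 ?e2 subrr.
apply: (tail_inv_ext _ (tail_inv_step lamP (p := pd) ti _ _ _)) => [r c|||].
- by rewrite e1 ?e2 -boxn_remove_diag.
- by rewrite e1 ?e2.
- by move=> c; rewrite e1 ?e2; apply: h1.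
by move=> r; rewrite e1 ?e2; apply: h2.
Qed.

Lemma tail_pair (i : 'I_n.-1) j p p' : hi_ord i = k -> (j < d)%N -> pair_ok d A j ->
  (p = ph j /\ p' = pv j \/ p = pv j /\ p' = ph j) ->
  tail_inv lam i (upd (upd u k p') (lo_ord i) p) (boxn d (decr A j)).
Proof.
move=> hi jd ok pp; have [b h1 h2] := pair_corner sA jd ok.
have [e1 e2 e3 e4] := pv_val jd ok; have [_ _ _ ne] := ctn_pv jd ok.
have /andP[A1 _] := ok.
have key (p0 : 'I_n * 'I_n) : p0 = ph j \/ p0 = pv j ->
   [/\ boxn d A p0.1 p0.2, forall c, boxn d A p0.1 c -> (c <= p0.2)%N
     & forall r, boxn d A r p0.2 -> (r <= p0.1)%N].
  case=> ->; split; rewrite ?e1 ?e2 ?e3 ?e4 //.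
  - by rewrite boxn_sym.
  - by move=> c; rewrite boxn_sym; apply: h2.
  by move=> r; rewrite boxn_sym; apply: h1.
have [b' k1' k2'] := key p' (ltac:(case: pp => -[_ ->]; auto)).
have [b0 k1 k2] := key p (ltac:(case: pp => -[-> _]; auto)).
have npp : (nat_of_ord p.1, nat_of_ord p.2) != (nat_of_ord p'.1, nat_of_ord p'.2).
  apply: contra ne => /eqP[f1 f2]; apply/eqP; case: pp => -[ep ep'].
    by apply: pos_eq; rewrite -ep -ep'.
  by apply: pos_eq; rewrite -ep -ep'.
have st1 := tail_inv_step lamP ti b' k1' k2'.
have hk : (lo_ord i).+1 = k by rewrite -hi.
rewrite -hk in st1.
apply: (tail_inv_ext _ (tail_inv_step lamP st1 _ _ _)) => [r c|||].
- rewrite (boxn_remove_pair r c sA jd ok).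
  have f1 : (nat_of_ord (pv j).1, nat_of_ord (pv j).2) = ((j + (A j).-1)%N, j).
    by congr (_, _).
  have f2 : (nat_of_ord (ph j).1, nat_of_ord (ph j).2) = (j, (j + (A j).-1)%N).
    by congr (_, _).
  by case: pp => -[-> ->]; rewrite f1 f2 -!andbA //; do 2!congr (_ && _); rewrite andbC.
- by rewrite b0.
- by move=> c /andP[bc _]; apply: k1.
by move=> r /andP[bc _]; apply: k2.
Qed.

Lemma agree_pair t (i : 'I_n.-1) p p' : hi_ord i = k ->
  agree t (upd (upd u k p') (lo_ord i) p) i =
  [&& t (lo_ord i) == p, t k == p' & agree t u k.+1].
Proof.
move=> hi; rewrite -[nat_of_ord i]/(nat_of_ord (lo_ord i)) agree_upd; congr (_ && _).
have -> : (lo_ord i).+1 = k by rewrite -hi.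
exact: agree_upd.
Qed.

Variables (phi : int -> F) (linked : bool).
Hypothesis linkedP : linked = (0 < k)%N && (k.-1 \in map val s).

Let lo : 'I_n := insubd k k.-1.

Lemma lo_val : lo = k.-1 :> nat.
Proof. by rewrite val_insubd; case: ifP => //; have := ltn_ord k; lia. Qed.

Lemma out_diag (t : tableau n) : flip (t k) = t k -> out t k.+1 = 0.
Proof. by move=> e; rewrite (@out_val _ _ _ k) //; have := box_content_flip (t k); rewrite e; lia. Qed.

(** The entry k - 1 fills p, with content y, and k fills its mirror image p'; after the
    transposition k has content y, so that y enters both phi and alpha. *)
Let pair_term (t : tableau n) p p' y : F :=
  phi y * al2 y * (if [&& t lo == p, t k == p' & agree t u k.+1]
    then link_before lo (out t lo) y * mix_coef t lo else 0).

(** For a given t at most one summand is nonzero. The box of k is a corner of a self-conjugate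
    shape: the last diagonal box, or an end of one hook, and then k - 1 must fill the mirror
    image. *)
Lemma term_step (t : tableau n) : is_std lam t ->
  (if agree t u k.+1 then phi (out t k.+1) * mix_coef t k.+1 else 0) =
  (if (0 < d)%N && (A d.-1 == 1%N) then
     phi 0 * (if (t k == pd) && agree t u k.+1 then link_before k (out t k) 0 * mix_coef t k else 0) else 0) +
  (if linked then \sum_(j < d | pair_ok d A j)
     (pair_term t (ph j) (pv j) (A j).-1%:Z + pair_term t (pv j) (ph j) (- (A j).-1%:Z))
   else 0).
Proof.
move=> ts; have [ag|Nag] := boolP (agree t u k.+1); last first.
  rewrite andbF mulr0 if_same add0r; case: ifP => // _.
  by rewrite big1 // => j _; rewrite /pair_term (negbTE Nag) !andbF !mulr0 addr0.
rewrite andbT; have [bk kr kc] := tail_corner lamP ti ts ag.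
have cl : conj_closed t k.+1 by apply: (tail_closed lamP ti ts ag) => r c; exact: boxn_sym.
have nb1 : ~~ boxn d A (t k).1 (t k).2.+1 by apply/negP => /kr; rewrite ltnn.
have nb2 : ~~ boxn d A (t k).1.+1 (t k).2 by apply/negP => /kc; rewrite ltnn.
have [dk|ndk] := eqVneq (flip (t k)) (t k).
  have e12 : (t k).1 = (t k).2 :> nat by rewrite -{1}dk.
  rewrite e12 in bk nb1; have [ed A1] := corner_diag sA bk nb1.
  have d0 : (0 < d)%N by case/andP: bk => + _; apply: leq_ltn_trans.
  rewrite -ed in A1 *; rewrite d0 {1}A1 eqxx /=.
  have [p1 p2] := pd_val d0 (ltac:(by rewrite -ed)).
  have -> : t k == pd by apply/eqP/pos_eq; rewrite ?p1 ?p2 ?e12 ed.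
  rewrite out_diag // (mix_coef_diag q_neq0 lamP lamC actP s_sorted ts _ dk); last first.
    move=> l lk; have [l' ll' e] := cl l (ltnW lk); exists l' => //.
    rewrite ltn_neqAle -ltnS ll' andbT; apply: contraTneq lk => /val_inj e'.
    have : t l = t k by rewrite -dk -e' e flipK.
    by move/(std_inj ts) => ->; rewrite ltnn.
  rewrite -/(link_before k (out t k) 0) [X in _ = _ + X](_ : _ = 0) ?addr0 //.
  case: ifP => // _; apply: big1 => j ok; have [e1 e2 e3 e4] := pv_val (ltn_ord j) ok.
  have /andP[Aj _] := ok; rewrite /pair_term.
  have -> : t k == pv j = false.
    by apply/eqP => e; move: e12; rewrite e; apply/eqP; case: (off_diag (ltn_ord j) ok).
  have -> : t k == ph j = false.
    by apply/eqP => e; move: e12; rewrite e; apply/eqP; case: (off_diag (ltn_ord j) ok).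
  by rewrite !andbF !mulr0 addr0.
have n12 : (t k).1 != (t k).2 :> nat.
  by apply: contraNneq ndk => e; apply/eqP/pos_eq; rewrite /= e.
rewrite [X in _ = X + _](_ : _ = 0) ?add0r; last first.
  case: ifP => // /andP[d0 /eqP A1]; have [p1 p2] := pd_val d0 A1.
  case: eqP => [e|_]; last by rewrite mulr0.
  by move: n12; rewrite e p1 ?p2 eqxx.
have [jd ok mx] := corner_pair sA n12 bk nb1 nb2.
set j0 := minn (t k).1 (t k).2 in jd ok mx.
have [e1 e2 e3 e4] := pv_val jd ok; have [cjp c1 c2 np] := ctn_pv jd ok.
have /andP[Aj0 _] := ok.
have tk : t k = ph j0 \/ t k = pv j0.
  have [[m1 m2]|[m1 m2]] := minn_maxn_cases mx; [left|right]; apply: pos_eq.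
  - by rewrite e3.
  - by rewrite e4.
  - by rewrite e1.
  by rewrite e2.
(* Without the letter that joins k - 1 to k, the mirror image cannot be reached. *)
case linkE : linked; last first.
  rewrite (mix_coef_pair0 q_neq0 lamP lamC actP s_sorted ts cl ndk) ?mulr0 // => i hi ins.
  move: linkE; rewrite linkedP -hi /= => /negbT /negP[].
  by apply/mapP; exists i.
move: linkE; rewrite linkedP => /andP[k0 /mapP[i ins ki]].
have hi : hi_ord i = k by apply/val_inj; rewrite /= -[nat_of_ord i]ki prednK.
have loi : lo_ord i = lo by apply/val_inj; rewrite /= lo_val ki.
rewrite (bigD1 (Ordinal jd)) //= big1 ?addr0; last first.
  move=> j /andP[okj nj]; have [f1 f2 f3 f4] := pv_val (ltn_ord j) okj.
  have mj : t k = pv j \/ t k = ph j -> j0 = j.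
    case=> e; rewrite /j0 e; first by rewrite f1 f2 (minn_idPr (leq_addr _ _)).
    by rewrite f3 f4 (minn_idPl (leq_addr _ _)).
  have nj' : j0 != j :> nat by rewrite eq_sym -[j0]/(val (Ordinal jd)) val_eqE.
  rewrite /pair_term; case: (t k =P pv j) => [e|_].
    by case/eqP: nj'; apply: mj; left.
  case: (t k =P ph j) => [e|_]; first by case/eqP: nj'; apply: mj; right.
  by rewrite !andbF !mulr0 addr0.
have ek : k.+1 = i.+2 by rewrite -hi.
have [pr|npr] := eqVneq (t lo) (flip (t k)); last first.
  rewrite (mix_coef_pair0 q_neq0 lamP lamC actP s_sorted ts cl ndk) ?mulr0 => [|i' hi' ins']; last first.
    have -> // : lo_ord i' = lo.
    by apply/val_inj; rewrite /= lo_val -hi'.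
  rewrite /pair_term; case: (t k =P pv j0) => [e|_].
    rewrite e cjp in npr; rewrite e (negbTE npr) (negbTE np) /= !andbF.
    by rewrite !mulr0 addr0.
  rewrite andbF; case: (t k =P ph j0) => [e|_]; last by rewrite andbF !mulr0 addr0.
  rewrite e -cjp flipK in npr; by rewrite (negbTE npr) !mulr0 addr0.
have cl0 : conj_closed t i.
  move=> l li; have [|l' ll' e] := cl l; first by rewrite ek (leq_trans li) // -addn2 leq_addr.
  exists l' => //; rewrite ltnNge; apply/negP => il'.
  have [e'|e'] : l' = lo_ord i \/ l' = hi_ord i.
    rewrite ek in ll'; have [h|h] := leq_ltn_succ2 il' ll'.
      by left; apply/val_inj.
    by right; apply/val_inj.
  - have : t l = t k by rewrite -[RHS]flipK -pr -loi -e' e flipK.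
    by move=> /(std_inj ts) el; move: li; rewrite el -hi ltnNge /= leqnSn.
  have : t l = t lo by rewrite pr -hi -e' e flipK.
  by move=> /(std_inj ts) el; move: li; rewrite el -loi /= ltnn.
have cl' : conj_closed t i.+2 by rewrite -ek.
have pr' : t (lo_ord i) = flip (t (hi_ord i)) by rewrite loi hi.
have cf2 := mix_coef_pair q_neq0 lamP lamC actP s_sorted ts cl' cl0 ins pr'.
rewrite ek cf2 loi (@out_val _ _ _ k) -?hi // hi.
have -> : (if (0 < i)%N then linkat i.-1 (out t i) (box_content (t lo)) else 1) =
    link_before lo (out t lo) (box_content (t lo)) by rewrite -loi.
have -> : mix_coef t i = mix_coef t lo by rewrite -loi.
rewrite /pair_term ag !andbT.
case: tk => tk.
  have lo1 : t lo = pv j0 by rewrite pr tk -cjp flipK.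
  rewrite lo1 tk !eqxx (negbTE np) /= c1 c2.
  by rewrite mulr0 add0r !mulrA.
have lo1 : t lo = ph j0 by rewrite pr tk cjp.
rewrite lo1 tk !eqxx [ph j0 == pv j0]eq_sym (negbTE np) /= c1 c2 opprK.
by rewrite mulr0 addr0 !mulrA.
Qed.

Lemma tail_trace_step (W : nat -> nat -> (nat -> nat) -> int -> F) (r : nat) :
  linked = (2 <= r)%N ->
  (forall u', (0 < d)%N -> A d.-1 = 1%N -> tail_inv lam k u' (boxn d.-1 A) ->
     box_content (u' k) = 0 -> tail_trace k u' (fun x => link_before k x 0) = W r.-1 d.-1 A 0) ->
  (forall (i : 'I_n.-1) j u' y, (2 <= r)%N -> hi_ord i = k -> (j < d)%N -> pair_ok d A j ->
     y = (A j).-1%:Z \/ y = - (A j).-1%:Z -> tail_inv lam i u' (boxn d (decr A j)) ->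
     box_content (u' (lo_ord i)) = y -> tail_trace i u' (fun x => link_before i x y) = W r.-2 d (decr A j) y) ->
  tail_trace k.+1 u phi = step_sum q im rt phi W r d A.
Proof.
move=> lr Wdiag Wpair; rewrite /tail_trace big_mkcond.
under eq_bigr => t _ do rewrite term_step ?(valP t) //.
rewrite big_split /= /step_sum; congr (_ + _).
  case: ifP => [/andP[d0 /eqP A1]|_]; last by rewrite big1.
  have [ti' c0] := tail_diag d0 A1.
  rewrite -big_distrr -(Wdiag _ d0 A1 ti' c0) /tail_trace [in RHS]big_mkcond; congr (_ * _).
  by apply: eq_bigr => t _; rewrite agree_upd.
rewrite lr; case: ifP => [r2|_]; last by rewrite big1.
have /andP[k0 /mapP[i ins ki]] : (0 < k)%N && (k.-1 \in map val s) by rewrite -linkedP lr.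
have hi : hi_ord i = k by apply/val_inj; rewrite /= -[nat_of_ord i]ki prednK.
have loi : lo_ord i = lo by apply/val_inj; rewrite /= lo_val ki.
rewrite exchange_big; apply: eq_bigr => j ok; rewrite big_split /=.
have pairE p p' y : p = ph j /\ p' = pv j \/ p = pv j /\ p' = ph j ->
    y = (A j).-1%:Z \/ y = - (A j).-1%:Z -> box_content p = y ->
    \sum_(t : St) pair_term (val t) p p' y = phi y * al2 y * W r.-2 d (decr A j) y.
  move=> pp yy cp; have ti' := tail_pair hi (ltn_ord j) ok pp.
  rewrite -(Wpair i j _ y r2 hi (ltn_ord j) ok yy ti') ?ffunE ?eqxx //.
  rewrite /pair_term -big_distrr /tail_trace [in RHS]big_mkcond; congr (_ * _).
  by apply: eq_bigr => t _; rewrite (agree_pair _ _ _ hi) loi -loi.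
have [_ c1 c2 _] := ctn_pv (ltn_ord j) ok.
congr (_ + _); apply: pairE; auto.
Qed.

End Step.
End PrefixSums.

(** * The twisted trace block by block *)

Section BlockInduction.
Variables (F : fieldType) (n : nat) (lam : seq nat) (q im : F) (rt : nat -> F).
Hypothesis q_neq0 : q != 0.
Hypothesis qnat_neq0 : forall k, (1 <= k <= n)%N -> qnat q k != 0.
Hypothesis lamP : is_partition n lam.
Hypothesis lamC : conj_part lam = lam.
Variables (H : unitAlgType F) (T : 'I_n.-1 -> H).
Variable act : specht F n lam -> H -> specht F n lam.
Hypothesis actP : specht_action q im rt T act.
Variables (kappa : seq nat) (s : seq 'I_n.-1).
Hypothesis kappaP : is_composition n kappa.
Hypothesis s_word : map val s = comp_word 0 kappa.
Local Notation tail_trace := (tail_trace T act s).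
Local Notation prefix_sum := (prefix_sum q im rt).
Local Notation step_sum := (step_sum q im rt).

Lemma s_sorted : sorted ltn (map val s).
Proof. by rewrite s_word sorted_comp_word //; case/andP: kappaP. Qed.

Definition block_part (m : nat) : nat := (m.+1)./2.

Definition block_value (m : nat) : F :=
  if odd m then
    beta_part q im rt (block_part m) *
    hop_gen (Zpart q) (beta_part q im rt) (Zpart q (block_part m)) 0 (block_part m).-1
  else 0.

Definition blocks_value (k : seq nat) : F := \prod_(m <- k) block_value m.
Definition block_parts (k : seq nat) : seq nat := map block_part k.

(** The size identity needs all blocks odd. If an earlier block is even, its value 0 makes both
    sides of the later identities vanish. *)
Lemma hook_sum_block_parts k : all odd k ->
  hook_sum (size (block_parts k)) (nth 0%N (block_parts k)) = sumn k.
Proof.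
elim: k => [|m k IH] /=; first by rewrite /hook_sum big_ord0.
case/andP=> om ok; rewrite /hook_sum big_ord_recl /=.
rewrite -[X in (_ + X)%N]/(hook_sum (size (block_parts k)) (nth 0%N (block_parts k))) IH //.
by congr (_ + _)%N; rewrite /block_part; lia.
Qed.

Lemma blocks_value_even k : ~~ all odd k -> blocks_value k = 0.
Proof.
rewrite -has_predC => /hasP[m mk /= nm]; rewrite /blocks_value (big_rem m) //=.
by rewrite /block_value (negbTE nm) mul0r.
Qed.

Lemma blocks_value_rcons k m : blocks_value (rcons k m) = blocks_value k * block_value m.
Proof. by rewrite /blocks_value -cats1 big_cat big_seq1. Qed.

Lemma block_parts_gt0 k : 0%N \notin k -> all (leq 1) (block_parts k).
Proof.
by elim: k => //= m k IH; rewrite inE negb_or => /andP[m0 /IH ->]; rewrite /block_part andbT; lia.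
Qed.

Lemma prefix_sum0 als r d A y : prefix_sum 0 als r d A y = 0.
Proof. by rewrite /prefix_sum !mul0r. Qed.

Lemma eq_step_sum phi psi W r d A : phi =1 psi -> step_sum phi W r d A = step_sum psi W r d A.
Proof.
by move=> e; rewrite /step_sum e; congr (_ + _); case: ifP => // _; apply: eq_bigr => j _; rewrite !e.
Qed.

Lemma step_sum0 phi als r d A : step_sum phi (prefix_sum 0 als) r d A = 0.
Proof.
rewrite /step_sum prefix_sum0 mulr0 if_same add0r; case: ifP => // _.
by apply: big1 => j _; rewrite !prefix_sum0 !mulr0 addr0.
Qed.

Section OneBlock.
Variables (k1 : seq nat) (m0 : nat) (k2 : seq nat).
Hypothesis kappaE : kappa = k1 ++ m0 :: k2.
Local Notation N0 := (sumn k1).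
Local Notation K := (blocks_value k1).
Local Notation als := (block_parts k1).

Hypothesis IH : forall u d A, strict_parts d A -> hook_sum d A = N0 ->
  tail_inv lam N0 u (boxn d A) ->
  tail_trace N0 u (fun=> 1) = K * (size als == d)%:R * id_det F d (nth 0%N als) A.

Lemma block_facts : [/\ 0%N \notin k1, (0 < m0)%N & (N0 + m0 <= n)%N].
Proof.
case/andP: kappaP; rewrite kappaE mem_cat inE !negb_or sumn_cat /= => /and3P[h1 h2 h3] /eqP e.
by split=> //; lia.
Qed.

Lemma linked_in_block i : (i \in map val s) =
  [|| i \in comp_word 0 k1, (N0 <= i < N0 + m0.-1)%N | i \in comp_word (N0 + m0) k2].
Proof. by rewrite s_word kappaE comp_word_cat /= add0n !mem_cat mem_iota. Qed.

Lemma k2_pos : 0%N \notin k2.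
Proof. by case/andP: kappaP; rewrite kappaE mem_cat inE !negb_or => /and3P[]. Qed.

Lemma linked_at r : (r < m0)%N -> (0 < N0 + r)%N ->
  ((N0 + r).-1 \in map val s) = (0 < r)%N.
Proof.
have [h1 h2 h3] := block_facts => rm r0; rewrite linked_in_block.
have [r1|r1] := posnP r; last first.
  by apply/orP; right; apply/orP; left; lia.
apply/negP => /or3P[/(allP (comp_word_bound 0 h1))|h|/(allP (comp_word_bound _ k2_pos))] /=; lia.
Qed.

Lemma linked_step r (k : 'I_n) : k.+1 = (N0 + r)%N -> (0 < r <= m0)%N ->
  (0 < k)%N && (k.-1 \in map val s) = (2 <= r)%N.
Proof.
move=> ek /andP[r0 rm]; have [k0|k0] := posnP k; first by lia.
have e : k.-1 = (N0 + r.-1).-1 by lia.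
by rewrite e linked_at; lia.
Qed.

Lemma link_before_at r x y : (r < m0)%N ->
  link_before q s (N0 + r) x y = if (0 < r)%N then link q x y else 1.
Proof.
move=> rm; rewrite /link_before /linkat; case: ifP => [h|/negbT]; first by rewrite linked_at.
by case: r rm => // r _; lia.
Qed.

(** The next content differs up to sign from those at the ends of the half hooks; with the bound by
    n this keeps the denominators Zq |y| - Zq (A j - 1) nonzero. *)
Definition valid_next d (A : nat -> nat) (y : int) : Prop :=
  forall j, (j < d)%N -> `|y|%N != (A j).-1 /\ (`|y| + (A j).-1 < n)%N.

Lemma size_block_eq d A r : all odd k1 -> hook_sum d A = (N0 + r)%N ->
  hook_sum d A = (hook_sum (size als) (nth 0%N als) + r)%N.
Proof. by move=> o ->; rewrite hook_sum_block_parts. Qed.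

Lemma valid_diag d A : strict_parts d A -> (hook_sum d A <= n)%N -> (0 < d)%N ->
  A d.-1 = 1%N -> valid_next d.-1 A 0.
Proof.
move=> sA hn d0 A1 j jd; have jd' : (j < d.-1 < d)%N by lia.
have h1 := sA.2 _ _ jd'; rewrite A1 in h1.
have jd2 : (j < d)%N by lia.
by have := hook_sum_ge1 A jd2; split; lia.
Qed.

Lemma valid_pair d A j y : strict_parts d A -> (hook_sum d A <= n)%N -> (j < d)%N ->
  (1 < A j)%N -> y = (A j).-1%:Z \/ y = - (A j).-1%:Z -> valid_next d (decr A j) y.
Proof.
move=> sA hn jd A1 yy k kd; have ey : `|y|%N = (A j).-1 by case: yy => ->; lia.
rewrite ey /decr; have hj := hook_sum_ge1 A jd; case: (k =P j) => [->|/eqP ne]; first by split; lia.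
have hk := hook_sum_ge sA jd kd; rewrite eq_sym in ne; have {}hk := hk ne.
have n1 : A j != A k by apply: contraNneq ne => /(strict_inj sA jd kd) ->.
by have := sA.1 k kd; split; lia.
Qed.

(** Induction on the number of entries in the current block: [tail_trace_step] on the side of the
    tableaux meets [prefix_sum_link] on the side of the closed form. *)
Lemma tail_trace_block r : (r < m0)%N -> forall u d A y, strict_parts d A ->
  hook_sum d A = (N0 + r)%N -> tail_inv lam (N0 + r) u (boxn d A) -> valid_next d A y ->
  tail_trace (N0 + r) u (fun x => link_before q s (N0 + r) x y) = prefix_sum K als r d A y.
Proof.
have [k10 m00 nm] := block_facts.
elim/ltn_ind: r => r IHr rm u d A y sA hs ti vy.
have hn : (hook_sum d A <= n)%N by rewrite hs; lia.
have [r0|r0] := posnP r.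
  move: hs ti; rewrite r0 addn0 => hs ti.
  transitivity (tail_trace N0 u (fun=> 1)).
    by apply: eq_bigr => t _; have := @link_before_at 0 (out (val t) N0) y m00; rewrite addn0 => ->.
  rewrite (IH sA hs ti) /prefix_sum /= addn0 mulr1.
  have [ev|od] := boolP (all odd k1); last by rewrite blocks_value_even // !mul0r.
  have [de|_] := eqVneq (size als) d; last by rewrite !mulr0n !(mulr0, mul0r).
  (* No particle has hopped in this block yet: the totals agree, and the hopping determinant is the
     one of the delta symbols. *)
  congr (_ * _); rewrite hop_det_id //.
  have := hook_sumE sA; have := hook_sum_seq (block_parts_gt0 k10).
  by rewrite hook_sum_block_parts // de hs; lia.
have kn : ((N0 + r).-1 < n)%N by lia.
pose k := Ordinal kn; have ek : k.+1 = (N0 + r)%N by rewrite /= prednK //; lia.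
have kN : k = (N0 + r.-1)%N :> nat by rewrite /=; lia.
rewrite -ek in ti.
have -> : tail_trace (N0 + r) u (fun x => link_before q s (N0 + r) x y) =
  tail_trace k.+1 u (fun x => link_before q s (N0 + r) x y) by rewrite ek.
rewrite (@tail_trace_step F n lam q im rt q_neq0 lamP lamC H T act actP s s_sorted k u d A sA ti
  (fun x => link_before q s (N0 + r) x y) (2 <= r)%N _ (prefix_sum K als) r) //; first 1 last.
- by rewrite -(@linked_step r k ek) // r0 ltnW.
- move=> u' d0 A1 ti' _; rewrite kN in ti' *.
  apply: IHr => //; [lia|lia|exact: strict_parts_pred| |exact: valid_diag].
  by have := hook_sum_pred d0 A1; lia.
- move=> i j u' y' r2 hi jd ok yy ti' _; have /andP[A1 _] := ok.
  have ik : i.+1 = k :> nat by rewrite -hi.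
  have iN : i = (N0 + r.-2)%N :> nat by rewrite kN in ik; lia.
  rewrite iN in ti' *.
  apply: IHr => //; [lia|lia|exact: strict_parts_decr| |exact: valid_pair].
  by have := hook_sum_decr jd A1; lia.
rewrite (@eq_step_sum _ (fun x => link q x y)); last by move=> x; rewrite link_before_at // r0.
have [ev|od] := boolP (all odd k1); last first.
  by rewrite (blocks_value_even od) step_sum0 prefix_sum0.
apply: (prefix_sum_link im rt q_neq0 qnat_neq0) => //; first exact: block_parts_gt0.
exact: size_block_eq.
Qed.

Lemma tail_trace_block_end u d A : strict_parts d A ->
  hook_sum d A = (N0 + m0)%N -> tail_inv lam (N0 + m0) u (boxn d A) ->
  tail_trace (N0 + m0) u (fun=> 1) = blocks_value (rcons k1 m0) *
    (size (block_parts (rcons k1 m0)) == d)%:R * id_det F d (nth 0%N (block_parts (rcons k1 m0))) A.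
Proof.
have [k10 m00 nm] := block_facts => sA hs ti.
have hn : (hook_sum d A <= n)%N by rewrite hs; lia.
have kn : ((N0 + m0).-1 < n)%N by lia.
pose k := Ordinal kn; have ek : k.+1 = (N0 + m0)%N by rewrite /= prednK //; lia.
have kN : k = (N0 + m0.-1)%N :> nat by rewrite /=; lia.
rewrite -ek in ti.
have -> : tail_trace (N0 + m0) u (fun=> 1) = tail_trace k.+1 u (fun=> 1) by rewrite ek.
rewrite (@tail_trace_step F n lam q im rt q_neq0 lamP lamC H T act actP s s_sorted k u d A sA ti
  (fun=> 1) (2 <= m0)%N _ (prefix_sum K als) m0) //; first 1 last.
- by rewrite -(@linked_step m0 k ek) // m00 leqnn.
- move=> u' d0 A1 ti' _; rewrite kN in ti' *.
  apply: tail_trace_block => //; [lia|exact: strict_parts_pred| |exact: valid_diag].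
  by have := hook_sum_pred d0 A1; lia.
- move=> i j u' y' r2 hi jd ok yy ti' _; have /andP[A1 _] := ok.
  have ik : i.+1 = k :> nat by rewrite -hi.
  have iN : i = (N0 + m0.-2)%N :> nat by rewrite kN in ik; lia.
  rewrite iN in ti' *.
  apply: tail_trace_block => //; [lia|exact: strict_parts_decr| |exact: valid_pair].
  by have := hook_sum_decr jd A1; lia.
rewrite blocks_value_rcons /block_parts map_rcons -/als.
have [ev|od] := boolP (all odd k1); last first.
  by rewrite (blocks_value_even od) step_sum0 !mul0r.
rewrite [block_value m0]/block_value; case: ifP => om.
  apply: (prefix_sum_end_odd im rt q_neq0 qnat_neq0) => //; first exact: block_parts_gt0.
  exact: size_block_eq.
rewrite mulr0 !mul0r; apply: (@prefix_sum_end_even F n q) => //.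
- exact: block_parts_gt0.
- exact: size_block_eq.
by rewrite om.
Qed.

End OneBlock.

(** The shape stays arbitrary in the induction over blocks, because removing the entries of the last
    block leads to many smaller shapes. *)
Theorem tail_trace_prefix k1 k2 : kappa = k1 ++ k2 -> forall u d A, strict_parts d A ->
  hook_sum d A = sumn k1 -> tail_inv lam (sumn k1) u (boxn d A) ->
  tail_trace (sumn k1) u (fun=> 1) = blocks_value k1 * (size (block_parts k1) == d)%:R *
    id_det F d (nth 0%N (block_parts k1)) A.
Proof.
elim/last_ind: k1 k2 => [|k1 m0 IH] k2 ek u d A sA hs ti.
  have d0 : d = 0%N.
    apply/eqP; rewrite -leqn0 leqNgt; apply/negP => d0.
    have := hook_sum_ge1 A d0; have := sA.1 0%N d0; rewrite hs /=; lia.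
  rewrite d0 eqxx mulr1 /id_det det_mx00 mulr1 /blocks_value big_nil /tail_trace.
  have [u0 eu] := bvec_val (tail_std ti).
  rewrite (bigD1 u0) /=; last by apply/agreeP => k _; rewrite eu.
  rewrite mul1r (mix_coef0 q_neq0 lamP actP s_sorted) ?(valP u0) // big1 ?addr0 // => t /andP[/agreeP ag ne].
  case/eqP: ne; apply/val_inj/ffunP => k; rewrite ag // -eu.
  by [].
rewrite sumn_rcons in hs ti *.
have ek' : kappa = k1 ++ m0 :: k2 by rewrite ek cat_rcons.
exact: (tail_trace_block_end ek' (IH _ ek') sA hs ti).
Qed.

End BlockInduction.

Lemma sum_lt m N : (m <= N)%N -> (\sum_(i < N) (i < m) = m)%N.
Proof.
move=> mN; rewrite -[RHS]card_ord -sum1_card (big_ord_widen N (fun=> 1%N) mN).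
by rewrite [RHS]big_mkcond; apply: eq_bigr => i _; case: ltnP.
Qed.

(** * Self-conjugate partitions *)

Section SelfConjugate.
Variables (n : nat) (lam : seq nat).
Hypothesis lamP : is_partition n lam.
Hypothesis lamC : conj_part lam = lam.
Local Notation d := (diag_len lam).
Local Notation ln := (nth 0%N lam).

Definition half_hook (i : nat) : nat := (ln i - i)%N.

Lemma self_conjE r c : (r < ln c)%N = (c < ln r)%N.
Proof. by rewrite -(conj_partE lamP) lamC. Qed.

Lemma part_antitone r s : (r <= s)%N -> (ln s <= ln r)%N.
Proof.
move=> rs; rewrite leqNgt; apply/negP => lt.
have := self_conjE (ln r) s; rewrite lt => /esym h.
have h' : (r < ln (ln r))%N by apply: leq_ltn_trans h.
by move: h'; rewrite self_conjE ltnn.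
Qed.

Lemma diag_lenE j : (j < d)%N = (j < ln j)%N.
Proof.
apply/idP/idP => [|lt].
  apply: contraLR; rewrite -!leqNgt => le; apply/bigmax_leqP_seq => i.
  rewrite mem_index_iota => /andP[i1 _] il; rewrite leqNgt; apply/negP => ji.
  have h : (j <= i.-1)%N by lia.
  by have := part_antitone h; lia.
have js : (j < size lam)%N by rewrite ltnNge; apply/negP => /(nth_default 0%N) e; rewrite e in lt.
apply: (@leq_bigmax_seq _ _ (fun i => (i <= ln i.-1)%N) id j.+1) => //.
by rewrite mem_index_iota; lia.
Qed.

Lemma half_hook_strict : strict_parts d half_hook.
Proof.
split=> [j|j k /andP[jk]]; rewrite /half_hook diag_lenE; first by lia.
by move=> kl; have := part_antitone (ltnW jk); lia.
Qed.

Lemma boxn_half_hook r c : boxn d half_hook r c = (c < ln r)%N.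
Proof.
rewrite /boxn diag_lenE /half_hook; have [rc|cr] := leqP r c.
  by have := @part_antitone r c rc; lia.
by rewrite -[RHS]self_conjE; lia.
Qed.

Lemma part_le j : (ln j <= n)%N.
Proof.
rewrite leqNgt; apply/negP => h.
by have := part_bounds lamP h; lia.
Qed.

Lemma diag_len_le : (d <= n)%N.
Proof.
have [->//|d0] := posnP d; have : (d.-1 < d)%N by lia.
by rewrite diag_lenE => /(part_bounds lamP); lia.
Qed.

(** The boxes outside the first d rows lie in the first d columns, and by symmetry column c holds
    [ln c - d] of them. The sum of the first d odd numbers, d^2, then converts row lengths into half
    hooks. *)
Lemma hook_sum_half_hook : hook_sum d half_hook = n.
Proof.
have dn := diag_len_le.
have below (r : 'I_n) : ~~ (r < d)%N -> ln r = (\sum_(c < n | (c < d)%N) (c < ln r))%N.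
  move=> Nr; rewrite -{1}(sum_lt (part_le r)) [LHS](bigID (fun c : 'I_n => (c < d)%N)) /=.
  rewrite [X in (_ + X)%N]big1 ?addn0 // => c Nc.
  rewrite -(boxn_half_hook r c) /boxn; have -> // : (minn r c < d)%N = false by lia.
have tot : (\sum_(r < d) (ln r + (ln r - d)) = n)%N.
  rewrite -[RHS](sum_parts lamP) [RHS](bigID (fun r : 'I_n => (r < d)%N)) /=.
  rewrite [X in (_ + X)%N](eq_bigr (fun r : 'I_n => \sum_(c < n | (c < d)%N) (c < ln r))%N); last exact: below.
  rewrite exchange_big /= big_split /=.
  rewrite (big_ord_widen n (fun i => nth 0%N lam i) dn).
  rewrite (big_ord_widen n (fun i => ln i - d)%N dn).
  congr (_ + _)%N; apply: eq_bigr => c cd.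
  have dl : (d <= ln c)%N.
    have cd' : (c <= d.-1)%N by lia.
    have : (d.-1 < d)%N by lia.
    by rewrite diag_lenE; have := part_antitone cd'; lia.
  have := sum_lt (part_le c); rewrite (bigID (fun r : 'I_n => (r < d)%N)) /=.
  rewrite [X in (X + _)%N = _](_ : _ = d); last first.
    rewrite -[RHS](sum_lt dn) [LHS]big_mkcond; apply: eq_bigr => r _.
    by case: ltnP => // rd; rewrite (leq_trans rd dl).
  move=> e; rewrite (eq_bigr (fun r : 'I_n => ((r < ln c)%N : nat))).
    by rewrite -{1}e addKn.
  by move=> r _; rewrite self_conjE.
have sq : (\sum_(j < d) (2 * j).+1 = d * d)%N.
  by elim: (d) => [|k IH]; rewrite ?big_ord0 // big_ord_recr /= IH; lia.
have cst : (\sum_(j < d) d = d * d)%N by rewrite sum_nat_const card_ord.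
rewrite /hook_sum -[RHS]tot; apply: (@addIn (d * d)%N) => /=; rewrite -{1}sq -{1}cst -!big_split /=.
apply: eq_bigr => j _; have cd := ltn_ord j.
have cd' : (j <= d.-1)%N by lia.
have : (d.-1 < d)%N by lia.
rewrite diag_lenE; have := part_antitone cd'; rewrite /half_hook; lia.
Qed.

Lemma diag_hooksE : diag_hooks lam = [seq (2 * half_hook i).-1 | i <- iota 0 d].
Proof.
rewrite /diag_hooks lamC (iotaDl 1 0) -map_comp; apply/eq_in_map => i.
rewrite mem_iota add0n diag_lenE /= /half_hook add1n /= !add0n; lia.
Qed.

Lemma size_diag_hooks : size (diag_hooks lam) = d.
Proof. by rewrite size_map size_iota. Qed.

Lemma nth_diag_hooks j : (j < d)%N -> nth 0%N (diag_hooks lam) j = (2 * half_hook j).-1.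
Proof. by move=> jd; rewrite diag_hooksE (nth_map 0%N) ?size_iota // nth_iota. Qed.

Lemma diag_hooks_comp : is_composition n (diag_hooks lam).
Proof.
apply/andP; split.
  apply/(nthP 0%N) => -[j]; rewrite size_diag_hooks => jd; rewrite nth_diag_hooks //.
  by have := half_hook_strict.1 j jd; lia.
rewrite -hook_sum_half_hook diag_hooksE sumnE big_map -[d in iota 0 d]subn0.
by rewrite -[iota 0 _]/(index_iota 0 d) big_mkord.
Qed.

Lemma diag_hooks_sorted : sorted geq (diag_hooks lam).
Proof.
apply: (@path.pairwise_sorted _ geq); apply/(pairwiseP 0%N) => i j.
rewrite !inE size_diag_hooks => id jd ij; rewrite !nth_diag_hooks //=.
by have := half_hook_strict.2 i j; rewrite ij jd => /(_ isT); lia.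
Qed.

Lemma tail_inv_full (u : tableau n) : tail_inv lam n u (boxn d half_hook).
Proof.
have N (k : 'I_n) : (n <= k)%N -> False by rewrite leqNgt ltn_ord.
split; try by [move=> k /N|move=> k l /N|move=> k c /N].
  by move=> r c rc; left; rewrite boxn_half_hook.
by move=> r c; rewrite boxn_half_hook.
Qed.

End SelfConjugate.

(** * Explicit values of the twisted trace at the elements w_kappa *)

Section TwistedOnCompositions.
Variables (F : fieldType) (n : nat) (lam : seq nat) (q im : F) (rt : nat -> F).
Hypothesis q_neq0 : q != 0.
Hypothesis qnat_neq0 : forall k, (1 <= k <= n)%N -> qnat q k != 0.
Hypothesis lamP : is_partition n lam.
Hypothesis lamC : conj_part lam = lam.
Variables (H : unitAlgType F) (T : 'I_n.-1 -> H).
Hypothesis HT : hecke_relations q T.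
Variable act : specht F n lam -> H -> specht F n lam.
Hypothesis actP : specht_action q im rt T act.
Local Notation d := (diag_len lam).
Local Notation A := (half_hook lam).

Lemma chi_tau_w_comp kappa : is_composition n kappa ->
  chi_tau act (T_perm T (w_comp n kappa)) =
  blocks_value q im rt kappa * (size kappa == d)%:R *
  id_det F d (nth 0%N (block_parts kappa)) A.
Proof.
move=> kn; have [s [sw srt we]] := comp_word_ex kn.
have sz : size s = coxlen (word_perm s) by have [_ ->] := sorted_word srt.
have sn : sumn kappa = n by case/andP: kn => _ /eqP.
(* For m = n no entry is frozen, so any u will do. *)
pose u : tableau n := [ffun k => (k, k)].
have := @tail_trace_prefix F n lam q im rt q_neq0 qnat_neq0 lamP lamC H T act actP kappa s kn sw
  kappa [::] (esym (cats0 _)) u d A (half_hook_strict lamP lamC).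
rewrite sn (hook_sum_half_hook lamP lamC) size_map => <- //; last exact: tail_inv_full.
rewrite (chi_tauE actP) we (T_perm_word q_neq0 HT sz) /spur /tail_trace [RHS]big_mkcond /=.
apply: eq_bigr => t _; rewrite ifT; last by apply/agreeP => k; rewrite leqNgt ltn_ord.
have [t' et] := bvec_val (conj_tab_std lamP lamC (valP t)).
rewrite mul1r /mix_coef mix_full -et coef_std (tau_eval _ et) /partial_act.
congr (act _ (T_word T _) _); apply/esym/all_filterP/allP => i _.
by have := ltn_ord i; lia.
Qed.

(** The q-analogue of (l + 1)^2 - l^2 = 2l + 1. *)
Lemma Zq_diff l : Zq q l.+1 - Zq q l = qnat q (2 * l).+1 / q ^+ (2 * l).+1.
Proof.
have e1 : qnat q l.+1 = qnat q l + q ^+ (2 * l) * q by rewrite qnatS exprSr.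
have e2 : qnat q l.+1 = q + q ^+ 2 * qnat q l.
  by have := qintD q_neq0 1 l; rewrite qint1 -PoszD add1n !qint_nat.
have e3 : qnat q (2 * l).+1 = qnat q l + q ^+ (2 * l) * qnat q l.+1.
  have := qintD q_neq0 l l.+1; rewrite -PoszD !qint_nat -exprnP -exprM.
  by move=> <-; congr qnat; lia.
have -> : Zq q l.+1 - Zq q l = (qnat q l.+1 ^+ 2 - q ^+ 2 * qnat q l ^+ 2) / q ^+ (2 * l.+1).
  rewrite /Zq mulnS exprD; have := expf_neq0 (2 * l) q_neq0; move: (q ^+ (2 * l)) => X X0.
  by field; rewrite X0 q_neq0.
have -> : q ^+ (2 * l.+1) = q * q ^+ (2 * l).+1 by rewrite -exprS; congr (_ ^+ _); lia.
have -> : qnat q l.+1 ^+ 2 - q ^+ 2 * qnat q l ^+ 2 = q * qnat q (2 * l).+1.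
  rewrite e3 expr2 {2}e1 mulrDr.
  have -> : qnat q l.+1 * qnat q l = q * qnat q l + q ^+ 2 * qnat q l ^+ 2.
    by rewrite {1}e2; ring.
  by ring.
by rewrite invfM mulrACA divff // mul1r.
Qed.

Hypothesis rtP : forall k, (1 <= k <= n)%N -> rt k ^+ 2 = qnat q k.

Lemma rt_neq0 k : (1 <= k <= n)%N -> rt k != 0.
Proof. by move=> kn; have := qnat_neq0 kn; rewrite -rtP // sqrf_eq0. Qed.

(** Passing from l to l + 1 multiplies the value by im rt(2l+3) / (q rt(2l+1)), by [Zq_diff] and
    [2l+1] = rt(2l+1)^2. The product telescopes, with q = rt(1)^2. *)
Lemma block_value_odd l : ((2 * l).+1 <= n)%N ->
  block_value q im rt (2 * l).+1 = im ^+ l * rt 1 ^- (2 * l).+1 * rt (2 * l).+1.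
Proof.
move=> ln; rewrite /block_value oddS oddM /=.
have -> : ((2 * l)./2 = l)%N by lia.
have r1 : rt 1 != 0 by apply: rt_neq0; lia.
have q1 : rt 1 ^+ 2 = q by rewrite rtP; [rewrite /qnat big_ord1 muln0 expr1|lia].
elim: l ln => [|l IH] ln /=.
  by rewrite muln0 expr0 expr1 mul1r mulVf // mulr1.
have {}IH := IH (ltac:(lia)).
rewrite add0r {1}/beta_part /= {1}/Zpart {1}/Zpart /= in IH *.
have nk : (1 <= (2 * l).+1 <= n)%N by lia.
have r2 := rt_neq0 nk; have e3 := rtP nk.
move: IH; rewrite [beta_part q im rt l.+1 * _]mulrC => IH.
transitivity (beta q im rt l.+1 / (Zq q l.+1 - Zq q l) *
  (im ^+ l * rt 1 ^- (2 * l).+1 * rt (2 * l).+1)).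
  by rewrite -IH -!mulrA; congr (_ * (_ * _)); rewrite mulrC.
rewrite Zq_diff -e3 /beta.
have -> : (2 * l.+1).+1 = (2 * l).+3 by lia.
have -> : (2 * l.+1).-1 = (2 * l).+1 by lia.
have -> : (2 * l.+1)%N = (2 * l).+2 by lia.
rewrite [q ^+ (2 * l).+2]exprS -q1.
have := expf_neq0 (2 * l).+1 (expf_neq0 2 r1); move: ((rt 1 ^+ 2) ^+ _) => X X0.
have := expf_neq0 (2 * l).+1 r1; rewrite [rt 1 ^+ (2 * l).+3]exprS [rt 1 ^+ (2 * l).+2]exprS.
move: (rt 1 ^+ (2 * l).+1) => Y Y0; rewrite [im ^+ l.+1]exprS.
move: (rt (2 * l).+3) (rt (2 * l).+1) r2 (im ^+ l) (rt 1) r1 => a b b0 c e e0.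
by field; rewrite X0 Y0 b0 e0.
Qed.

Lemma sumn_odd k : all odd k -> sumn k = (size k + 2 * sumn (map half k))%N.
Proof. by elim: k => //= m k IH /andP[om /IH ->]; lia. Qed.

Lemma blocks_value_odd kappa : (sumn kappa <= n)%N -> all odd kappa ->
  blocks_value q im rt kappa =
  im ^+ ((sumn kappa - size kappa) %/ 2) * rt 1 ^- sumn kappa * \prod_(k <- kappa) rt k.
Proof.
move=> kn ok; have -> : ((sumn kappa - size kappa) %/ 2 = sumn (map half kappa))%N.
  by rewrite (sumn_odd ok) addKn mulKn.
elim: kappa kn ok => [|m k IH] /= kn.
  by rewrite /blocks_value !big_nil expr0 invr1 !mulr1.
case/andP=> om ok; rewrite /blocks_value !big_cons -/(blocks_value q im rt k) IH //; last by lia.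
have em : m = (2 * m./2).+1 by lia.
have bE := @block_value_odd m./2; rewrite -em in bE; rewrite bE; last by lia.
rewrite !exprD invfM; move: (rt 1 ^- m) (rt 1 ^- sumn k) (im ^+ _) (im ^+ _) (\prod_(j <- k) _).
by move=> a b c e f; ring.
Qed.

(** The determinant supplies a constant polynomial with integral coefficient, hence the passage from
    F to the integers. *)
Lemma id_det_intr al a : id_det F d al a =
  (\det (\matrix_(j < d, i < d) ((al i == a j)%:R : int)))%:~R.
Proof.
rewrite -[RHS]/(intmul 1 _) -det_map_mx; congr (\det _); apply/matrixP => j i.
by rewrite !mxE; case: eqP => _.
Qed.

(** A nonzero determinant has a nonzero term, which matches the parts (m + 1)/2 of the odd blocks
    with the half hooks, hence the blocks with the hooks. *)
Lemma id_det_neq0 kappa : all odd kappa -> size kappa = d ->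
  \det (\matrix_(j < d, i < d) ((nth 0%N (block_parts kappa) i == A j)%:R : int)) != 0 ->
  perm_eq kappa (diag_hooks lam).
Proof.
move=> ok sk ne.
have [s /forallP sP] : exists s : 'S_d, [forall j : 'I_d, nth 0%N (block_parts kappa) (s j) == A j].
  apply/existsP; apply: contraNT ne => /existsPn h; apply/eqP.
  apply: big1 => s _; have /forallPn[j nj] := h s.
  by rewrite (bigD1 j) //= mxE (negbTE nj) mul0r mulr0.
have szk : size kappa == d by rewrite sk.
apply: (@perm_trans _ (Tuple szk)) => //; rewrite perm_sym; apply/tuple_permP; exists s.
apply: (@eq_from_nth _ 0%N); first by rewrite size_diag_hooks // size_tuple.
move=> j; rewrite size_diag_hooks // => jd; rewrite (nth_diag_hooks lamP lamC) //.
rewrite -[j]/(nat_of_ord (Ordinal jd)) -tnth_nth tnth_mktuple (tnth_nth 0%N) /=.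
have sd : (s (Ordinal jd) < size kappa)%N by rewrite sk.
have := sP (Ordinal jd); rewrite (nth_map 0%N) // /block_part => /eqP /= <-.
by have := all_nthP 0%N ok _ sd; lia.
Qed.

Lemma chi_tau_w_comp_int kappa : is_composition n kappa ->
  exists e : int, chi_tau act (T_perm T (w_comp n kappa)) =
    e%:~R * ((- im) ^+ ((n - d) %/ 2) * rt 1 ^- n * \prod_(h <- diag_hooks lam) rt h) /\
    (e != 0 -> sort geq kappa = diag_hooks lam).
Proof.
move=> kn; rewrite chi_tau_w_comp // id_det_intr.
set D := \det _.
have [/eqP D0|D0] := boolP (D == 0).
  by exists 0; rewrite D0 mulr0 mul0r eqxx.
have [ok|od] := boolP (all odd kappa); last first.
  by exists 0; rewrite blocks_value_even // !mul0r eqxx.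
have [sk|sk] := eqVneq (size kappa) d; last first.
  by exists 0; rewrite mulr0 !mul0r eqxx.
have pe := id_det_neq0 ok sk D0.
(* The sign turns the power of im coming from the blocks into one of - im. *)
exists ((-1) ^+ ((n - d) %/ 2) * D); split=> [|_]; last first.
  apply: (@sorted_eq _ geq).
  - by move=> y x z /= xy yz; apply: leq_trans yz xy.
  - by move=> x y /anti_leq.
  - by apply: sort_sorted => x y; apply: leq_total.
  - exact: (diag_hooks_sorted lamP lamC).
  by rewrite perm_sort.
have sn : sumn kappa = n by case/andP: kn => _ /eqP.
rewrite blocks_value_odd ?sn // sk mulr1 rmorphM rmorphXn rmorphN1 /=.
rewrite (perm_big _ pe) [(- im) ^+ _]exprNn.
have := sqrr_sign F ((n - d) %/ 2).
move: ((-1) ^+ _) (im ^+ _) (_^-1) (\prod_(i <- _) _) (D%:~R) => a b c e f a2.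
by rewrite mulrACA mulrCA -[LHS]mul1r -a2; ring.
Qed.

End TwistedOnCompositions.

Theorem corollary6p12 (F : fieldType) (n : nat) (n_ge2 : (2 <= n)%N)
  (charF : 2%:R != 0 :> F)
  (q : F) (q_neq0 : q != 0)
  (im : F) (imP : im ^+ 2 = -1)
  (rt : nat -> F) (rt0 : rt 0%N = 0)
  (rtP : forall k, (1 <= k <= n)%N -> qnat q k != 0 /\ rt k ^+ 2 = qnat q k)
  (H : unitAlgType F) (T : 'I_n.-1 -> H) (HP : hecke_presentation q T)
  (sharp : {lrmorphism H -> H}) (sharpP : is_sharp T sharp)
  (act : forall lam : seq nat, specht F n lam -> H -> specht F n lam)
  (actP : forall lam, is_partition n lam ->
            specht_action q im rt T (@act lam))
  (wC : {set 'S_n} -> 'S_n)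
  (wCP : forall C, C \in classes (Alt 'I_n) -> wC C \in min_length C)
  (w : 'S_n) (wA : w \in (Alt 'I_n)) :
  exists g : {set 'S_n} -> half_laurent,
    (forall mu, is_partition n mu ->
       chi (@act mu) (A_perm T sharp w) =
       \sum_(C in classes (Alt 'I_n))
          hl_eval (g C) q * chi (@act mu) (A_perm T sharp (wC C)))
    /\
    forall lam, is_partition n lam -> conj_part lam = lam ->
      exists a : {poly int},
        [/\ a != 0 ->
              ((size a).-1 + coxlen (w_comp n (diag_hooks lam)) <= coxlen w)%N,
            chi_tau (@act lam) (T_perm T w) = diag_factor n q im rt lam a,
            a != 0 -> exists kappa, [/\ is_composition n kappa,
              sort geq kappa = diag_hooks lam & reduces_to w (w_comp n kappa)]
          & forall e : bool,
              chi_half (@act lam) e (A_perm T sharp w) =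
              2%:R^-1 * (\sum_(C in classes (Alt 'I_n))
                 hl_eval (g C) q * chi (@act lam) (A_perm T sharp (wC C)))
              + (-1) ^+ e * (2%:R^-1 * diag_factor n q im rt lam a)].
Proof.
have n_gt0 : (0 < n)%N by apply: ltnW.
have HT : hecke_relations q T by case: HP.
have qnat_neq0 k : (1 <= k <= n)%N -> qnat q k != 0 by move=> /rtP[].
have sqrt_qnat k : (1 <= k <= n)%N -> rt k ^+ 2 = qnat q k by move=> /rtP[].
have [c cL cE] := class_span_T_perm q_neq0 charF n_gt0 HT sharpP wCP w.
(* Both the coefficients and the Laurent polynomials representing them are fixed before any mu is
   considered. *)
have [g gE] : exists g : {set 'S_n} -> half_laurent, forall C, hl_eval (g C) q = c C.
  exact: (fin_all_exists cL).
have even_w : ~~ odd_perm w by rewrite -Alt_even.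
have even_wC C : C \in classes (Alt 'I_n) -> ~~ odd_perm (wC C).
  move=> CA; rewrite -Alt_even; have := wCP _ CA; rewrite inE => /andP[+ _].
  case/imsetP: CA => x xA -> /imsetP[y yA ->].
  by rewrite groupJ.
have chiE mu : is_partition n mu -> chi (@act mu) (A_perm T sharp w) =
    \sum_(C in classes (Alt 'I_n)) hl_eval (g C) q * chi (@act mu) (A_perm T sharp (wC C)).
  move=> muP; rewrite (chi_A_perm sharp (actP _ muP)) //.
  (* As w and the w_C are even, the averaged character takes at T_w and T_(w_C) the values of the
     character at A_w and A_(w_C). *)
  rewrite (cE (fun h => 2%:R^-1 * (chi (@act mu) h + chi (@act mu) (sharp h)))); last first.
    exact: (chi_sym_alt_trace q_neq0 HT sharpP (actP _ muP)).
  apply: eq_bigr => C CA; rewrite gE; congr (_ * _).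
  by rewrite (chi_A_perm sharp (actP _ muP)) // even_wC.
exists g; split=> // lam lamP lamC.
have [a [dega valA reda]] := twisted_trace_T_perm q_neq0 n_gt0 HT
  (chi_tau_twisted q_neq0 charF n_ge2 qnat_neq0 lamP HT sharpP (actP _ lamP) lamC)
  (diag_hooks_comp lamP lamC)
  (chi_tau_w_comp_int q_neq0 qnat_neq0 lamP lamC HT (actP _ lamP) sqrt_qnat) w.
have tauE : chi_tau (@act lam) (T_perm T w) = diag_factor n q im rt lam a.
  by rewrite valA /diag_factor !mulrA [int_eval _ _ * _]mulrC.
exists a; split=> // e.
by rewrite (chi_half_A_perm q_neq0 charF n_ge2 qnat_neq0 lamP HT sharpP (actP _ lamP) lamC) // tauE chiE.
Qed.
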